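(* Let $T>0$. Weak entropy solutions of the periodic Fornberg–Whitham problem on $\mathbb{T}\times[0,T]$ (as defined in the context) are unique. More precisely, if $u$ and $v$ are weak entropy solutions on $\mathbb{T}\times[0,T]$ with initial values $u_0\in L^\infty(\mathbb{T})$ and $v_0\in L^\infty(\mathbb{T})$, respectively, then for every $t\in[0,T]$, $$\int_{\mathbb{T}}|u(x,t)-v(x,t)|\,dx\le e^{t\|K'\|_{L^\infty(\mathbb{T})}}\int_{\mathbb{T}}|u_0(x)-v_0(x)|\,dx .$$
   Context: $\mathbb{T}=\mathbb{R}/\mathbb{Z}$, functions on $\mathbb{T}$ identified with $1$-periodic functions on $\mathbb{R}$. The Fornberg–Whitham problem is $u_t+uu_x+(1-\partial_x^2)^{-1}u_x=0$ for $x\in\mathbb{T},t>0$, $u(x,0)=u_0(x)$. Let $K:\mathbb{T}\to\mathbb{R}$ be given on $[0,1]$ by $K(x)=\frac{\sqrt e}{e-1}\cosh(x-\tfrac12)$, extended periodically; then $(1-\partial_x^2)^{-1}w_x=K'\ast w$ (convolution in $x$ over $\mathbb{T}$), where $K'$ is bounded. Given $u_0\in L^\infty(\mathbb{T})$ and $T>0$, a function $u\in L^\infty(\mathbb{T}\times[0,T])$ is a weak entropy solution if for every $\lambda\in\mathbb{R}$ and every nonnegative $C^1$ function $\phi$ with compact support in $\mathbb{T}\times\mathbb{R}$, $$0\le\int_0^T\!\!\int_{\mathbb{T}}\Big(|u-\lambda|\,\partial_t\phi+\operatorname{sgn}(u-\lambda)\tfrac{u^2-\lambda^2}{2}\partial_x\phi-\operatorname{sgn}(u-\lambda)\,\big(K'\ast(u(\cdot,t)-\lambda)\big)(x)\,\phi\Big)dx\,dt+\int_{\mathbb{T}}|u_0(x)-\lambda|\phi(x,0)\,dx,$$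 where $u=u(x,t)$, $\phi=\phi(x,t)$. Such $u$ are taken (after modification on a null set) to be the representative for which $t\mapsto u(\cdot,t)$ is weak-$*$ continuous $[0,T]\to L^\infty(\mathbb{T})$. *)

(* Defs.v *)
From HB Require Import structures.
From mathcomp Require Import all_boot all_order all_algebra.
From mathcomp Require Import all_classical all_reals all_analysis ess_sup_inf.
Set Implicit Arguments. Unset Strict Implicit. Unset Printing Implicit Defensive.
Import Order.TTheory GRing.Theory Num.Theory.
Import numFieldNormedType.Exports.
Local Open Scope classical_set_scope.
Local Open Scope ring_scope.

Section FW.
Context {R : realType}.

Notation leb := (@lebesgue_measure R).

Definition fracR (x : R) : R := x - (Num.floor x)%:~R.

Definition Kconst : R := Num.sqrt (expR 1) / (expR 1 - 1).

Definition Kfun (x : R) : R :=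
  Kconst * ((expR (fracR x - 2^-1) + expR (- (fracR x - 2^-1))) / 2).

(* K'(x) = sqrt e/(e-1) sinh(x - 1/2) on (0,1), extended 1-periodically
   (the value at the integers is irrelevant: a null set) *)
Definition Kp (x : R) : R :=
  Kconst * ((expR (fracR x - 2^-1) - expR (- (fracR x - 2^-1))) / 2).

Definition Kp_Linf_norm : R := fine (ess_sup leb (fun x => (`|Kp x|)%:E)).

Definition periodic1 (f : R -> R) : Prop := forall x, f (x + 1) = f x.

Definition Linf_T (f : R -> R) : Prop :=
  periodic1 f /\ measurable_fun [set: R] f /\
  exists M : R, {ae leb, forall x, `|f x| <= M}.

Definition convT (k w : R -> R) (x : R) : R :=
  Rintegral leb `[0, 1] (fun y => k (x - y) * w y).

(* phi : T x R -> R nonnegative, C^1 (continuous partial derivatives phix,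
   phit), with compact support in T x R (i.e. bounded support in t). *)
Definition test_fun (phi phix phit : R -> R -> R) : Prop :=
  (forall x t, 0 <= phi x t) /\
  (forall x t, phi (x + 1) t = phi x t) /\
  (exists B : R, forall x t, B < `|t| -> phi x t = 0) /\
  (forall x t : R, is_derive x (1 : R) (fun y => phi y t) (phix x t)) /\
  (forall x t : R, is_derive t (1 : R) (fun s => phi x s) (phit x t)) /\
  continuous (fun p : R * R => phi p.1 p.2) /\
  continuous (fun p : R * R => phix p.1 p.2) /\
  continuous (fun p : R * R => phit p.1 p.2).

Definition entropy_integrand (u : R -> R -> R) (lam : R)
  (phi phix phit : R -> R -> R) (p : R * R) : R :=
  let x := p.1 in let t := p.2 in
  `|u x t - lam| * phit x t
  + Num.sg (u x t - lam) * ((u x t ^+ 2 - lam ^+ 2) / 2) * phix x t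
  - Num.sg (u x t - lam) * convT Kp (fun y => u y t - lam) x * phi x t.

(* u is a weak entropy solution on T x [0,T] with initial value u0,
   taken in its representative for which t |-> u(.,t) is weak-* continuous
   [0,T] -> L^oo(T) = (L^1(T))^*. *)
Definition weak_entropy_solution (T : R) (u0 : R -> R) (u : R -> R -> R) : Prop :=
  (forall x t, u (x + 1) t = u x t) /\
  measurable_fun ([set: R] `*` `[0, T]) (fun p : R * R => u p.1 p.2) /\
  (exists M : R, {ae (leb \x leb)%E, forall p : R * R,
      p \in [set: R] `*` `[0, T] -> `|u p.1 p.2| <= M}) /\
  (forall t, t \in `[0, T] -> Linf_T (fun x => u x t)) /\
  (forall g : R -> R, leb.-integrable `[0, 1] (fun x => (g x)%:E) ->
     {within `[0, T], continuous (fun t => Rintegral leb `[0, 1] (fun x => u x t * g x))}) /\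
  (forall (lam : R) (phi phix phit : R -> R -> R),
     test_fun phi phix phit ->
     (0 <= \int[(leb \x leb)%E]_(p in `[0%R, 1%R] `*` `[0%R, T])
              (entropy_integrand u lam phi phix phit p)%:E
         + \int[leb]_(x in `[0%R, 1%R]) (`|u0 x - lam| * phi x 0)%:E)%E).

End FW.

(* Main.v *)
Require Import Defs.
From HB Require Import structures.
From mathcomp Require Import all_boot all_order all_algebra.
From mathcomp Require Import all_classical all_reals all_analysis ess_sup_inf.
From mathcomp Require Import measurable_realfun lra ring.
Import Order.TTheory GRing.Theory Num.Theory.
Import numFieldNormedType.Exports.
Local Open Scope classical_set_scope.
Local Open Scope ring_scope.

(* Kruzhkov's doubling of variables.  The inequality for u at (x,t) with
   lambda = v(y,s) and the one for v at (y,s) with lambda = u(x,t) are tested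
   with eta(t) k_h(s - t) rho_e(x - y), where k_h is a bump supported in (0,h)
   and rho_e its 1-periodic analogue of width e.  As K' has mean zero, lambda
   drops out of the nonlocal term.  Since k_h only sees s > t, the initial term
   of v vanishes, and that of u is controlled by one more use of the inequality
   for v, with lambda = u0(x) and the test function rho_e(x - y) (1 - S(s/h)),
   S' = bump.
   Let first h -> 0, then e -> 0.  No strong continuity in time is needed: |u - v|
   is bounded below by sgn(u(x,t) - v(x,t)) times the doubled difference, which
   is linear in v(y,s), so that weak-* continuity suffices for h -> 0; for e -> 0
   one uses Lebesgue points in x only.
   With A(t) = int |u - v| dx and eta(t) = exp(-kt) chi(t), k = ||K'||_oo, the
   nonlocal term k eta A is absorbed by -eta', which makes Gronwall's lemma
   superfluous: int A exp(-kt) (-chi') dt <= A(0).  Concentrating -chi' near t0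
   and testing with sgn((u - v)(., t0)) gives the bound at every t0. *)

(** * Bounded measurable functions *)

(** When the two inequalities are added, every derivative of a kernel cancels: those of [kern] in s
    and t, and those of [pkern] in x and y, are opposite, while the flux is symmetric in u and
    lambda. Besides the initial term, only |u - v| eta' and the nonlocal term survive. The order of
    the limits is forced. Weak-* continuity gives pointwise information in time only after
    integration against a fixed function of x, namely [pkern] at fixed e or a translate of [Kp], so
    h must vanish while e is still positive. As [kern] is one-sided, part of it leaves [0, T] when t
    is within h of T, and its mass drops below 1 there. The absorption of the nonlocal term survives
    because eta is chosen with eta' + k eta = 0 near T. Taking lambda = v(y,s) or u(x,t) at every
    point, and exchanging fourfold integrals, calls for functions measurable on the whole plane and
    bounded everywhere, not just almost everywhere. The argument therefore runs inside the class
    [bm], and arbitrary solutions are truncated at the end. *)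

Definition bm {d} {T : measurableType d} {R : realType} (f : T -> R) :=
  measurable_fun setT f /\ exists M : R, forall x, `|f x| <= M.

Lemma bm_cst {d} {T : measurableType d} {R : realType} (c : R) :
  bm (fun _ : T => c).
Proof. by split => //; exists `|c|. Qed.

Lemma bmD {d} {T : measurableType d} {R : realType} (f g : T -> R) :
  bm f -> bm g -> bm (fun x => f x + g x).
Proof.
move=> [mf [M fM]] [mg [N gN]]; split; first exact: measurable_funD.
by exists (M + N) => x; rewrite (le_trans (ler_normD _ _))// lerD.
Qed.

Lemma bmN {d} {T : measurableType d} {R : realType} (f : T -> R) :
  bm f -> bm (fun x => - f x).
Proof.
move=> [mf [M fM]]; split; first exact: measurableT_comp.
by exists M => x; rewrite normrN.
Qed.

Lemma bmB {d} {T : measurableType d} {R : realType} (f g : T -> R) :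
  bm f -> bm g -> bm (fun x => f x - g x).
Proof. by move=> bf bg; apply: bmD => //; exact: bmN. Qed.

Lemma bmM {d} {T : measurableType d} {R : realType} (f g : T -> R) :
  bm f -> bm g -> bm (fun x => f x * g x).
Proof.
move=> [mf [M fM]] [mg [N gN]]; split; first exact: measurable_funM.
by exists (M * N) => x; rewrite normrM ler_pM.
Qed.

Lemma bm_norm {d} {T : measurableType d} {R : realType} (f : T -> R) :
  bm f -> bm (fun x => `|f x|).
Proof.
move=> [mf [M fM]]; split; first exact: measurableT_comp.
by exists M => x; rewrite normr_id.
Qed.

Lemma measurable_sg {R : realType} : measurable_fun [set: R] (@Num.sg R).
Proof.
rewrite (_ : @Num.sg R = fun x => if x == 0 then 0 else if x < 0 then -1 else 1).
  apply: measurable_fun_ifT => //; first exact: measurable_fun_eqr.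
  by apply: measurable_fun_ifT => //; exact: measurable_fun_ltr.
by apply/funext => x; rewrite /Num.sg; case: (x == 0).
Qed.

Lemma bm_sg {d} {T : measurableType d} {R : realType} (f : T -> R) :
  measurable_fun setT f -> bm (fun x => Num.sg (f x)).
Proof.
move=> mf; split; first by apply: measurableT_comp => //; exact: measurable_sg.
by exists 1 => x; rewrite normr_sg; case: (f x == 0) => //=; rewrite ler01.
Qed.

Lemma bm_comp {d d'} {T : measurableType d} {T' : measurableType d'} {R : realType}
  (f : T -> R) (g : T' -> T) : bm f -> measurable_fun setT g -> bm (fun x => f (g x)).
Proof.
by move=> [mf [M fM]] mg; split; [exact: measurableT_comp|exists M].
Qed.

Definition findom {d} {T : measurableType d} {R : realType}
  (mu : set T -> \bar R) (D : set T) := measurable D /\ (mu D < +oo)%E.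

Lemma bm_integrable {d} {T : measurableType d} {R : realType}
  (mu : {measure set T -> \bar R}) (D : set T) (f : T -> R) :
  findom mu D -> bm f -> mu.-integrable D (EFin \o f).
Proof.
move=> [mD fD] [mf [M fM]]; apply: measurable_bounded_integrable => //.
  exact: measurable_funTS.
by exists M; split => [|x Mx y _]; [exact: num_real|exact: le_trans (fM y) (ltW Mx)].
Qed.

(** Tonelli yields measurability of partial integrals for nonnegative integrands. So [f + M], cut
    off outside [D], is integrated, and the contribution of the constant [M] is subtracted
    afterwards. *)
Lemma bm_int {d1 d2} {T1 : measurableType d1} {T2 : measurableType d2}
  {R : realType} (mu : {sigma_finite_measure set T2 -> \bar R}) (D : set T2)
  (f : T1 -> T2 -> R) :
  findom mu D -> bm (fun p : T1 * T2 => f p.1 p.2) ->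
  bm (fun x => \int[mu]_(y in D) f x y).
Proof.
move=> fD [mf [M fM]]; have [mD Doo] := fD.
have M0 : 0 <= M.
  have [[x y]|T0] := pselect (exists p : T1 * T2, True).
    by move: x => x; rewrite (le_trans _ (fM x)).
  by rewrite leNgt; apply/negP => _; apply: T0; exists (point, point).
have bmx x : bm (f x).
  split; last by exists M => y; exact: (fM (x, y)).
  exact: (measurable_fun_pair2 _ mf).
split.
  pose g (p : T1 * T2) : R := (f p.1 p.2 + M) * \1_D p.2.
  have mg : measurable_fun setT (fun p => (g p)%:E).
    apply/measurable_EFinP; apply: measurable_funM.
      by apply: measurable_funD.
    by apply: measurableT_comp => //; exact: measurable_indic.
  have g0 p : (0 <= (g p)%:E)%E.
    rewrite lee_fin mulr_ge0//; have := fM p; rewrite ler_norml => /andP[+ _].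
    by lra.
  have := measurable_fun_fubini_tonelli_F (m2 := mu) _ mg g0.
  rewrite /fubini_F => mG.
  rewrite (_ : (fun x => _) = fun x => fine (\int[mu]_y (g (x, y))%:E)
                              - M * fine (mu D)).
    apply: measurable_funB => //; apply: measurableT_comp => //.
  apply/funext => x.
  have -> : fine (\int[mu]_y (g (x, y))%:E) = \int[mu]_(y in D) (f x y + M).
    rewrite Rintegral_mkcond; congr fine; apply: eq_integral => y _.
    rewrite /g /= patchE indicE; case: ifPn => yD.
      by rewrite mulr1.
    by rewrite mulr0.
  rewrite RintegralD// ?Rintegral_cst//; first by rewrite addrK.
  - exact: bm_integrable.
  - by apply: bm_integrable => //; exact: bm_cst.
exists (M * fine (mu D)) => x.
apply: le_trans (le_normr_Rintegral _ _) _ => //; first exact: bm_integrable.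
rewrite -Rintegral_cst//; apply: le_Rintegral => //.
- by apply: bm_integrable => //; exact: bm_norm.
- by apply: bm_integrable => //; exact: bm_cst.
- by move=> y _; exact: (fM (x, y)).
Qed.

Lemma findom_prod {d1 d2} {T1 : measurableType d1} {T2 : measurableType d2}
  {R : realType} (m1 : {sigma_finite_measure set T1 -> \bar R})
  (m2 : {sigma_finite_measure set T2 -> \bar R}) (D1 : set T1) (D2 : set T2) :
  findom m1 D1 -> findom m2 D2 -> findom (m1 \x m2)%E (D1 `*` D2).
Proof.
move=> [mD1 f1] [mD2 f2]; split; first exact: measurableX.
by rewrite product_measure1E// lte_mul_pinfty// ge0_fin_numE.
Qed.

Lemma Rintegral_prod {d1 d2} {T1 : measurableType d1} {T2 : measurableType d2}
  {R : realType} (m1 : {sigma_finite_measure set T1 -> \bar R})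
  (m2 : {sigma_finite_measure set T2 -> \bar R}) (D1 : set T1) (D2 : set T2)
  (f : T1 * T2 -> R) :
  findom m1 D1 -> findom m2 D2 -> bm f ->
  \int[(m1 \x m2)%E]_(p in D1 `*` D2) f p =
    \int[m1]_(x in D1) \int[m2]_(y in D2) f (x, y) /\
  \int[(m1 \x m2)%E]_(p in D1 `*` D2) f p =
    \int[m2]_(y in D2) \int[m1]_(x in D1) f (x, y).
Proof.
move=> F1 F2 bf; have [mD1 f1] := F1; have [mD2 f2] := F2.
have F12 := findom_prod _ _ _ _ F1 F2; have [mD12 f12] := F12.
have bx x : bm (fun y => f (x, y)).
  by apply: bm_comp bf _; exact: measurable_pair1.
have by_ y : bm (fun x => f (x, y)).
  by apply: bm_comp bf _; exact: measurable_pair2.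
have ig := bm_integrable _ _ _ F12 bf.
have ig' : (m1 \x m2)%E.-integrable setT ((EFin \o f) \_ (D1 `*` D2)).
  by apply/(integrable_mkcond _ mD12).1.
split.
- rewrite /Rintegral integral_mkcond -integral12_prod_meas1//; congr fine.
  rewrite [RHS]integral_mkcond /fubini_F; apply: eq_integral => x _.
  rewrite [RHS]patchE; case: ifPn => xD.
    rewrite fineK; last by apply: integrable_fin_num => //; exact: bm_integrable.
    rewrite [RHS]integral_mkcond; apply: eq_integral => y _; rewrite !patchE.
    by rewrite in_setX xD.
  by rewrite integral0_eq// => y _; rewrite patchE in_setX (negbTE xD).
- rewrite /Rintegral integral_mkcond -integral21_prod_meas1//; congr fine.
  rewrite [RHS]integral_mkcond /fubini_G; apply: eq_integral => y _.
  rewrite [RHS]patchE; case: ifPn => yD.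
    rewrite fineK; last by apply: integrable_fin_num => //; exact: bm_integrable.
    rewrite [RHS]integral_mkcond; apply: eq_integral => x _; rewrite !patchE.
    by rewrite in_setX yD andbT.
  by rewrite integral0_eq// => x _; rewrite patchE in_setX (negbTE yD) andbF.
Qed.

Lemma Rintegral_swap {d1 d2} {T1 : measurableType d1} {T2 : measurableType d2}
  {R : realType} (m1 : {sigma_finite_measure set T1 -> \bar R})
  (m2 : {sigma_finite_measure set T2 -> \bar R}) (D1 : set T1) (D2 : set T2)
  (f : T1 -> T2 -> R) :
  findom m1 D1 -> findom m2 D2 -> bm (fun p => f p.1 p.2) ->
  \int[m1]_(x in D1) \int[m2]_(y in D2) f x y =
  \int[m2]_(y in D2) \int[m1]_(x in D1) f x y.
Proof.
move=> F1 F2 bf.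
by have [<- <-] := Rintegral_prod m1 m2 _ _ (fun p => f p.1 p.2) F1 F2 bf.
Qed.

Lemma Rintegral_cvg0 {d} {T : measurableType d} {R : realType}
  (mu : {measure set T -> \bar R}) (D : set T) (f : nat -> T -> R) (M : R) :
  findom mu D -> (forall n, measurable_fun setT (f n)) ->
  (forall n x, D x -> `|f n x| <= M) ->
  {ae mu, forall x, D x -> f n x @[n --> \oo] --> 0} ->
  \int[mu]_(x in D) f n x @[n --> \oo] --> 0.
Proof.
move=> FD mf fM f0; have [mD _] := FD.
have [] := @dominated_convergence _ _ _ mu D mD (fun n x => (f n x)%:E)
   (fun _ => 0%E) (fun _ => M%:E).
- by move=> n; apply/measurable_EFinP/measurable_funTS.
- exact: measurable_cst.
- by apply: filterS f0 => x /[apply] h; apply/fine_cvgP; split => //; exact: nearW.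
- by apply: bm_integrable => //; exact: bm_cst.
- by apply: aeW => x n Dx; rewrite lee_fin fM.
move=> _ _; rewrite integral0 => /fine_cvgP[_]; exact.
Qed.

Lemma within_continuousP {R : realType} (a b : R) (G : R -> R) (t : R) :
  {within `[a, b], continuous G} -> t \in `[a, b] -> forall e : R, 0 < e ->
  exists2 d : R, 0 < d & forall s, s \in `[a, b] -> `|s - t| < d -> `|G s - G t| < e.
Proof.
move=> cG tab e e0; have /cvgrPdist_lt /(_ e e0) H := cG t.
have : within `[a, b] (nbhs t) [set s | `|G t - G s| < e].
  by rewrite nbhs_subspace_in.
move=> [d /= d0 Hd]; exists d => // s sab std; rewrite distrC; apply: Hd => //.
by rewrite /ball /= distrC.
Qed.

Lemma findom_itv {R : realType} (a b : R) : findom (@lebesgue_measure R) `[a, b].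
Proof.
split => //; have -> := lebesgue_measure_itv `[a, b]; case: ifP => // _.
by rewrite -EFinB ltry.
Qed.

Lemma Rintegral_itv_cst {R : realType} (a b c : R) : a <= b ->
  \int[@lebesgue_measure R]_(x in `[a, b]) c = c * (b - a).
Proof.
move=> ab; rewrite Rintegral_cst//= lebesgue_measure_itv /= lte_fin.
move: ab; rewrite le_eqVlt => /predU1P[->|->]; first by rewrite ltxx subrr.
by rewrite -EFinB.
Qed.

Lemma bm_le_Rintegral {d} {T : measurableType d} {R : realType}
  (mu : {measure set T -> \bar R}) (D : set T) (f g : T -> R) :
  findom mu D -> bm f -> bm g -> (forall x, D x -> f x <= g x) ->
  \int[mu]_(x in D) f x <= \int[mu]_(x in D) g x.
Proof.
move=> FD bf bg fg; have [mD _] := FD.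
by apply: le_Rintegral => //; exact: bm_integrable.
Qed.

Lemma bm_RintegralD {d} {T : measurableType d} {R : realType}
  (mu : {measure set T -> \bar R}) (D : set T) (f g : T -> R) :
  findom mu D -> bm f -> bm g ->
  \int[mu]_(x in D) (f x + g x) = \int[mu]_(x in D) f x + \int[mu]_(x in D) g x.
Proof.
by move=> FD bf bg; have [mD _] := FD; apply: RintegralD => //; exact: bm_integrable.
Qed.

Lemma bm_RintegralB {d} {T : measurableType d} {R : realType}
  (mu : {measure set T -> \bar R}) (D : set T) (f g : T -> R) :
  findom mu D -> bm f -> bm g ->
  \int[mu]_(x in D) (f x - g x) = \int[mu]_(x in D) f x - \int[mu]_(x in D) g x.
Proof.
by move=> FD bf bg; have [mD _] := FD; apply: RintegralB => //; exact: bm_integrable.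
Qed.

Lemma bm_RintegralZl {d} {T : measurableType d} {R : realType}
  (mu : {measure set T -> \bar R}) (D : set T) (c : R) (f : T -> R) :
  findom mu D -> bm f ->
  \int[mu]_(x in D) (c * f x) = c * \int[mu]_(x in D) f x.
Proof.
by move=> FD bf; have [mD _] := FD; apply: RintegralZl => //; exact: bm_integrable.
Qed.

Lemma bm_norm_Rintegral {d} {T : measurableType d} {R : realType}
  (mu : {measure set T -> \bar R}) (D : set T) (f : T -> R) :
  findom mu D -> bm f ->
  `|\int[mu]_(x in D) f x| <= \int[mu]_(x in D) `|f x|.
Proof.
by move=> FD bf; have [mD _] := FD; apply: le_normr_Rintegral => //; exact: bm_integrable.
Qed.

Lemma Rintegral_ae_eq {d} {T : measurableType d} {R : realType}
  (mu : {measure set T -> \bar R}) (D : set T) (f g : T -> R) :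
  measurable D -> measurable_fun D f -> measurable_fun D g ->
  {ae mu, forall x, D x -> f x = g x} ->
  \int[mu]_(x in D) f x = \int[mu]_(x in D) g x.
Proof.
move=> mD mf mg fg; congr fine; apply: ae_eq_integral => //.
- exact/measurable_EFinP.
- exact/measurable_EFinP.
- by apply: filterS fg => x /[apply] ->.
Qed.

(* R and the domain of lebesgue_measure carry distinct, convertible measurable
   structures, which defeats unification in the general lemmas above; hence the
   restatements for the Lebesgue measure. *)
Lemma le_int1 {R : realType} (a b : R) (f g : R -> R) : bm f -> bm g ->
  (forall x, a <= x <= b -> f x <= g x) ->
  \int[@lebesgue_measure R]_(x in `[a, b]) f x <= \int[@lebesgue_measure R]_(x in `[a, b]) g x.
Proof.
by move=> bf bg fg; apply: bm_le_Rintegral => //; exact: findom_itv.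
Qed.

Lemma int1D {R : realType} (a b : R) (f g : R -> R) : bm f -> bm g ->
  \int[@lebesgue_measure R]_(x in `[a, b]) (f x + g x) =
  \int[@lebesgue_measure R]_(x in `[a, b]) f x + \int[@lebesgue_measure R]_(x in `[a, b]) g x.
Proof. by move=> bf bg; apply: bm_RintegralD => //; exact: findom_itv. Qed.

Lemma int1B {R : realType} (a b : R) (f g : R -> R) : bm f -> bm g ->
  \int[@lebesgue_measure R]_(x in `[a, b]) (f x - g x) =
  \int[@lebesgue_measure R]_(x in `[a, b]) f x - \int[@lebesgue_measure R]_(x in `[a, b]) g x.
Proof. by move=> bf bg; apply: bm_RintegralB => //; exact: findom_itv. Qed.

Lemma int1Zl {R : realType} (a b c : R) (f : R -> R) : bm f ->
  \int[@lebesgue_measure R]_(x in `[a, b]) (c * f x) =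
  c * \int[@lebesgue_measure R]_(x in `[a, b]) f x.
Proof. by move=> bf; apply: bm_RintegralZl => //; exact: findom_itv. Qed.

Lemma norm_int1 {R : realType} (a b : R) (f : R -> R) : bm f ->
  `|\int[@lebesgue_measure R]_(x in `[a, b]) f x| <=
  \int[@lebesgue_measure R]_(x in `[a, b]) `|f x|.
Proof. by move=> bf; apply: bm_norm_Rintegral => //; exact: findom_itv. Qed.

Lemma eq_int1 {R : realType} (a b : R) (f g : R -> R) :
  (forall x, a <= x <= b -> f x = g x) ->
  \int[@lebesgue_measure R]_(x in `[a, b]) f x = \int[@lebesgue_measure R]_(x in `[a, b]) g x.
Proof.
by move=> fg; apply: eq_Rintegral => x; rewrite inE /= in_itv/=; exact: fg.
Qed.

Lemma bm_int1 {d} {S : measurableType d} {R : realType} (a b : R) (f : S -> R -> R) :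
  bm (fun p : S * R => f p.1 p.2) ->
  bm (fun x => \int[@lebesgue_measure R]_(y in `[a, b]) f x y).
Proof. by move=> bf; exact: (bm_int (@lebesgue_measure R) `[a, b] f (findom_itv a b) bf). Qed.

Lemma int1_swap {R : realType} (a b c e : R) (f : R -> R -> R) :
  bm (fun p : R * R => f p.1 p.2) ->
  \int[@lebesgue_measure R]_(x in `[a, b]) \int[@lebesgue_measure R]_(y in `[c, e]) f x y =
  \int[@lebesgue_measure R]_(y in `[c, e]) \int[@lebesgue_measure R]_(x in `[a, b]) f x y.
Proof.
move=> bf; exact: (Rintegral_swap (@lebesgue_measure R) (@lebesgue_measure R) `[a, b] `[c, e] f (findom_itv a b) (findom_itv c e) bf).
Qed.

Lemma int1_cvg0 {R : realType} (a b : R) (f : nat -> R -> R) (M : R) :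
  (forall n, bm (f n)) -> (forall n x, a <= x <= b -> `|f n x| <= M) ->
  {ae @lebesgue_measure R, forall x, a <= x <= b -> f n x @[n --> \oo] --> 0} ->
  \int[@lebesgue_measure R]_(x in `[a, b]) f n x @[n --> \oo] --> 0.
Proof.
move=> bf fM f0; apply: (Rintegral_cvg0 _ _ _ M); first exact: findom_itv.
- by move=> n; case: (bf n).
- by move=> n x; rewrite /= in_itv/=; exact: fM.
- exact: f0.
Qed.

Lemma ae_mono2 {d} {T : measurableType d} {R : realType}
  (mu : {measure set T -> \bar R}) (P Q S : T -> Prop) :
  (forall x, P x -> Q x -> S x) ->
  {ae mu, forall x, P x} -> {ae mu, forall x, Q x} -> {ae mu, forall x, S x}.
Proof. by move=> PQS; exact: filterS2. Qed.

Lemma ae_mono {d} {T : measurableType d} {R : realType}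
  (mu : {measure set T -> \bar R}) (P S : T -> Prop) :
  (forall x, P x -> S x) -> {ae mu, forall x, P x} -> {ae mu, forall x, S x}.
Proof. by move=> PS; exact: filterS. Qed.

(** * A smooth step and its derivative *)

Definition C1 {R : realType} (f f' : R -> R) :=
  (forall x : R, is_derive x (1 : R) f (f' x)) /\ continuous f'.

Lemma C1_continuous {R : realType} (f f' : R -> R) : C1 f f' -> continuous f.
Proof.
move=> [df _] x; apply/differentiable_continuous/derivable1_diffP.
exact: ex_derive.
Qed.

Lemma C1M {R : realType} (f f' g g' : R -> R) : C1 f f' -> C1 g g' ->
  C1 (fun x => f x * g x) (fun x => f' x * g x + f x * g' x).
Proof.
move=> Cf Cg; have cf := C1_continuous _ _ Cf; have cg := C1_continuous _ _ Cg.
case: Cf Cg => df cf' [dg cg']; split => [x|x].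
  have dfx := df x; have dgx := dg x.
  by apply: (is_derive_eq (is_deriveM dfx dgx)); rewrite /GRing.scale /= addrC mulrC.
by apply: cvgD; apply: cvgM; [exact: cf'|exact: cg|exact: cf|exact: cg'].
Qed.

Lemma C1_comp {R : realType} (f f' g g' : R -> R) : C1 f f' -> C1 g g' ->
  C1 (fun x => f (g x)) (fun x => f' (g x) * g' x).
Proof.
move=> [df cf'] Cg; have cg := C1_continuous _ _ Cg.
case: Cg => dg cg'; split => [x|x].
  have dfx := df (g x); have dgx := dg x.
  exact: is_derive1_comp.
by apply: cvgM; [apply: continuous_comp; [exact: cg|exact: cf']|exact: cg'].
Qed.

Lemma C1_affine {R : realType} (a b : R) : C1 (fun x => a * x + b) (fun=> a).
Proof.
split => [x|x]; last exact: cvg_cst.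
have := is_deriveD (is_deriveZ a (is_derive_id x (1 : R))) (is_derive_cst b x 1).
by move/is_derive_eq; apply; rewrite /GRing.scale /= mulr1 addr0.
Qed.

Lemma C1_cst {R : realType} (b : R) : C1 (fun=> b) (fun=> 0).
Proof. by split => [x|x]; [exact: is_derive_cst|exact: cvg_cst]. Qed.

Lemma C1D {R : realType} (f f' g g' : R -> R) : C1 f f' -> C1 g g' ->
  C1 (fun x => f x + g x) (fun x => f' x + g' x).
Proof.
move=> [df cf'] [dg cg']; split => [x|x]; last by apply: cvgD; [exact: cf'|exact: cg'].
by have dfx := df x; have dgx := dg x; exact: is_deriveD.
Qed.

Lemma C1Zl {R : realType} (c : R) (f f' : R -> R) : C1 f f' ->
  C1 (fun x => c * f x) (fun x => c * f' x).
Proof.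
move=> Cf; have := C1M _ _ _ _ (C1_cst c) Cf.
by under [X in C1 _ X]eq_fun do rewrite mul0r add0r.
Qed.

Lemma C1_expR {R : realType} : C1 (@expR R) expR.
Proof. by split => x; [exact: is_derive_expR|exact: continuous_expR]. Qed.

Lemma C1_FTC {R : realType} (F f : R -> R) (a b : R) : C1 F f -> a <= b ->
  \int[@lebesgue_measure R]_(x in `[a, b]) f x = F b - F a.
Proof.
move=> CF; rewrite le_eqVlt => /predU1P[->|ab].
  by rewrite set_itv1 Rintegral_set1 subrr.
have cF := C1_continuous _ _ CF; case: CF => dF cf.
rewrite /Rintegral (@continuous_FTC2 _ _ F)//.
- exact: continuous_subspaceT.
- split => //.
  + by apply: cvg_at_right_filter; exact: cF.
  + by apply: cvg_at_left_filter; exact: cF.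
- by move=> x _; rewrite derive1E; exact: derive_val.
Qed.

Definition clamp {R : realType} (x : R) : R := Num.min 1 (Num.max 0 x).

Lemma clamp_le0 {R : realType} (x : R) : x <= 0 -> clamp x = 0.
Proof. by move=> x0; rewrite /clamp max_l// min_r. Qed.

Lemma clamp_ge1 {R : realType} (x : R) : 1 <= x -> clamp x = 1.
Proof. by move=> x1; rewrite /clamp max_r ?(le_trans _ x1)// min_l. Qed.

Lemma clamp_id {R : realType} (x : R) : 0 <= x <= 1 -> clamp x = x.
Proof. by move=> /andP[x0 x1]; rewrite /clamp max_r// min_r. Qed.

Lemma clamp_itv {R : realType} (x : R) : 0 <= clamp x <= 1.
Proof. by rewrite /clamp le_min ler01 le_max lexx ge_min lexx. Qed.

Lemma continuous_clamp {R : realType} : continuous (@clamp R).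
Proof.
move=> x; apply: continuous_min; first exact: cvg_cst.
by apply: continuous_max; [exact: cvg_cst|exact: cvg_id].
Qed.

(** The difference quotients of Q at a are dominated by those of P, which tend to 0. This serves the
    two corners of [clamp], where P composed with [clamp] agrees with P on one side and is constant
    on the other. *)
Lemma is_derive_kink {R : realType} (P Q : R -> R) (a : R) :
  is_derive a (1 : R) P 0 -> Q a = P a ->
  (\forall y \near a, `|Q y - P a| <= `|P y - P a|) -> is_derive a (1 : R) Q 0.
Proof.
move=> [dP P0] Qa QP.
have cP : h^-1 *: ((P \o shift a) (h *: (1 : R)) - P a) @[h --> 0^'] --> (0 : R).
  by rewrite -[X in _ --> X]P0; exact: dP.
suff cQ : h^-1 *: ((Q \o shift a) (h *: (1 : R)) - Q a) @[h --> 0^'] --> (0 : R).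
  by split; [apply/cvg_ex; exists 0|exact: cvg_lim].
apply/cvgr0Pnorm_lt => e e0; move/cvgr0Pnorm_lt : cP => /(_ e e0) cP.
have shQP : \forall h \near 0^', `|Q (h + a) - P a| <= `|P (h + a) - P a|.
  have : \forall h \near (0 : R), `|Q (h + a) - P a| <= `|P (h + a) - P a|.
    by rewrite (near_shift a) /=; apply: filterS QP => y; rewrite /= sub0r addrNK.
  exact: cvg_within.
near=> h; apply: le_lt_trans (_ : `|h^-1 *: ((P \o shift a) (h *: 1) - P a)| < e).
  rewrite !normrM ler_wpM2l// Qa /= /GRing.scale /= mulr1.
  by near: h.
by near: h.
Unshelve. all: by end_near. Qed.

(** Outside [0, 1] the composition is constant, so the vanishing of P' at 0 and 1 is what makes the
    one-sided derivatives match. *)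
Lemma C1_clamp {R : realType} (P P' : R -> R) : C1 P P' -> P' 0 = 0 -> P' 1 = 0 ->
  C1 (fun x => P (clamp x)) (fun x => P' (clamp x)).
Proof.
move=> [dP cP] P0 P1; split=> [x|x]; last first.
  by apply: continuous_comp; [exact: continuous_clamp|exact: cP].
have [x0|x0|->] := ltgtP x 0.
- rewrite clamp_le0 ?ltW// P0; apply: (near_eq_is_derive (f := cst (P 0))).
    by near=> y; rewrite clamp_le0// ltW//; near: y; exact: lt_nbhsl.
- have [x1|x1|->] := ltgtP x 1.
  + rewrite clamp_id ?ltW// ?x0//; apply: near_eq_is_derive (dP x).
    near=> y; rewrite clamp_id//; apply/andP; split; apply/ltW; near: y.
      exact: lt_nbhsr.
    exact: lt_nbhsl.
  + rewrite clamp_ge1 ?ltW// P1; apply: (near_eq_is_derive (f := cst (P 1))).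
    by near=> y; rewrite clamp_ge1// ltW//; near: y; exact: lt_nbhsr.
  + rewrite clamp_ge1// P1; apply: (is_derive_kink P).
    * by have := dP 1; rewrite P1.
    * by rewrite clamp_ge1.
    * near=> y; have [y1|y1] := leP 1 y; first by rewrite clamp_ge1// subrr normr0.
      rewrite clamp_id// (ltW y1) andbT ltW//; near: y; exact: lt_nbhsr.
- rewrite clamp_le0// P0; apply: (is_derive_kink P).
  + by have := dP 0; rewrite P0.
  + by rewrite clamp_le0.
  + near=> y; have [y1|y1] := leP y 0; first by rewrite clamp_le0// subrr normr0.
    by rewrite clamp_id// (ltW y1)/= ltW//; near: y; exact: lt_nbhsl.
Unshelve. all: by end_near. Qed.

(* Polynomial in the clamped variable with derivative 30 c^2 (1 - c)^2, so that
   step increases from 0 to 1 and bump has mass 1. *)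
Definition step {R : realType} (x : R) : R :=
  10 * clamp x ^+ 3 - 15 * clamp x ^+ 4 + 6 * clamp x ^+ 5.
Definition bump {R : realType} (x : R) : R :=
  30 * clamp x ^+ 2 * (1 - clamp x) ^+ 2.
Definition bump' {R : realType} (x : R) : R :=
  60 * clamp x * (1 - clamp x) * (1 - 2 * clamp x).

Lemma C1_ext {R : realType} (f f' g g' : R -> R) :
  f =1 g -> f' =1 g' -> C1 f f' -> C1 g g'.
Proof. by move=> /funext -> /funext ->. Qed.

Lemma C1_exp {R : realType} n : C1 (fun x : R => x ^+ n.+1) (fun x => n.+1%:R * x ^+ n).
Proof.
have C1id : C1 (@id R) (fun=> 1).
  by apply: C1_ext (C1_affine 1 0) => x //=; rewrite mul1r addr0.
elim: n => [|n ih]; first by apply: C1_ext C1id => x //=; rewrite expr0 mulr1.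
apply: C1_ext (C1M _ _ _ _ C1id ih) => x /=; first by rewrite -exprS.
by rewrite mul1r mulrCA -exprS -[in RHS]natr1 mulrDl mul1r addrC.
Qed.

Lemma C1_step {R : realType} : C1 (@step R) bump.
Proof.
pose P (c : R) : R := 10 * c ^+ 3 - 15 * c ^+ 4 + 6 * c ^+ 5.
pose P' (c : R) : R := 30 * c ^+ 2 * (1 - c) ^+ 2.
apply: (C1_clamp P P').
- apply: C1_ext (C1D _ _ _ _ (C1D _ _ _ _ (C1Zl 10 _ _ (C1_exp 2))
    (C1Zl (-15) _ _ (C1_exp 3))) (C1Zl 6 _ _ (C1_exp 4))) => x; rewrite /P /P'; ring.
- by rewrite /P'; ring.
- by rewrite /P'; ring.
Qed.

(** The kernels enter test functions, so [bump] has to be C1 as well. Hence the squares in its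
    definition: the double zeros of c^2 (1 - c)^2 make its derivative vanish at both corners of
    [clamp]. *)
Lemma C1_bump {R : realType} : C1 (@bump R) bump'.
Proof.
pose P (c : R) : R := 30 * c ^+ 2 * (1 - c) ^+ 2.
pose P' (c : R) : R := 60 * c * (1 - c) * (1 - 2 * c).
apply: (C1_clamp P P').
- apply: C1_ext (C1D _ _ _ _ (C1D _ _ _ _ (C1Zl 30 _ _ (C1_exp 1))
    (C1Zl (-60) _ _ (C1_exp 2))) (C1Zl 30 _ _ (C1_exp 3))) => x; rewrite /P /P'; ring.
- by rewrite /P'; ring.
- by rewrite /P'; ring.
Qed.

Lemma step_le0 {R : realType} (x : R) : x <= 0 -> step x = 0.
Proof. by move=> x0; rewrite /step clamp_le0//; ring. Qed.
Lemma step_ge1 {R : realType} (x : R) : 1 <= x -> step x = 1.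
Proof. by move=> x0; rewrite /step clamp_ge1//; ring. Qed.
Lemma bump_le0 {R : realType} (x : R) : x <= 0 -> bump x = 0.
Proof. by move=> x0; rewrite /bump clamp_le0//; ring. Qed.
Lemma bump_ge1 {R : realType} (x : R) : 1 <= x -> bump x = 0.
Proof. by move=> x0; rewrite /bump clamp_ge1//; ring. Qed.
Lemma bump'_le0 {R : realType} (x : R) : x <= 0 -> bump' x = 0.
Proof. by move=> x0; rewrite /bump' clamp_le0//; ring. Qed.
Lemma bump'_ge1 {R : realType} (x : R) : 1 <= x -> bump' x = 0.
Proof. by move=> x0; rewrite /bump' clamp_ge1//; ring. Qed.

Lemma bump_itv {R : realType} (x : R) : 0 <= bump x <= 30.
Proof.
rewrite /bump; have := clamp_itv x; move: (clamp x) => c /andP[c0 c1].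
have d0 : 0 <= (1 - c) ^+ 2 by exact: sqr_ge0.
have e0 : 0 <= c ^+ 2 by exact: sqr_ge0.
apply/andP; split; first by apply: mulr_ge0 => //; apply: mulr_ge0 => //; apply: ler0n.
rewrite -mulrA -[leRHS]mulr1; apply: ler_wpM2l => //.
by apply: mulr_ile1; rewrite ?sqr_ge0//; apply: exprn_ile1; lra.
Qed.

Lemma bump'_bound {R : realType} (x : R) : `|bump' x| <= 60.
Proof.
rewrite /bump'; have := clamp_itv x; move: (clamp x) => c /andP[c0 c1].
have : `|c * (1 - c) * (1 - 2 * c)| <= 1.
  have d : 0 <= c * (1 - c) by apply: mulr_ge0; lra.
  rewrite normrM; apply: mulr_ile1 => //; first by rewrite ger0_norm//; nra.
  by rewrite ler_norml; apply/andP; split; lra.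
by move=> h; rewrite -!(mulrA 60) normrM (ger0_norm (ler0n _ _)); lra.
Qed.

Lemma step_itv {R : realType} (x : R) : 0 <= step x <= 1.
Proof.
rewrite /step; have := clamp_itv x; move: (clamp x) => c /andP[c0 c1].
(* The quadratic 10 - 15 c + 6 c^2 is rewritten with nonnegative coefficients in c and 1 - c. *)
have -> : 10 * c ^+ 3 - 15 * c ^+ 4 + 6 * c ^+ 5 =
    c ^+ 3 * (10 * (1 - c) ^+ 2 + c * (5 * (1 - c) + c)) by ring.
(* The symmetry step(1 - c) = 1 - step(c) reduces the upper bound to the lower one. *)
have e : c ^+ 3 * (10 * (1 - c) ^+ 2 + c * (5 * (1 - c) + c)) =
    1 - (1 - c) ^+ 3 * (10 * c ^+ 2 + (1 - c) * (5 * c + (1 - c))) by ring.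
have d0 : 0 <= 1 - c by lra.
apply/andP; split; first by rewrite mulr_ge0 ?exprn_ge0//; nra.
by rewrite e lerBlDr lerDl mulr_ge0 ?exprn_ge0//; nra.
Qed.

(** * Kernels *)

Definition kern {R : realType} (h r : R) : R := bump (r / h) / h.
Definition kern' {R : realType} (h r : R) : R := bump' (r / h) / h / h.

Lemma C1_kern {R : realType} (h : R) : C1 (kern h) (kern' h).
Proof.
apply: C1_ext (C1Zl h^-1 _ _ (C1_comp _ _ _ _ C1_bump (C1_affine h^-1 0))) => x;
  rewrite addr0 (mulrC _ x) (mulrC h^-1)//.
Qed.

Lemma C1_step_scale {R : realType} (h : R) : C1 (fun r => step (r / h)) (kern h).
Proof.
apply: C1_ext (C1_comp _ _ _ _ C1_step (C1_affine h^-1 0)) => x;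
  by rewrite addr0 (mulrC _ x).
Qed.

Lemma continuous_kern' {R : realType} (h : R) : continuous (kern' h).
Proof. by case: (C1_kern h). Qed.

Lemma continuous_kern {R : realType} (h : R) : continuous (kern h).
Proof. exact: C1_continuous (C1_kern h). Qed.

Lemma kern_le0 {R : realType} (h r : R) : 0 < h -> r <= 0 -> kern h r = 0.
Proof. by move=> h0 r0; rewrite /kern bump_le0 ?mul0r// pmulr_lle0// invr_gt0. Qed.
Lemma kern_geh {R : realType} (h r : R) : 0 < h -> h <= r -> kern h r = 0.
Proof. by move=> h0 r0; rewrite /kern bump_ge1 ?mul0r// ler_pdivlMr// mul1r. Qed.
Lemma kern'_le0 {R : realType} (h r : R) : 0 < h -> r <= 0 -> kern' h r = 0.
Proof. by move=> h0 r0; rewrite /kern' bump'_le0 ?mul0r// pmulr_lle0// invr_gt0. Qed.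
Lemma kern'_geh {R : realType} (h r : R) : 0 < h -> h <= r -> kern' h r = 0.
Proof. by move=> h0 r0; rewrite /kern' bump'_ge1 ?mul0r// ler_pdivlMr// mul1r. Qed.

Lemma kern_itv {R : realType} (h r : R) : 0 < h -> 0 <= kern h r <= 30 / h.
Proof.
move=> h0; have /andP[b0 b1] := bump_itv (r / h).
have hV : 0 <= h^-1 by rewrite invr_ge0 ltW.
by rewrite /kern mulr_ge0//=; exact: ler_wpM2r.
Qed.

Lemma bm_kern {R : realType} (h : R) : 0 < h -> bm (kern h).
Proof.
move=> h0; split; first by apply: continuous_measurable_fun; exact: continuous_kern.
by exists (30 / h) => x; have /andP[? ?] := kern_itv h x h0; rewrite ger0_norm.
Qed.

Lemma bm_kern' {R : realType} (h : R) : 0 < h -> bm (kern' h).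
Proof.
move=> h0; split; first by apply: continuous_measurable_fun; exact: continuous_kern'.
have hV : 0 <= h^-1 by rewrite invr_ge0 ltW.
exists (60 / h / h) => x; rewrite /kern' 2!normrM (ger0_norm hV).
apply: ler_wpM2r => //; apply: ler_wpM2r => //; exact: bump'_bound.
Qed.

Lemma fracR_itv {R : realType} (x : R) : 0 <= fracR x < 1.
Proof.
have /andP[a b] := floor_itv x; move: b; rewrite intrD mulr1z /fracR => b.
by apply/andP; split; lra.
Qed.

Lemma fracR_def {R : realType} (x : R) (n : int) : n%:~R <= x < n%:~R + 1 ->
  fracR x = x - n%:~R.
Proof.
by move=> /andP[a b]; rewrite /fracR (@floor_def _ x n)// a intrD mulr1z.
Qed.

Lemma fracR_periodic {R : realType} (x : R) : fracR (x + 1) = fracR x.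
Proof.
have /andP[a b] := fracR_itv x.
rewrite (@fracR_def _ (x + 1) (Num.floor x + 1)) intrD mulr1z; last first.
  by move: a b; rewrite /fracR => a b; apply/andP; split; lra.
by rewrite /fracR; ring.
Qed.

Definition pkern {R : realType} (h x : R) : R := kern h (fracR x).
Definition pkern' {R : realType} (h x : R) : R := kern' h (fracR x).

(* Near x, including across an integer, f \o fracR is a single translate of f, so
   that periodization preserves smoothness; this uses h < 1. *)
Lemma near_periodize {R : realType} (h : R) (f : R -> R) (x : R) :
  0 < h -> h < 1 -> (forall r : R, r <= 0 -> f r = 0) -> (forall r : R, h <= r -> f r = 0) ->
  \forall y \near x, f (y - (Num.floor x)%:~R) = f (fracR y).
Proof.
move=> h0 h1 f0 fh; set n := Num.floor x.
have /andP[a b] := fracR_itv x; rewrite /fracR -/n in a b.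
near=> y.
have yl : n%:~R - (1 - h) < y by near: y; apply: lt_nbhsr; lra.
have yr : y < n%:~R + 1 by near: y; apply: lt_nbhsl; lra.
have [yn|yn] := leP n%:~R y; first by rewrite (@fracR_def _ y n)// yn yr.
rewrite (@fracR_def _ y (n - 1)); last first.
  by rewrite intrB mulr1z; apply/andP; split; lra.
by rewrite intrB mulr1z f0 ?fh//; lra.
Unshelve. all: by end_near. Qed.

Lemma C1_pkern {R : realType} (h : R) : 0 < h -> h < 1 -> C1 (pkern h) (pkern' h).
Proof.
move=> h0 h1.
have nk x := near_periodize h (kern h) x h0 h1 (fun r => kern_le0 h r h0) (fun r => kern_geh h r h0).
have nk' x := near_periodize h (kern' h) x h0 h1 (fun r => kern'_le0 h r h0) (fun r => kern'_geh h r h0).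
have Ct (x : R) : C1 (fun y => kern h (y - (Num.floor x)%:~R)) (fun y => kern' h (y - (Num.floor x)%:~R)).
  by apply: C1_ext (C1_comp _ _ _ _ (C1_kern h) (C1_affine 1 (- (Num.floor x)%:~R))) => y;
    rewrite mul1r ?mulr1.
split => x.
  apply: near_eq_is_derive (nk x) _.
  by have [d _] := Ct x; exact: d.
have [_ c] := Ct x; have := c x.
rewrite /continuous_at /pkern' {2}/fracR.
apply: cvg_trans; apply: near_eq_cvg; exact: nk'.
Qed.

Lemma pkern_periodic {R : realType} (h x : R) : pkern h (x + 1) = pkern h x.
Proof. by rewrite /pkern fracR_periodic. Qed.

Lemma pkern_itv {R : realType} (h r : R) : 0 < h -> 0 <= pkern h r <= 30 / h.
Proof. exact: kern_itv. Qed.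

Lemma bm_pkern {R : realType} (h : R) : 0 < h -> h < 1 -> bm (pkern h).
Proof.
move=> h0 h1; split.
  by apply: continuous_measurable_fun; exact: C1_continuous (C1_pkern h h0 h1).
by have [_ [M HM]] := bm_kern h h0; exists M => x; exact: HM.
Qed.

Lemma bm_pkern' {R : realType} (h : R) : 0 < h -> h < 1 -> bm (pkern' h).
Proof.
move=> h0 h1; split.
  by apply: continuous_measurable_fun; have [] := C1_pkern h h0 h1.
by have [_ [M HM]] := bm_kern' h h0; exists M => x; exact: HM.
Qed.

(** For x and y in [0, 1] the difference x - y lies in [-1, 1], where only two translates of [kern]
    can be nonzero. This makes the periodic kernel accessible to the fundamental theorem of
    calculus. *)
Lemma pkernE {R : realType} (h r : R) : 0 < h -> h < 1 -> -1 <= r <= 1 ->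
  pkern h r = kern h r + kern h (r + 1).
Proof.
move=> h0 h1 /andP[r0 r1]; rewrite /pkern.
have [rn|rp] := ltP r 0.
  rewrite (@fracR_def _ r (-1)) ?mulrN1z ?opprK; last by apply/andP; split; lra.
  by rewrite (kern_le0 h r)// ?add0r// ltW.
rewrite (kern_geh h (r + 1))// ?addr0; last by lra.
have [r1'|r1'] := ltP r 1.
  by rewrite (@fracR_def _ r 0) ?subr0// rp add0r.
(* At r = 1 the fractional part jumps back to 0; both sides vanish, as [kern] is zero at 0 and
   beyond h < 1. *)
have -> : r = 1 by lra.
rewrite (@fracR_def _ 1 1) mulr1z ?subrr; last by apply/andP; split; lra.
by rewrite kern_le0// (kern_geh h 1)// ltW.
Qed.

(** The primitives of the two translates telescope: the value step(x / h) occurs at y = 0 in the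
    first and at y = 1 in the second, leaving step((x + 1) / h) - step((x - 1) / h) = 1. *)
Lemma pkern_mass_r {R : realType} (h x : R) : 0 < h -> h < 1 -> 0 <= x <= 1 ->
  \int[@lebesgue_measure R]_(y in `[0, 1]) pkern h (x - y) = 1.
Proof.
move=> h0 h1 /andP[x0 x1].
transitivity (\int[@lebesgue_measure R]_(y in `[0, 1]) (kern h (x - y) + kern h (x - y + 1))).
  apply: eq_Rintegral => y; rewrite inE /= in_itv/= => /andP[y0 y1].
  by rewrite pkernE//; apply/andP; split; lra.
have C a : C1 (fun y => - step ((a - y) / h)) (fun y => kern h (a - y)).
  apply: C1_ext (C1Zl (-1) _ _ (C1_comp _ _ _ _ (C1_step_scale h) (C1_affine (-1) a))) => y.
    by rewrite mulN1r mulN1r (addrC _ a).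
  by rewrite !mulN1r (addrC _ a) mulrN1 opprK.
have := C1D _ _ _ _ (C x) (C (x + 1)) => C2.
rewrite (_ : (fun y => _) = (fun y => kern h (x - y) + kern h (x + 1 - y))); last first.
  by apply/funext => y; rewrite addrAC.
rewrite (C1_FTC _ _ 0 1 C2)// !subr0 addrK.
rewrite (step_ge1 ((x + 1) / h)); last by rewrite ler_pdivlMr// mul1r; lra.
rewrite (step_le0 ((x - 1) / h)); last by rewrite pmulr_lle0 ?invr_gt0//; lra.
by ring.
Qed.

(** The part of the bump that lies beyond T is lost, so the mass is 1 only for t <= T - h. This
    deficit is the factor [m] in [doubling_inner] and [kato_eps]. *)
Lemma kern_mass {R : realType} (h t T : R) : 0 < h -> 0 <= t -> 0 <= T ->
  \int[@lebesgue_measure R]_(s in `[0, T]) kern h (s - t) = step ((T - t) / h).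
Proof.
move=> h0 t0 T0.
have C : C1 (fun x => step ((x - t) / h)) (fun x => kern h (x - t)).
  apply: C1_ext (C1_comp _ _ _ _ (C1_step_scale h) (C1_affine 1 (- t))) => x.
    by rewrite mul1r.
  by rewrite mul1r mulr1.
rewrite (C1_FTC _ _ 0 T C)// sub0r (step_le0 (- t / h)) ?subr0//.
by rewrite pmulr_lle0 ?invr_gt0//; lra.
Qed.

(** * Approximate identities *)

(** The shift by 2 keeps every mesh size, including the one for n = 0, strictly below 1, as the
    periodization demands. *)
Definition mesh {R : realType} (n : nat) : R := n.+2%:R^-1.

Lemma mesh_gt0 {R : realType} n : 0 < mesh n :> R.
Proof. by rewrite invr_gt0 ltr0n. Qed.

Lemma mesh_lt1 {R : realType} n : mesh n < 1 :> R.
Proof. by rewrite invf_lt1 ?ltr0n// ltr1n. Qed.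

Lemma near_mesh {R : realType} (e : R) : 0 < e -> \forall n \near \oo, mesh n < e.
Proof.
move=> e0; near=> n; apply: le_lt_trans (_ : n.+1%:R^-1 < e).
  by rewrite lef_pV2 ?posrE ?ltr0n// ler_nat.
by near: n; exact: (near_infty_natSinv_lt (PosNum e0)).
Unshelve. all: by end_near. Qed.

Lemma ae_exists_itv {R : realType} (a b : R) (P : R -> Prop) : a < b ->
  {ae @lebesgue_measure R, forall x, P x} -> exists x, a < x < b /\ P x.
Proof.
move=> ab [N [mN N0 sN]]; apply: contrapT => /forallNP h.
have : (@lebesgue_measure R `]a, b[ <= @lebesgue_measure R N)%E.
  apply: le_measure; rewrite ?inE// => x; rewrite /= in_itv/= => xab.
  by apply: sN => Px; exact: (h x).
rewrite N0 leNgt; have -> := lebesgue_measure_itv `]a, b[.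
by rewrite /= lte_fin ab -EFinB lte_fin subr_gt0 ab.
Qed.

Lemma bm_pkern2 {R : realType} (h : R) : 0 < h -> h < 1 ->
  bm (fun p : R * R => pkern h (p.1 - p.2)).
Proof.
by move=> h0 h1; apply: (bm_comp (pkern h)); [exact: bm_pkern|exact: measurable_funB].
Qed.

Lemma bm_shift {R : realType} (f : R -> R) (a : R) : bm f -> bm (fun y : R => f (a - y)).
Proof. by move=> bf; apply: bm_comp bf _; exact: measurable_funB. Qed.

Lemma bm_shift' {R : realType} (f : R -> R) (a : R) : bm f -> bm (fun y : R => f (y - a)).
Proof. by move=> bf; apply: bm_comp bf _; exact: measurable_funB. Qed.

(** Only the values of G on (t, t + mesh n) are seen, with total mass at most 1, so the modulus of
    continuity of G at t bounds the integral. *)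
Lemma mollify_time {R : realType} (T t : R) (G : R -> R) : 0 <= t < T -> bm G ->
  {within `[0, T], continuous G} ->
  \int[@lebesgue_measure R]_(s in `[0, T]) (kern (mesh n) (s - t) * `|G t - G s|)
     @[n --> \oo] --> 0.
Proof.
move=> /andP[t0 tT] bG cG; apply/cvgr0Pnorm_le => e e0.
have tT' : t \in `[0, T] by rewrite in_itv/= t0 ltW.
have [d d0 Hd] := within_continuousP _ _ _ _ cG tT' _ e0.
near=> n.
have hn : mesh n < d by near: n; exact: near_mesh.
have h0 := @mesh_gt0 R n.
have bk := bm_shift' _ t (bm_kern (mesh n) h0).
rewrite ger0_norm; last first.
  by apply: Rintegral_ge0 => s _; rewrite mulr_ge0//; case/andP: (kern_itv _ (s - t) h0).
apply: (@le_trans _ _ (\int[@lebesgue_measure R]_(s in `[0, T]) (e * kern (mesh n) (s - t)))).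
  apply: bm_le_Rintegral; first exact: findom_itv.
  - by apply: bmM => //; apply: bm_norm; apply: bmB => //; exact: bm_cst.
  - by apply: bmM => //; exact: bm_cst.
  move=> s; rewrite /= in_itv/= => sT.
  have [st|st] := leP (s - t) 0; first by rewrite kern_le0// mul0r mulr0.
  have [sh|sh] := leP (mesh n) (s - t); first by rewrite kern_geh// mul0r mulr0.
  rewrite mulrC; apply: ler_wpM2r; first by case/andP: (kern_itv _ (s - t) h0).
  by rewrite distrC ltW// Hd// gtr0_norm//; exact: lt_trans hn.
rewrite bm_RintegralZl//; last exact: findom_itv.
rewrite kern_mass//; last by rewrite ltW// (le_lt_trans t0).
rewrite -[leRHS]mulr1; apply: ler_wpM2l; first exact: ltW.
by case/andP: (step_itv ((T - t) / mesh n)).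
Unshelve. all: by end_near. Qed.

Lemma lebesgue_pt_mesh {R : realType} (f : R -> R) (x : R) : lebesgue_pt f x ->
  davg f x (mesh n) @[n --> \oo] --> 0%E.
Proof.
apply: cvg_comp => A [e /= e0 HA]; near=> n; apply: HA; last exact: mesh_gt0.
rewrite /ball /= sub0r normrN ger0_norm ?(ltW (mesh_gt0 _))//.
by near: n; exact: near_mesh.
Unshelve. all: by end_near. Qed.

(** [kern h] is at most 30 / h and x - y is confined to (0, h), inside a ball of measure 2 h: hence
    the factor 60 = 30 * 2. The condition h < x keeps the second translate in [pkernE] away from
    [0, 1]. *)
Lemma mollify_le_davg {R : realType} (f : R -> R) (x h : R) : bm f ->
  0 < x <= 1 -> 0 < h -> h < 1 -> h < x ->
  ((\int[@lebesgue_measure R]_(y in `[0, 1]) (pkern h (x - y) * `|f x - f y|))%:E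
   <= 60%:E * davg f x h)%E.
Proof.
move=> bf /andP[x0 x1] h0 h1 hx.
have mf := bf.1.
have bd : bm (fun y : R => `|f x - f y|) by apply: bm_norm; apply: bmB => //; exact: bm_cst.
have bk : bm (fun y : R => kern h (x - y)) by apply: bm_shift; exact: bm_kern.
have -> : \int[@lebesgue_measure R]_(y in `[0, 1]) (pkern h (x - y) * `|f x - f y|) =
    \int[@lebesgue_measure R]_(y in `[0, 1]) (kern h (x - y) * `|f x - f y|).
  apply: eq_Rintegral => y; rewrite inE /= in_itv/= => /andP[y0 y1].
  rewrite pkernE//; last by apply/andP; split; lra.
  by rewrite (kern_geh h (x - y + 1))// ?addr0//; lra.
have mg : measurable_fun setT (fun y : R => (kern h (x - y) * `|f x - f y|)%:E).
  by apply/measurable_EFinP; case: (bmM _ _ bk bd).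
have g0 y : (0 <= (kern h (x - y) * `|f x - f y|)%:E)%E.
  by rewrite lee_fin mulr_ge0//; case/andP: (kern_itv h (x - y) h0).
rewrite fineK; last first.
  have fI := findom_itv (0 : R) 1; have [mI _] := fI.
  apply: integrable_fin_num => //.
  exact: bm_integrable fI (bmM _ _ bk bd).
apply: (@le_trans _ _ (\int[@lebesgue_measure R]_y (kern h (x - y) * `|f x - f y|)%:E)%E).
  exact: ge0_subset_integral.
apply: (@le_trans _ _ (\int[@lebesgue_measure R]_(y in ball x h) ((30 / h)%:E * `|(f y - f x)%:E|))%E).
  rewrite [leRHS]integral_mkcond; apply: ge0_le_integral => //.
  - apply/(measurable_restrictT _ _).1; first exact: measurable_ball.
    apply: measurable_funTS; apply: emeasurable_funM => //.
    apply: measurableT_comp => //; apply/measurable_EFinP.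
    by apply: measurable_funB.
  - move=> y _; rewrite patchE; case: ifPn => yb.
      rewrite abse_EFin -EFinM lee_fin distrC; apply: ler_wpM2r => //.
      by case/andP: (kern_itv h (x - y) h0).
    have [xy|xy] := leP (x - y) 0; first by rewrite kern_le0// mul0r.
    rewrite kern_geh ?mul0r// leNgt; apply: contra yb => xyh.
    by rewrite inE /ball /= gtr0_norm.
rewrite ge0_integralZl_EFin//; last 3 first.
- exact: measurable_ball.
- apply: measurable_funTS; apply: measurableT_comp => //; apply/measurable_EFinP.
  by apply: measurable_funB.
- by rewrite divr_ge0// ltW.
rewrite /davg /iavg (lebesgue_measure_ball _ (ltW h0)) inver ifF; last first.
  by apply/negbTE; rewrite mulrn_eq0/= gt_eqF.
rewrite muleA -EFinM.
have -> : 60 * (h *+ 2)^-1 = 30 / h by field; rewrite gt_eqF.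
exact: lexx.
Qed.

(** The inner integral tends to 0 at every Lebesgue point x > 0 by [mollify_le_davg], and the unit
    mass of [pkern] bounds it by M + M, so dominated convergence applies in x. *)
Lemma mollify_space {R : realType} (f : R -> R) : bm f ->
  \int[@lebesgue_measure R]_(x in `[0, 1]) \int[@lebesgue_measure R]_(y in `[0, 1])
     (pkern (mesh n) (x - y) * `|f x - f y|) @[n --> \oo] --> 0.
Proof.
move=> bf; have [mf [M fM]] := bf.
have fI := findom_itv (0 : R) 1.
have bg n : bm (fun p : R * R => pkern (mesh n) (p.1 - p.2) * `|f p.1 - f p.2|).
  apply: bmM; first by apply: bm_pkern2; [exact: mesh_gt0|exact: mesh_lt1].
  by apply: bm_norm; apply: bmB; apply: (bm_comp f).
have gge0 n x : 0 <= \int[@lebesgue_measure R]_(y in `[0, 1])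
     (pkern (mesh n) (x - y) * `|f x - f y|).
  apply: Rintegral_ge0 => y _; rewrite mulr_ge0//.
  by case/andP: (pkern_itv (mesh n) (x - y) (mesh_gt0 n)).
apply: (Rintegral_cvg0 _ _ _ (M + M)) => //.
- by move=> n; case: (bm_int (@lebesgue_measure R) `[0, 1]
    (fun x y : R => pkern (mesh n) (x - y) * `|f x - f y|) fI (bg n)).
- move=> n x; rewrite /= in_itv/= => xI; rewrite ger0_norm//.
  have bp : bm (fun y : R => pkern (mesh n) (x - y)).
    by apply: bm_shift; apply: bm_pkern; [exact: mesh_gt0|exact: mesh_lt1].
  have -> : M + M = \int[@lebesgue_measure R]_(y in `[0, 1]) ((M + M) * pkern (mesh n) (x - y)).
    by rewrite (bm_RintegralZl _ _ _ _ fI bp) pkern_mass_r ?mulr1 ?mesh_gt0 ?mesh_lt1.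
  apply: le_int1.
  + by apply: bmM => //; apply: bm_norm; apply: bmB => //; exact: bm_cst.
  + by apply: bmM => //; exact: bm_cst.
  + move=> y _; rewrite mulrC; apply: ler_wpM2r.
      by case/andP: (pkern_itv (mesh n) (x - y) (mesh_gt0 n)).
    by rewrite (le_trans (ler_normB _ _))// lerD.
have lf : locally_integrable setT f.
  split => //; first exact: openT.
  move=> K _ cK; have mK : measurable K by exact: compact_measurable.
  apply: le_lt_trans (_ : \int[@lebesgue_measure R]_(x in K) M%:E < +oo)%E.
    apply: ge0_le_integral => //; last by move=> x _; rewrite lee_fin.
    by do 2 apply: measurableT_comp => //; exact: measurable_funTS.
  rewrite integral_cst// lte_mul_pinfty// ?lee_fin ?(le_trans _ (fM 0))//.
  exact: compact_finite_measure.
(* At x = 0 the condition mesh n < x never holds; this point is discarded as a null set. *)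
have ln0 : {ae @lebesgue_measure R, forall x, x != 0}.
  exists [set 0]; split => //; first exact: lebesgue_measure_set1.
  by move=> x /= /negP; rewrite negbK => /eqP.
apply: (ae_mono2 (@lebesgue_measure R) _ _ _ _ ln0 (lebesgue_differentiation lf)).
move=> x xn0 /lebesgue_pt_mesh lx; rewrite /= in_itv/= => /andP[x0 x1].
have {x0 xn0}x0 : 0 < x by rewrite lt_neqAle eq_sym xn0.
have {}lx : (60%:E * davg f x (mesh n) @[n --> \oo] --> 0)%E.
  by rewrite -(mule0 60%:E); apply: cvgeZl.
suff /fine_cvgP[_] : ((\int[@lebesgue_measure R]_(y in `[0, 1])
   (pkern (mesh n) (x - y) * `|f x - f y|))%:E @[n --> \oo] --> 0)%E by [].
apply: squeeze_cvge (@cvg_cst _ _ _ _ _) lx.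
near=> n; rewrite lee_fin gge0/=; apply: mollify_le_davg => //.
- by rewrite x0.
- exact: mesh_gt0.
- exact: mesh_lt1.
- by near: n; exact: near_mesh.
Unshelve. all: by end_near. Qed.

(** * The kernel K' *)

Lemma integrable1 {R : realType} (a b : R) (f : R -> R) : bm f ->
  (@lebesgue_measure R).-integrable `[a, b] (EFin \o f).
Proof.
move=> bf; exact: (bm_integrable (@lebesgue_measure R) `[a, b] f (findom_itv a b) bf).
Qed.

Lemma measurable_floor {R : realType} :
  measurable_fun [set: R] (fun x : R => (Num.floor x)%:~R : R).
Proof.
move=> mD; apply: (measurability _ (RGenOInfty.measurableE R)) => //.
move=> /= _ [_ [a ->] <-]; rewrite setTI preimage_itvoy.
rewrite (_ : [set x | _] = `[(Num.floor a + 1)%:~R, +oo[%classic)//.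
apply/seteqP; split => x /=; rewrite in_itv/= andbT -floor_ge_int;
  by rewrite lezD1 floor_lt_int.
Qed.

(** The modulus of both one-sided limits of K' at the integers, sqrt e / (e - 1) sinh(1/2), which
    equals 1/2. *)
Definition Kpmax {R : realType} : R := Kconst * ((expR 2^-1 - expR (- 2^-1)) / 2).

Lemma Kconst_gt0 {R : realType} : 0 < Kconst :> R.
Proof.
by rewrite /Kconst divr_gt0// ?sqrtr_gt0 ?expR_gt0// subr_gt0 expR_gt1.
Qed.

Lemma Kp_le_max {R : realType} (x : R) : `|Kp x| <= Kpmax.
Proof.
rewrite /Kp /Kpmax normrM (ger0_norm (ltW Kconst_gt0)).
apply: ler_wpM2l; first exact: ltW Kconst_gt0.
have h2 : 0 <= 2^-1 :> R by rewrite invr_ge0.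
rewrite normrM (ger0_norm h2); apply: ler_wpM2r => //.
have /andP[a b] := fracR_itv x; set y := fracR x - 2^-1.
have y1 : expR y <= expR 2^-1 :> R by rewrite ler_expR /y; lra.
have y2 : expR (- y) <= expR 2^-1 :> R by rewrite ler_expR /y; lra.
have y3 : expR (- 2^-1) <= expR y :> R by rewrite ler_expR /y; lra.
have y4 : expR (- 2^-1) <= expR (- y) :> R by rewrite ler_expR /y; lra.
by rewrite ler_norml; apply/andP; split; lra.
Qed.

Definition Ksh {R : realType} (z : R) : R :=
  Kconst * ((expR (z - 2^-1) - expR (- (z - 2^-1))) / 2).
Definition Kch {R : realType} (z : R) : R :=
  Kconst * ((expR (z - 2^-1) + expR (- (z - 2^-1))) / 2).

Lemma C1_Kch {R : realType} : C1 (@Kch R) Ksh.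
Proof.
have e1 := C1_comp _ _ _ _ (@C1_expR R) (C1_affine 1 (- 2^-1)).
have e2 := C1_comp _ _ _ _ (@C1_expR R) (C1_affine (-1) 2^-1).
apply: C1_ext (C1Zl (Kconst / 2) _ _ (C1D _ _ _ _ e1 e2)) => x.
  rewrite /Kch mul1r mulN1r opprB (addrC (- x)); ring.
rewrite /Ksh mul1r mulN1r opprB (addrC (- x)); ring.
Qed.

Lemma continuous_Ksh {R : realType} : continuous (@Ksh R).
Proof. by have [] := @C1_Kch R. Qed.

Lemma Kp_frac {R : realType} (x : R) : Kp x = Ksh (fracR x).
Proof. by []. Qed.

Lemma bm_Kp {R : realType} : bm (@Kp R).
Proof.
split; last by exists Kpmax; exact: Kp_le_max.
apply: (@measurableT_comp _ _ _ _ _ _ (@Ksh R) _ (@fracR R)).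
  by apply: continuous_measurable_fun; exact: continuous_Ksh.
by apply: measurable_funB => //; exact: measurable_floor.
Qed.

(** K' is continuous from the right at 0 with value [- Kpmax], so any smaller essential bound would
    fail on a whole interval (0, c). Together with [Kp_le_max] this turns the essential norm into a
    bound valid at every point. *)
Lemma Kp_Linf_norm_ge {R : realType} : Kpmax <= Kp_Linf_norm :> R.
Proof.
rewrite /Kp_Linf_norm; set E := ess_sup _ _.
have aeE : {ae @lebesgue_measure R, forall x, (`|Kp x|%:E <= E)%E} by exact: ess_sup_ge.
have [x0 [_ x0E]] := ae_exists_itv 0 1 _ (@ltr01 R) aeE.
have E_le : (E <= Kpmax%:E)%E.
  by apply/ess_supP; apply: aeW => x; rewrite lee_fin Kp_le_max.
(* [fine] sends infinite values to 0, so finiteness has to be known before [fine E] can be compared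
   with [Kpmax]. *)
have Efin : E \is a fin_num.
  rewrite ge0_fin_numE; first exact: le_lt_trans E_le (ltry _).
  by apply: le_trans x0E; rewrite lee_fin.
rewrite leNgt; apply/negP => ltE.
have : Ksh 0 = - Kpmax :> R by rewrite /Ksh /Kpmax sub0r opprK; ring.
move=> Ksh0.
have /cvgrPdist_lt /(_ (Kpmax - fine E)) := @continuous_Ksh R 0.
rewrite subr_gt0 => /(_ ltE) [d /= d0 Hd].
pose c := Num.min d 1.
have c0 : 0 < c by rewrite lt_min d0 ltr01.
have cd : c <= d by rewrite ge_min lexx.
have c1 : c <= 1 by rewrite ge_min lexx orbT.
have [x [/andP[xp xc] xE]] := ae_exists_itv 0 c _ c0 aeE.
have := Hd x; rewrite /ball /= sub0r normrN gtr0_norm// => /(_ _).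
rewrite Ksh0 => /(_ (lt_le_trans xc cd)).
have : `|Kp x| <= fine E by rewrite -lee_fin fineK.
rewrite Kp_frac (@fracR_def _ x 0); last first.
  by rewrite ltW//= add0r (lt_le_trans xc).
rewrite subr0 ler_norml ltr_norml => /andP[h1 h2] /andP[h3 h4].
by move: (fine E) h1 h2 h3 h4 => e; lra.
Qed.

Lemma Kp_le {R : realType} (x : R) : `|Kp x| <= Kp_Linf_norm.
Proof. exact: le_trans (Kp_le_max x) Kp_Linf_norm_ge. Qed.

Lemma Kp_Linf_norm_ge0 {R : realType} : 0 <= Kp_Linf_norm :> R.
Proof. exact: le_trans (normr_ge0 _) (Kp_le 0). Qed.

(** K' is the derivative of K, and [Kch], the profile of K on one period, takes equal values at 0
    and 1 because cosh is even. The integral is split at y = x, where the fractional part of x - y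
    jumps. *)
Lemma Kp_mean0 {R : realType} (x : R) : 0 <= x <= 1 ->
  \int[@lebesgue_measure R]_(y in `[0, 1]) Kp (x - y) = 0.
Proof.
move=> /andP[x0 x1].
have bK : bm (fun y : R => Kp (x - y)) by apply: bm_shift; exact: bm_Kp.
have iK (a b : R) : (@lebesgue_measure R).-integrable `[a, b] (EFin \o (fun y : R => Kp (x - y))).
  exact: integrable1.
have CK c : C1 (fun y => - Kch (c - y)) (fun y : R => Ksh (c - y)).
  apply: C1_ext (C1Zl (-1) _ _ (C1_comp _ _ _ _ C1_Kch (C1_affine (-1) c))) => y.
    by rewrite mulN1r mulN1r (addrC _ c).
  by rewrite !mulN1r (addrC _ c) mulrN1 opprK.
have cKsh c (a b : R) : (@lebesgue_measure R).-integrable `[a, b] (EFin \o (fun y : R => Ksh (c - y))).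
  apply: continuous_compact_integrable; first exact: segment_compact.
  apply: continuous_subspaceT; by have [] := CK c.
have e := @Rintegral_itvB R (fun y => Kp (x - y)) (BLeft 0) (BRight 1) x (iK 0 1).
rewrite !bnd_simp in e; have {}e := e x0 x1.
have e2 : \int[@lebesgue_measure R]_(y in `]x, 1]) Kp (x - y) = - Kch x + Kch (x + 1 - x).
  rewrite (_ : \int[_]_(y in _) _ = \int[@lebesgue_measure R]_(y in `]x, 1]) Ksh (x + 1 - y)).
    rewrite Rintegral_itv_obnd_cbnd; last first.
      by apply: integrableS (cKsh (x + 1) x 1) => //; exact: subset_itv_oc_cc.
    by rewrite (C1_FTC _ _ _ _ (CK (x + 1)))// addrK opprK.
  apply: eq_Rintegral => y; rewrite inE /= in_itv/= => /andP[y0 y1].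
  rewrite Kp_frac (@fracR_def _ _ (-1)) ?mulrN1z ?opprK; first by rewrite addrAC.
  by apply/andP; split; lra.
have e3 : \int[@lebesgue_measure R]_(y in `[0, x]) Kp (x - y) = - Kch 0 + Kch x.
  (* The endpoint y = 0 is removed: for x = 1 the fractional part of x - y would be 0 there instead
     of 1. *)
  rewrite -Rintegral_itv_obnd_cbnd; last first.
    by apply: integrableS (iK 0 x) => //; exact: subset_itv_oc_cc.
  rewrite (_ : \int[_]_(y in _) _ = \int[@lebesgue_measure R]_(y in `]0, x]) Ksh (x - y)).
    rewrite Rintegral_itv_obnd_cbnd; last first.
      by apply: integrableS (cKsh x 0 x) => //; exact: subset_itv_oc_cc.
    by rewrite (C1_FTC _ _ _ _ (CK x))// subrr subr0 opprK.
  apply: eq_Rintegral => y; rewrite inE /= in_itv/= => /andP[y0 y1].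
  by rewrite Kp_frac (@fracR_def _ _ 0) ?subr0//; apply/andP; split; lra.
move: e; rewrite e2 e3 => /eqP; rewrite subr_eq => /eqP ->.
have -> : x + 1 - x = 1 by ring.
have -> : Kch 1 = Kch 0 :> R.
  rewrite /Kch sub0r opprK; have -> : 1 - 2^-1 = 2^-1 :> R by lra.
  by rewrite (addrC (expR _)).
ring.
Qed.

(** With one variable frozen, all test functions of the proof are products of a periodic function of
    x and a compactly supported function of t, so the entropy inequality is only ever invoked in
    this form. *)
Lemma test_fun_prod {R : realType} (a a' b b' : R -> R) :
  C1 a a' -> C1 b b' -> (forall x, a (x + 1) = a x) ->
  (forall x, 0 <= a x) -> (forall t, 0 <= b t) ->
  (exists B : R, forall t, B < `|t| -> b t = 0) ->
  test_fun (fun x t => a x * b t) (fun x t => a' x * b t) (fun x t => a x * b' t).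
Proof.
move=> Ca Cb pa a0 b0 [B bB].
have ca := C1_continuous _ _ Ca; have cb := C1_continuous _ _ Cb.
have jc (f g : R -> R) : continuous f -> continuous g ->
    continuous (fun p : R * R => f p.1 * g p.2).
  move=> cf cg p; apply: cvgM.
    by apply: (@continuous_comp _ _ _ (fun p : R * R => p.1) f); [exact: cvg_fst|exact: cf].
  by apply: (@continuous_comp _ _ _ (fun p : R * R => p.2) g); [exact: cvg_snd|exact: cg].
split; first by move=> x t; rewrite mulr_ge0.
split; first by move=> x t; rewrite pa.
split; first by exists B => x t /bB ->; rewrite mulr0.
split.
  move=> x t; have [d _] := C1M _ _ _ _ Ca (C1_cst (b t)); have := d x.
  by rewrite mulr0 addr0.
split.
  move=> x t; have [d _] := C1M _ _ _ _ (C1_cst (a x)) Cb; have := d t.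
  by rewrite mul0r add0r.
have [_ ca'] := Ca; have [_ cb'] := Cb.
by split; [exact: jc|split; exact: jc].
Qed.

(** * Integration over the space-time strip *)

Lemma bmX {d} {T : measurableType d} {R : realType} (f : T -> R) n :
  bm f -> bm (fun x => f x ^+ n).
Proof.
move=> bf; elim: n => [|n ih]; first by under eq_fun do rewrite expr0; exact: bm_cst.
by under eq_fun do rewrite exprS; exact: bmM.
Qed.

Lemma bm_sgn {d} {T : measurableType d} {R : realType} (f : T -> R) :
  bm f -> bm (fun x => Num.sg (f x)).
Proof. by move=> [mf _]; exact: bm_sg. Qed.

Ltac bm_tac := repeat first
  [ assumption | apply: bm_cst | apply: bm_norm | apply: bm_sgn | apply: bmX
  | apply: bmD | apply: bmN | apply: bmM ].

(** An iterated integral, so that linearity, estimates and exchanges of order reduce to one variable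
    at a time; [strip_int_prodE] links it to the product measure. *)
Definition strip_int {R : realType} (T : R) (f : R * R -> R) : R :=
  \int[@lebesgue_measure R]_(x in `[0, 1]) \int[@lebesgue_measure R]_(t in `[0, T]) f (x, t).

Lemma bm_x {R : realType} (f : R * R -> R) (x : R) : bm f -> bm (fun t : R => f (x, t)).
Proof. by move=> bf; apply: bm_comp bf _; exact: measurable_pair1. Qed.

Lemma bm_t {R : realType} (f : R * R -> R) (t : R) : bm f -> bm (fun x : R => f (x, t)).
Proof. by move=> bf; apply: bm_comp bf _; exact: measurable_pair2. Qed.

Lemma bm_pair {R : realType} (f : R * R -> R) : bm f -> bm (fun p : R * R => f (p.1, p.2)).
Proof. by move=> bf; apply: bm_comp bf _; exact: measurable_fun_pair. Qed.

Lemma bm_sec {d} {S : measurableType d} {R : realType} (a b : R) (f : S * R -> R) :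
  bm f -> bm (fun x => \int[@lebesgue_measure R]_(y in `[a, b]) f (x, y)).
Proof.
move=> bf; apply: (bm_int1 a b (fun x y => f (x, y))).
by apply: bm_comp bf _; exact: measurable_fun_pair.
Qed.

Lemma bm_strip_int {d} {S : measurableType d} {R : realType} (T : R) (f : S -> R * R -> R) :
  bm (fun sp : S * (R * R) => f sp.1 sp.2) -> bm (fun s => strip_int T (f s)).
Proof.
move=> bf; rewrite /strip_int.
apply: (bm_int1 0 1 (fun s x => \int[@lebesgue_measure R]_(t in `[0, T]) f s (x, t))).
apply: (bm_int1 0 T (fun (sx : S * R) t => f sx.1 (sx.2, t))).
apply: (bm_comp _ (fun p : S * R * R => (p.1.1, (p.1.2, p.2))) bf).
apply: measurable_fun_pair; first exact: measurableT_comp.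
by apply: measurable_fun_pair => //; exact: measurableT_comp.
Qed.

Lemma strip_int_le {R : realType} (T : R) (f g : R * R -> R) : bm f -> bm g ->
  (forall x t, 0 <= x <= 1 -> 0 <= t <= T -> f (x, t) <= g (x, t)) -> strip_int T f <= strip_int T g.
Proof.
move=> bf bg fg; apply: le_int1; [exact: bm_sec|exact: bm_sec|move=> x x01].
by apply: le_int1; [exact: bm_x|exact: bm_x|move=> t tT; exact: fg].
Qed.

Lemma eq_strip_int {R : realType} (T : R) (f g : R * R -> R) :
  (forall x t, 0 <= x <= 1 -> 0 <= t <= T -> f (x, t) = g (x, t)) -> strip_int T f = strip_int T g.
Proof.
by move=> fg; apply: eq_int1 => x x01; apply: eq_int1 => t tT; exact: fg.
Qed.

Lemma strip_intD {R : realType} (T : R) (f g : R * R -> R) : bm f -> bm g ->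
  strip_int T (fun p => f p + g p) = strip_int T f + strip_int T g.
Proof.
move=> bf bg; rewrite /strip_int -int1D; [|exact: bm_sec|exact: bm_sec].
by apply: eq_int1 => x _; rewrite int1D//; exact: bm_x.
Qed.

Lemma strip_intZl {R : realType} (T c : R) (f : R * R -> R) : bm f ->
  strip_int T (fun p => c * f p) = c * strip_int T f.
Proof.
move=> bf; rewrite /strip_int -int1Zl; last exact: bm_sec.
by apply: eq_int1 => x _; rewrite int1Zl//; exact: bm_x.
Qed.

Lemma strip_intN {R : realType} (T : R) (f : R * R -> R) : bm f ->
  strip_int T (fun p => - f p) = - strip_int T f.
Proof.
move=> bf; rewrite -mulN1r -strip_intZl//; apply: eq_strip_int => x t _ _; by rewrite mulN1r.
Qed.

Lemma strip_int_ge0 {R : realType} (T : R) (f : R * R -> R) :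
  (forall x t, 0 <= x <= 1 -> 0 <= t <= T -> 0 <= f (x, t)) -> 0 <= strip_int T f.
Proof.
move=> f0; apply: Rintegral_ge0 => x; rewrite /= in_itv/= => x01.
by apply: Rintegral_ge0 => t; rewrite /= in_itv/= => tT; exact: f0.
Qed.

Lemma strip_int_swapxt {R : realType} (T : R) (f : R * R -> R) : bm f ->
  strip_int T f = \int[@lebesgue_measure R]_(t in `[0, T]) \int[@lebesgue_measure R]_(x in `[0, 1]) f (x, t).
Proof.
by move=> bf; apply: (int1_swap 0 1 0 T (fun x t => f (x, t))); exact: bm_pair.
Qed.

Lemma strip_int_prodE {R : realType} (T : R) (f : R * R -> R) : bm f ->
  \int[(@lebesgue_measure R \x @lebesgue_measure R)%E]_(p in `[0, 1] `*` `[0, T]) f p = strip_int T f.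
Proof.
move=> bf.
exact: (Rintegral_prod (@lebesgue_measure R) (@lebesgue_measure R) `[0, 1] `[0, T] f
  (findom_itv 0 1) (findom_itv 0 T) bf).1.
Qed.

Lemma strip_int_int1_swap {R : realType} (T a b : R) (f : R -> R * R -> R) :
  bm (fun sp : R * (R * R) => f sp.1 sp.2) ->
  strip_int T (fun p => \int[@lebesgue_measure R]_(s in `[a, b]) f s p) =
  \int[@lebesgue_measure R]_(s in `[a, b]) strip_int T (f s).
Proof.
move=> bf; rewrite /strip_int.
rewrite [RHS](int1_swap a b 0 1
  (fun s x => \int[@lebesgue_measure R]_(t in `[0, T]) f s (x, t))); last first.
  apply: (bm_int1 0 T (fun (sx : R * R) t => f sx.1 (sx.2, t))).
  apply: (bm_comp _ (fun p : R * R * R => (p.1.1, (p.1.2, p.2))) bf).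
  apply: measurable_fun_pair; first exact: measurableT_comp.
  by apply: measurable_fun_pair => //; exact: measurableT_comp.
apply: eq_int1 => x _; apply: (int1_swap 0 T a b (fun t s => f s (x, t))).
apply: (bm_comp _ (fun p : R * R => (p.2, (x, p.1))) bf).
by apply: measurable_fun_pair => //; apply: measurable_fun_pair.
Qed.

Lemma strip_int_swap {R : realType} (T : R) (F : R * R -> R * R -> R) :
  bm (fun pq : (R * R) * (R * R) => F pq.1 pq.2) ->
  strip_int T (fun p => strip_int T (F p)) = strip_int T (fun q => strip_int T (fun p => F p q)).
Proof.
move=> bF; rewrite {1}/strip_int.
transitivity (\int[@lebesgue_measure R]_(x in `[0, 1])
  strip_int T (fun q => \int[@lebesgue_measure R]_(t in `[0, T]) F (x, t) q)).
  apply: eq_int1 => x _; rewrite strip_int_int1_swap//.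
  apply: (bm_comp _ (fun p : R * (R * R) => ((x, p.1), p.2)) bF).
  by apply: measurable_fun_pair => //; apply: measurable_fun_pair.
rewrite -(strip_int_int1_swap T 0 1
  (fun x q => \int[@lebesgue_measure R]_(t in `[0, T]) F (x, t) q))//.
apply: (bm_int1 0 T (fun (sx : R * (R * R)) t => F (sx.1, t) sx.2)).
apply: (bm_comp _ (fun p : R * (R * R) * R => ((p.1.1, p.2), p.1.2)) bF).
apply: measurable_fun_pair; last exact: measurableT_comp.
by apply: measurable_fun_pair => //; exact: measurableT_comp.
Qed.

Lemma int1_cvg0_neq {R : realType} (a b c : R) (f : nat -> R -> R) (M : R) :
  (forall n, bm (f n)) -> (forall n x, a <= x <= b -> `|f n x| <= M) ->
  (forall x, x != c -> a <= x <= b -> f n x @[n --> \oo] --> 0) ->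
  \int[@lebesgue_measure R]_(x in `[a, b]) f n x @[n --> \oo] --> 0.
Proof.
move=> bf fM f0; apply: (int1_cvg0 _ _ _ M) => //.
exists [set c]; split => //; first exact: lebesgue_measure_set1.
move=> x /= h; apply: contrapT => /eqP xc; apply: h; exact: f0.
Qed.

(** Dominated convergence in t, then in x. Convergence is asked for t < T only, to match
    [mollify_time]; the final time is a null set. *)
Lemma strip_int_cvg0 {R : realType} (T M : R) (f : nat -> R * R -> R) : 0 <= T ->
  (forall n, bm (f n)) ->
  (forall n x t, 0 <= x <= 1 -> 0 <= t <= T -> `|f n (x, t)| <= M) ->
  (forall x t, 0 <= x <= 1 -> 0 <= t < T -> f n (x, t) @[n --> \oo] --> 0) ->
  strip_int T (f n) @[n --> \oo] --> 0.
Proof.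
move=> T0 bf fM f0; apply: (int1_cvg0_neq 0 1 0 _ (M * T)).
- by move=> n; exact: bm_sec.
- move=> n x x01; have b := bm_x _ x (bf n).
  apply: le_trans (norm_int1 _ _ _ b) _.
  have -> : M * T = \int[@lebesgue_measure R]_(t in `[0, T]) M.
    by rewrite Rintegral_itv_cst// subr0.
  by apply: le_int1; [exact: bm_norm|exact: bm_cst|move=> t tT; exact: fM].
- move=> x _ x01; apply: (int1_cvg0_neq 0 T T _ M).
  + by move=> n; exact: bm_x.
  + by move=> n t tT; exact: fM.
  + move=> t tT /andP[t0 t1]; apply: f0 => //.
    by rewrite t0 lt_neqAle tT.
Qed.

(** * Doubling of variables *)

Definition Kconv {R : realType} (u : R -> R -> R) (p : R * R) : R :=
  convT Kp (fun y => u y p.2) p.1.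

(** The entropy integrand for the product a(x) b(t), with lambda already removed from the
    convolution, as [Kp_mean0] permits. *)
Definition flux_integrand {R : realType} (u : R -> R -> R) (lam : R)
  (a a' b b' : R -> R) (p : R * R) : R :=
  `|u p.1 p.2 - lam| * (a p.1 * b' p.2)
  + Num.sg (u p.1 p.2 - lam) * ((u p.1 p.2 ^+ 2 - lam ^+ 2) / 2) * (a' p.1 * b p.2)
  - Num.sg (u p.1 p.2 - lam) * Kconv u p * (a p.1 * b p.2).

Definition kruzhkov_ineq {R : realType} (T : R) (u0 : R -> R) (u : R -> R -> R) :=
  forall (lam : R) (a a' b b' : R -> R),
  C1 a a' -> C1 b b' -> bm a -> bm a' -> bm b -> bm b' ->
  (forall x, a (x + 1) = a x) ->
  (forall x, 0 <= a x) -> (forall t, 0 <= b t) ->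
  (exists B : R, forall t, B < `|t| -> b t = 0) ->
  0 <= strip_int T (flux_integrand u lam a a' b b')
     + \int[@lebesgue_measure R]_(x in `[0, 1]) (`|u0 x - lam| * (a x * b 0)).

(** The properties of a solution on which the doubling argument rests, for a representative bounded
    at every point of the plane. Its values may then serve as lambda everywhere, and all integrands
    belong to [bm]. *)
Definition bounded_solution {R : realType} (T : R) (u0 : R -> R) (u : R -> R -> R) :=
  [/\ bm (fun p : R * R => u p.1 p.2), bm u0,
      forall g : R -> R, bm g ->
        {within `[0, T], continuous (fun t => \int[@lebesgue_measure R]_(x in `[0, 1]) (u x t * g x))}
    & kruzhkov_ineq T u0 u].

Lemma bm_Kconv {R : realType} (u : R -> R -> R) :
  bm (fun p : R * R => u p.1 p.2) -> bm (Kconv u).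
Proof.
move=> bu.
apply: (bm_int1 0 1 (fun (p : R * R) y => Kp (p.1 - y) * u y p.2)).
apply: bmM.
  apply: (bm_comp _ (fun p : R * R * R => p.1.1 - p.2) bm_Kp).
  by apply: measurable_funB => //; exact: measurableT_comp.
apply: (bm_comp _ (fun p : R * R * R => (p.2, p.1.2)) bu).
by apply: measurable_fun_pair => //; exact: measurableT_comp.
Qed.

Section measurable_projections.
Context {d1 d2 d3 d4 : measure_display} {T1 : measurableType d1} {T2 : measurableType d2}
  {T3 : measurableType d3} {T4 : measurableType d4}.

Lemma measurable_fst_fst : measurable_fun setT (fun p : T1 * T2 * T3 => p.1.1).
Proof. exact: measurableT_comp. Qed.
Lemma measurable_fst_snd : measurable_fun setT (fun p : T1 * T2 * T3 => p.1.2).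
Proof. exact: measurableT_comp. Qed.
Lemma measurable_snd_fst : measurable_fun setT (fun p : T1 * (T2 * T3) => p.2.1).
Proof. exact: measurableT_comp. Qed.
Lemma measurable_snd_snd : measurable_fun setT (fun p : T1 * (T2 * T3) => p.2.2).
Proof. exact: measurableT_comp. Qed.

End measurable_projections.

(** In F1 + F2 the two [kern'] terms cancel, and so do the flux terms: exchanging u and v changes
    the sign of both sgn and the difference of squares, while the derivatives of [pkern e (x - y)]
    in x and in y are opposite. *)
Lemma kruzhkov_doubling {R : realType} (T h e : R) (u0 v0 : R -> R) (u v : R -> R -> R)
  (eta eta' : R -> R) :
  0 <= T ->
  0 < h -> 0 < e -> e < 1 -> bounded_solution T u0 u -> bounded_solution T v0 v ->
  C1 eta eta' -> bm eta -> bm eta' -> (forall t, 0 <= eta t) ->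
  0 <= strip_int T (fun p => strip_int T (fun q =>
         `|u p.1 p.2 - v q.1 q.2| * eta' p.2 * (kern h (q.2 - p.2) * pkern e (p.1 - q.1))
         - Num.sg (u p.1 p.2 - v q.1 q.2) * (Kconv u p - Kconv v q) * eta p.2
           * (kern h (q.2 - p.2) * pkern e (p.1 - q.1))))
     + \int[@lebesgue_measure R]_(x in `[0, 1]) strip_int T (fun q =>
         `|u0 x - v q.1 q.2| * (pkern e (x - q.1) * (eta 0 * kern h q.2))).
Proof.
move=> T0 h0 e0 e1 [bu bu0 _ Eu] [bv bv0 _ Ev] Ceta beta beta' eta0.
have Cper := C1_pkern e e0 e1; have Cker := C1_kern h.
have bper := bm_pkern e e0 e1; have bper' := bm_pkern' e e0 e1.
have bker := bm_kern h h0; have bker' := bm_kern' h h0.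
have bKu := bm_Kconv u bu; have bKv := bm_Kconv v bv.
(* [k1 s] is the derivative of [eta t * kern h (s - t)] in t. [F1 q] is the integrand for u with q =
   (y, s) frozen, [F2 p] the one for v with p = (x, t) frozen. *)
pose k1 s t : R := eta' t * kern h (s - t) - eta t * kern' h (s - t).
pose F1 (q p : R * R) : R := flux_integrand u (v q.1 q.2) (fun x => pkern e (x - q.1))
  (fun x => pkern' e (x - q.1)) (fun t => eta t * kern h (q.2 - t)) (k1 q.2) p.
pose F2 (p q : R * R) : R := flux_integrand v (u p.1 p.2) (fun y => pkern e (p.1 - y))
  (fun y => - pkern' e (p.1 - y)) (fun s => eta p.2 * kern h (s - p.2))
  (fun s => eta p.2 * kern' h (s - p.2)) q.
pose J (x : R) (q : R * R) : R := `|u0 x - v q.1 q.2| * (pkern e (x - q.1) * (eta 0 * kern h q.2)).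
have m11 := @measurable_fst_fst _ _ _ R R (R * R)%type.
have m12 := @measurable_fst_snd _ _ _ R R (R * R)%type.
have m21 := @measurable_snd_fst _ _ _ (R * R)%type R R.
have m22 := @measurable_snd_snd _ _ _ (R * R)%type R R.
have bF1 : bm (fun qp : (R * R) * (R * R) => F1 qp.1 qp.2).
  rewrite /F1 /k1 /flux_integrand.
  have l1 : bm (fun qp : (R * R) * (R * R) => u qp.2.1 qp.2.2) by exact: (bm_comp _ _ bu).
  have l2 : bm (fun qp : (R * R) * (R * R) => v qp.1.1 qp.1.2) by exact: (bm_comp _ _ bv).
  have l3 : bm (fun qp : (R * R) * (R * R) => Kconv u qp.2) by exact: (bm_comp _ _ bKu).
  have l4 : bm (fun qp : (R * R) * (R * R) => pkern e (qp.2.1 - qp.1.1)).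
    by apply: (bm_comp _ _ bper); exact: measurable_funB.
  have l5 : bm (fun qp : (R * R) * (R * R) => pkern' e (qp.2.1 - qp.1.1)).
    by apply: (bm_comp _ _ bper'); exact: measurable_funB.
  have l6 : bm (fun qp : (R * R) * (R * R) => kern h (qp.1.2 - qp.2.2)).
    by apply: (bm_comp _ _ bker); exact: measurable_funB.
  have l7 : bm (fun qp : (R * R) * (R * R) => kern' h (qp.1.2 - qp.2.2)).
    by apply: (bm_comp _ _ bker'); exact: measurable_funB.
  have l8 : bm (fun qp : (R * R) * (R * R) => eta qp.2.2) by exact: (bm_comp _ _ beta).
  have l9 : bm (fun qp : (R * R) * (R * R) => eta' qp.2.2) by exact: (bm_comp _ _ beta').
  by bm_tac.
have bF2 : bm (fun pq : (R * R) * (R * R) => F2 pq.1 pq.2).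
  rewrite /F2 /flux_integrand.
  have l1 : bm (fun pq : (R * R) * (R * R) => v pq.2.1 pq.2.2) by exact: (bm_comp _ _ bv).
  have l2 : bm (fun pq : (R * R) * (R * R) => u pq.1.1 pq.1.2) by exact: (bm_comp _ _ bu).
  have l3 : bm (fun pq : (R * R) * (R * R) => Kconv v pq.2) by exact: (bm_comp _ _ bKv).
  have l4 : bm (fun pq : (R * R) * (R * R) => pkern e (pq.1.1 - pq.2.1)).
    by apply: (bm_comp _ _ bper); exact: measurable_funB.
  have l5 : bm (fun pq : (R * R) * (R * R) => pkern' e (pq.1.1 - pq.2.1)).
    by apply: (bm_comp _ _ bper'); exact: measurable_funB.
  have l6 : bm (fun pq : (R * R) * (R * R) => kern h (pq.2.2 - pq.1.2)).
    by apply: (bm_comp _ _ bker); exact: measurable_funB.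
  have l7 : bm (fun pq : (R * R) * (R * R) => kern' h (pq.2.2 - pq.1.2)).
    by apply: (bm_comp _ _ bker'); exact: measurable_funB.
  have l8 : bm (fun pq : (R * R) * (R * R) => eta pq.1.2) by exact: (bm_comp _ _ beta).
  by bm_tac.
have bJ : bm (fun xq : R * (R * R) => J xq.1 xq.2).
  have n21 := @measurable_snd_fst _ _ _ R R R.
  have n22 := @measurable_snd_snd _ _ _ R R R.
  rewrite /J.
  have l1 : bm (fun xq : R * (R * R) => u0 xq.1) by exact: (bm_comp _ _ bu0).
  have l2 : bm (fun xq : R * (R * R) => v xq.2.1 xq.2.2) by exact: (bm_comp _ _ bv).
  have l3 : bm (fun xq : R * (R * R) => pkern e (xq.1 - xq.2.1)).
    by apply: (bm_comp _ _ bper); exact: measurable_funB.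
  have l4 : bm (fun xq : R * (R * R) => kern h xq.2.2) by exact: (bm_comp _ _ bker).
  by bm_tac.
have bF1q q : bm (F1 q).
  by apply: (bm_comp _ (fun p => (q, p)) bF1); exact: measurable_pair1.
have bF2p p : bm (F2 p).
  by apply: (bm_comp _ (fun q => (p, q)) bF2); exact: measurable_pair1.
have Cper_l y : C1 (fun x => pkern e (x - y)) (fun x => pkern' e (x - y)).
  by apply: C1_ext (C1_comp _ _ _ _ Cper (C1_affine 1 (- y))) => x; rewrite mul1r ?mulr1.
have Cper_r x : C1 (fun y => pkern e (x - y)) (fun y => - pkern' e (x - y)).
  apply: C1_ext (C1_comp _ _ _ _ Cper (C1_affine (-1) x)) => y; rewrite mulN1r (addrC (- y))//.
  by rewrite mulrN1.
have Cker_l t : C1 (fun s => kern h (s - t)) (fun s => kern' h (s - t)).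
  by apply: C1_ext (C1_comp _ _ _ _ Cker (C1_affine 1 (- t))) => s; rewrite mul1r ?mulr1.
have Cker_r s : C1 (fun t => kern h (s - t)) (fun t => - kern' h (s - t)).
  apply: C1_ext (C1_comp _ _ _ _ Cker (C1_affine (-1) s)) => t; rewrite mulN1r (addrC (- t))//.
  by rewrite mulrN1.
have ker0 r : 0 <= kern h r by case/andP: (kern_itv h r h0).
have per0 r : 0 <= pkern e r by case/andP: (pkern_itv e r e0).
(* [eta] is merely bounded; the compact support in time required of test functions is supplied by
   the kernel. *)
have kern_supp s : exists B : R, forall t, B < `|t| -> kern h (s - t) = 0 /\ kern h (t - s) = 0.
  exists (`|s| + h) => t; rewrite lter_normr => /orP[] ht.
    have := ler_norm s; split; [rewrite kern_le0//; lra|rewrite kern_geh//; lra].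
  have := ler_norm (- s); rewrite normrN => ?.
  split; [rewrite kern_geh//; lra|rewrite kern_le0//; lra].
have I1 q : 0 <= strip_int T (F1 q) + \int[@lebesgue_measure R]_(x in `[0, 1]) J x q.
  have := Eu (v q.1 q.2) _ _ _ _ (Cper_l q.1) (C1M _ _ _ _ Ceta (Cker_r q.2)).
  have -> : (fun t => eta' t * kern h (q.2 - t) + eta t * (- kern' h (q.2 - t))) = k1 q.2.
    by apply/funext => t; rewrite /k1 mulrN.
  rewrite /J subr0; apply.
  - exact: bm_shift'.
  - exact: bm_shift'.
  - by apply: bmM => //; exact: bm_shift.
  - by rewrite /k1; apply: bmB; apply: bmM => //; exact: bm_shift.
  - by move=> x; rewrite addrAC pkern_periodic.
  - by [].
  - by move=> t; rewrite mulr_ge0.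
  - by have [B HB] := kern_supp q.2; exists B => t /HB[-> _]; rewrite mulr0.
have I2 p : 0 <= p.2 -> 0 <= strip_int T (F2 p).
  move=> p2.
  have := Ev (u p.1 p.2) _ _ _ _ (Cper_r p.1) (C1Zl (eta p.2) _ _ (Cker_l p.2)).
  rewrite (_ : \int[_]_(x in _) _ = 0); last first.
    rewrite (@eq_int1 _ _ _ _ (fun=> 0)) ?Rintegral_itv_cst ?mul0r//.
    by move=> x _; rewrite kern_le0 ?mulr0//; lra.
  rewrite addr0; apply.
  - exact: bm_shift.
  - by apply: bmN; exact: bm_shift.
  - by apply: bmM; [exact: bm_cst|exact: bm_shift'].
  - by apply: bmM; [exact: bm_cst|exact: bm_shift'].
  - by move=> y; rewrite opprD addrA -(pkern_periodic e (_ - 1)) subrK.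
  - by [].
  - by move=> t; rewrite mulr_ge0.
  - by have [B HB] := kern_supp p.2; exists B => t /HB[_ ->]; rewrite mulr0.
have bIF1 : bm (fun q => strip_int T (F1 q)) by exact: bm_strip_int.
have bIF2 : bm (fun p => strip_int T (F2 p)) by exact: bm_strip_int.
have bIJ : bm (fun q => \int[@lebesgue_measure R]_(x in `[0, 1]) J x q).
  apply: (bm_int1 0 1 (fun q x => J x q)).
  by apply: (bm_comp _ (fun qx : R * R * R => (qx.2, qx.1)) bJ); exact: measurable_fun_pair.
have : 0 <= strip_int T (fun q => strip_int T (F1 q) + \int[@lebesgue_measure R]_(x in `[0, 1]) J x q).
  by apply: strip_int_ge0 => x t _ _; exact: I1.
rewrite (strip_intD T _ _ bIF1 bIJ) (strip_int_int1_swap T 0 1 J bJ) (strip_int_swap T F1 bF1).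
have : 0 <= strip_int T (fun p => strip_int T (F2 p)).
  by apply: strip_int_ge0 => x t _ /andP[t0 _]; exact: I2.
move=> H2 H1.
have bIF1' : bm (fun p => strip_int T (fun q => F1 q p)).
  apply: (bm_strip_int T (fun p q => F1 q p)).
  by apply: (bm_comp _ (fun pq => (pq.2, pq.1)) bF1); exact: measurable_fun_pair.
have bF1p p : bm (fun q => F1 q p).
  by apply: (bm_comp _ (fun q => (q, p)) bF1); exact: measurable_pair2.
have -> : strip_int T (fun p => strip_int T (fun q =>
         `|u p.1 p.2 - v q.1 q.2| * eta' p.2 * (kern h (q.2 - p.2) * pkern e (p.1 - q.1))
         - Num.sg (u p.1 p.2 - v q.1 q.2) * (Kconv u p - Kconv v q) * eta p.2
           * (kern h (q.2 - p.2) * pkern e (p.1 - q.1)))) =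
   strip_int T (fun p => strip_int T (fun q => F1 q p)) + strip_int T (fun p => strip_int T (F2 p)).
  rewrite -(strip_intD T _ _ bIF1' bIF2); apply: eq_strip_int => x t _ _.
  rewrite -(strip_intD T _ _ (bF1p (x, t)) (bF2p (x, t))); apply: eq_strip_int => y s _ _.
  rewrite /F1 /F2 /flux_integrand /k1 /=.
  rewrite -(opprB (u x t) (v y s)) sgrN normrN.
  ring.
by rewrite addrAC addr_ge0.
Qed.

(** * The initial layer *)

Lemma bm_step {R : realType} : bm (@step R).
Proof.
split; first by apply: continuous_measurable_fun; exact: C1_continuous C1_step.
by exists 1 => x; have /andP[a b] := step_itv x; rewrite ger0_norm.
Qed.

Lemma bm_bump {R : realType} : bm (@bump R).
Proof.
split; first by apply: continuous_measurable_fun; exact: C1_continuous C1_bump.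
by exists 30 => x; have /andP[a b] := bump_itv x; rewrite ger0_norm.
Qed.

(** The time derivative of 1 - S(s/h) is [- kern h], which produces the left-hand side. The flux and
    nonlocal terms carry the undifferentiated factor 1 - S(s/h), which lives on s < h and makes them
    negligible as h tends to 0. *)
Lemma initial_layer {R : realType} (T e : R) (u0 v0 : R -> R) (v : R -> R -> R) :
  0 <= T -> 0 < e -> e < 1 -> bm u0 -> bounded_solution T v0 v ->
  exists C : R, forall h, 0 < h ->
  \int[@lebesgue_measure R]_(x in `[0, 1]) strip_int T (fun q =>
         `|u0 x - v q.1 q.2| * (pkern e (x - q.1) * kern h q.2)) <=
  \int[@lebesgue_measure R]_(x in `[0, 1]) \int[@lebesgue_measure R]_(y in `[0, 1])
         (pkern e (x - y) * `|u0 x - v0 y|)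
  + C * \int[@lebesgue_measure R]_(s in `[0, T]) (1 - step (s / h)).
Proof.
move=> T0 e0 e1 bu0 [bv bv0 _ Ev].
have Cper := C1_pkern e e0 e1.
have bper := bm_pkern e e0 e1; have bper' := bm_pkern' e e0 e1.
have bKv := bm_Kconv v bv.
have per0 r : 0 <= pkern e r by case/andP: (pkern_itv e r e0).
have n21 := @measurable_snd_fst _ _ _ R R R.
have n22 := @measurable_snd_snd _ _ _ R R R.
have l1 : bm (fun xq : R * (R * R) => u0 xq.1) by exact: (bm_comp _ _ bu0).
have l2 : bm (fun xq : R * (R * R) => v xq.2.1 xq.2.2) by exact: (bm_comp _ _ bv).
have l3 : bm (fun xq : R * (R * R) => pkern e (xq.1 - xq.2.1)).
  by apply: (bm_comp _ _ bper); exact: measurable_funB.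
have l4 : bm (fun xq : R * (R * R) => pkern' e (xq.1 - xq.2.1)).
  by apply: (bm_comp _ _ bper'); exact: measurable_funB.
have l5 : bm (fun xq : R * (R * R) => Kconv v xq.2) by exact: (bm_comp _ _ bKv).
pose G (x : R) (q : R * R) : R :=
  - (Num.sg (v q.1 q.2 - u0 x) * ((v q.1 q.2 ^+ 2 - u0 x ^+ 2) / 2) * pkern' e (x - q.1))
  - Num.sg (v q.1 q.2 - u0 x) * Kconv v q * pkern e (x - q.1).
have bG : bm (fun xq : R * (R * R) => G xq.1 xq.2) by rewrite /G; bm_tac.
(* [C] may depend on e, through [pkern' e], but it is fixed before h. *)
have [_ [C GC]] := bG; exists C => h h0.
(* the factor step (s + 2) is 1 for s >= 0 and makes the support of b bounded *)
pose b (s : R) : R := step (s + 2) * (1 - step (s / h)).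
pose b' (s : R) : R := bump (s + 2) * (1 - step (s / h)) + step (s + 2) * (- kern h s).
have Cb : C1 b b'.
  apply: C1M.
    apply: C1_ext (C1_comp _ _ _ _ C1_step (C1_affine 1 2)) => s; by rewrite mul1r ?mulr1.
  apply: C1_ext (C1D _ _ _ _ (C1_cst 1) (C1Zl (-1) _ _ (C1_step_scale h))) => s;
    by rewrite mulN1r ?add0r.
have bs2 : bm (fun s : R => step (s + 2)).
  by apply: (bm_comp _ _ bm_step); exact: measurable_funD.
have bb2 : bm (fun s : R => bump (s + 2)).
  by apply: (bm_comp _ _ bm_bump); exact: measurable_funD.
have bsh : bm (fun s : R => step (s / h)).
  by apply: (bm_comp _ _ bm_step); exact: measurable_funM.
have bker := bm_kern h h0.
have bb : bm b by rewrite /b; bm_tac.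
have bb' : bm b' by rewrite /b'; bm_tac.
have bE s : 0 <= s -> b s = 1 - step (s / h).
  by move=> s0; rewrite /b (step_ge1 (s + 2)) ?mul1r//; lra.
have b'E s : 0 <= s -> b' s = - kern h s.
  by move=> s0; rewrite /b' bump_ge1 ?mul0r ?add0r ?(step_ge1 (s + 2)) ?mul1r//; lra.
have b0 s : 0 <= b s.
  have /andP[a1 a2] := step_itv (s + 2); have /andP[a3 a4] := step_itv (s / h).
  by rewrite mulr_ge0// subr_ge0.
have bsupp : exists B : R, forall t, B < `|t| -> b t = 0.
  exists (2 + h) => t; rewrite lter_normr => /orP[] ht.
    by rewrite /b (step_ge1 (t / h)) ?subrr ?mulr0// ler_pdivlMr//; lra.
  by rewrite /b step_le0 ?mul0r//; lra.
have Cper_r x : C1 (fun y => pkern e (x - y)) (fun y => - pkern' e (x - y)).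
  apply: C1_ext (C1_comp _ _ _ _ Cper (C1_affine (-1) x)) => y; rewrite mulN1r (addrC (- y))//.
  by rewrite mulrN1.
have bL : bm (fun xq : R * (R * R) => `|u0 xq.1 - v xq.2.1 xq.2.2| * (pkern e (xq.1 - xq.2.1) * kern h xq.2.2)).
  have l6 : bm (fun xq : R * (R * R) => kern h xq.2.2) by exact: (bm_comp _ _ bker).
  by bm_tac.
have bLx x : bm (fun q : R * R => `|u0 x - v q.1 q.2| * (pkern e (x - q.1) * kern h q.2)).
  by apply: (bm_comp _ (fun q => (x, q)) bL); exact: measurable_pair1.
have bS : bm (fun p : R * R => pkern e (p.1 - p.2) * `|u0 p.1 - v0 p.2|).
  have k1 : bm (fun p : R * R => pkern e (p.1 - p.2)) by exact: bm_pkern2.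
  have k2 : bm (fun p : R * R => u0 p.1) by exact: (bm_comp _ _ bu0).
  have k3 : bm (fun p : R * R => v0 p.2) by exact: (bm_comp _ _ bv0).
  by bm_tac.
have -> : C * \int[@lebesgue_measure R]_(s in `[0, T]) (1 - step (s / h)) =
    \int[@lebesgue_measure R]_(x in `[0, 1]) (C * \int[@lebesgue_measure R]_(s in `[0, T]) (1 - step (s / h))).
  by rewrite Rintegral_itv_cst// subr0 mulr1.
have bS1 : bm (fun x : R => \int[@lebesgue_measure R]_(y in `[0, 1]) (pkern e (x - y) * `|u0 x - v0 y|)).
  exact: (bm_int1 0 1 (fun x y : R => pkern e (x - y) * `|u0 x - v0 y|)).
rewrite -int1D//; last exact: bm_cst.
apply: le_int1.
- exact: (bm_strip_int T (fun (x : R) q => `|u0 x - v q.1 q.2| * (pkern e (x - q.1) * kern h q.2))).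
- by apply: bmD => //; exact: bm_cst.
move=> x x01.
have bGx : bm (G x) by apply: (bm_comp _ (fun q => (x, q)) bG); exact: measurable_pair1.
have bq2 : bm (fun q : R * R => b q.2) by exact: (bm_comp _ _ bb).
have := Ev (u0 x) _ _ _ _ (Cper_r x) Cb.
have -> : \int[@lebesgue_measure R]_(y in `[0, 1]) (`|v0 y - u0 x| * (pkern e (x - y) * b 0)) =
    \int[@lebesgue_measure R]_(y in `[0, 1]) (pkern e (x - y) * `|u0 x - v0 y|).
  apply: eq_int1 => y _; rewrite bE// mul0r step_le0// subr0 mulr1 distrC mulrC//.
have -> : strip_int T (flux_integrand v (u0 x) (fun y => pkern e (x - y)) (fun y => - pkern' e (x - y)) b b') =
    - strip_int T (fun q => `|u0 x - v q.1 q.2| * (pkern e (x - q.1) * kern h q.2))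
    + strip_int T (fun q => G x q * b q.2).
  rewrite -(strip_intN T _ (bLx x)) -(strip_intD T _ _ (bmN _ (bLx x)) (bmM _ _ bGx bq2)).
  apply: eq_strip_int => y s _ /andP[s0 _]; rewrite /flux_integrand /G /= b'E// distrC; ring.
have le1 : strip_int T (fun q => G x q * b q.2) <=
    C * \int[@lebesgue_measure R]_(s in `[0, T]) (1 - step (s / h)).
  have -> : C * \int[@lebesgue_measure R]_(s in `[0, T]) (1 - step (s / h)) =
      strip_int T (fun q => C * b q.2).
    rewrite (strip_intZl T C _ bq2); congr (_ * _).
    rewrite /strip_int [RHS](@eq_int1 _ _ _ _ (fun=> \int[@lebesgue_measure R]_(s in `[0, T]) (1 - step (s / h)))).
      by rewrite Rintegral_itv_cst// subr0 mulr1.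
    by move=> z _; apply: eq_int1 => s /andP[s0 _]; rewrite /= bE.
  apply: strip_int_le; [exact: bmM|by apply: bmM => //; exact: bm_cst|].
  move=> y s _ _ /=; apply: ler_wpM2r => //.
  by have := GC (x, (y, s)); rewrite ler_norml => /andP[].
move=> H.
have {}H : 0 <= - strip_int T (fun q => `|u0 x - v q.1 q.2| * (pkern e (x - q.1) * kern h q.2))
    + strip_int T (fun q => G x q * b q.2)
    + \int[@lebesgue_measure R]_(y in `[0, 1]) (pkern e (x - y) * `|u0 x - v0 y|).
  apply: H => //.
  - exact: bm_shift.
  - by apply: bmN; exact: bm_shift.
  - by move=> y; rewrite opprD addrA -(pkern_periodic e (_ - 1)) subrK.
by lra.
Qed.

Lemma layer_cvg0 {R : realType} (T : R) :
  \int[@lebesgue_measure R]_(s in `[0, T]) (1 - step (s / mesh n)) @[n --> \oo] --> 0.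
Proof.
apply: (int1_cvg0_neq 0 T 0 _ 1).
- move=> n; apply: bmB; first exact: bm_cst.
  by apply: (bm_comp _ _ bm_step); exact: measurable_funM.
- move=> n s _; have /andP[a b] := step_itv (s / mesh n).
  by rewrite ger0_norm ?subr_ge0// gerBl.
- move=> s s0 /andP[s1 _]; have {s0 s1}s0 : 0 < s by rewrite lt_neqAle eq_sym s0.
  apply: cvg_near_cst; near=> n.
  rewrite step_ge1 ?subrr// ler_pdivlMr ?mesh_gt0// mul1r ltW//.
  by near: n; exact: near_mesh.
Unshelve. all: by end_near. Qed.

(** * Removing the time mollifier *)

Lemma le_cvg0 {R : realType} (X Y : R) (Z : nat -> R) :
  (\forall n \near \oo, X <= Y + Z n) -> Z n @[n --> \oo] --> 0 -> X <= Y.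
Proof.
move=> XY /cvgr0Pnorm_le Z0; apply/ler_addgt0Pr => e e0.
near \oo => n; apply: (@le_trans _ _ (Y + Z n)); first by near: n.
rewrite lerD2l; apply: le_trans (ler_norm _) _.
by near: n; exact: Z0.
Unshelve. all: by end_near. Qed.

Lemma strip_int_tensor {R : realType} (T : R) (f g : R -> R) : bm f -> bm g ->
  strip_int T (fun q => f q.1 * g q.2) =
  (\int[@lebesgue_measure R]_(x in `[0, 1]) f x) * \int[@lebesgue_measure R]_(t in `[0, T]) g t.
Proof.
move=> bf bg; rewrite mulrC -int1Zl//; apply: eq_int1 => x _.
by rewrite /= (int1Zl _ _ (f x) g bg) mulrC.
Qed.

(* The errors made by replacing q = (y,s) with p = (x,t) in the doubled integral:
   defect_x moves y to x at time t, defect_xt moves s to t for K' * v, and defect_t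
   moves s to t for v, where the average in y has to be taken first because v is
   only weak-* continuous in time. *)
Definition defect_x {R : realType} (e : R) (f : R * R -> R) (p : R * R) : R :=
  \int[@lebesgue_measure R]_(y in `[0, 1]) (pkern e (p.1 - y) * `|f p - f (y, p.2)|).

Definition mollif {R : realType} (e : R) (v : R -> R -> R) (x s : R) : R :=
  \int[@lebesgue_measure R]_(y in `[0, 1]) (v y s * pkern e (x - y)).

Definition defect_t {R : realType} (T h e : R) (v : R -> R -> R) (p : R * R) : R :=
  \int[@lebesgue_measure R]_(s in `[0, T])
     (kern h (s - p.2) * `|mollif e v p.1 p.2 - mollif e v p.1 s|).

Definition defect_xt {R : realType} (T h e : R) (f : R * R -> R) (p : R * R) : R :=
  \int[@lebesgue_measure R]_(y in `[0, 1]) (pkern e (p.1 - y) *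
    \int[@lebesgue_measure R]_(s in `[0, T]) (kern h (s - p.2) * `|f (y, p.2) - f (y, s)|)).

Lemma bm_defect_x {R : realType} (e : R) (f : R * R -> R) :
  0 < e -> e < 1 -> bm f -> bm (defect_x e f).
Proof.
move=> e0 e1 bf.
apply: (bm_int1 0 1 (fun (p : R * R) y => pkern e (p.1 - y) * `|f p - f (y, p.2)|)).
have m11 := @measurable_fst_fst _ _ _ R R R.
have m12 := @measurable_fst_snd _ _ _ R R R.
have l1 : bm (fun p : R * R * R => pkern e (p.1.1 - p.2)).
  by apply: (bm_comp _ _ (bm_pkern e e0 e1)); exact: measurable_funB.
have l2 : bm (fun p : R * R * R => f p.1) by exact: (bm_comp _ _ bf).
have l3 : bm (fun p : R * R * R => f (p.2, p.1.2)).
  by apply: (bm_comp _ (fun p : R * R * R => (p.2, p.1.2)) bf); exact: measurable_fun_pair.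
by bm_tac.
Qed.

Lemma bm_mollif {R : realType} (e : R) (v : R -> R -> R) :
  0 < e -> e < 1 -> bm (fun p : R * R => v p.1 p.2) -> bm (fun p : R * R => mollif e v p.1 p.2).
Proof.
move=> e0 e1 bv.
apply: (bm_int1 0 1 (fun (p : R * R) y => v y p.2 * pkern e (p.1 - y))).
have m11 := @measurable_fst_fst _ _ _ R R R.
have m12 := @measurable_fst_snd _ _ _ R R R.
have l1 : bm (fun p : R * R * R => pkern e (p.1.1 - p.2)).
  by apply: (bm_comp _ _ (bm_pkern e e0 e1)); exact: measurable_funB.
have l3 : bm (fun p : R * R * R => v p.2 p.1.2).
  by apply: (bm_comp _ (fun p : R * R * R => (p.2, p.1.2)) bv); exact: measurable_fun_pair.
by bm_tac.
Qed.

Lemma bm_defect_t {R : realType} (T h e : R) (v : R -> R -> R) :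
  0 < h -> 0 < e -> e < 1 -> bm (fun p : R * R => v p.1 p.2) -> bm (defect_t T h e v).
Proof.
move=> h0 e0 e1 bv; have bG := bm_mollif e v e0 e1 bv.
apply: (bm_int1 0 T (fun (p : R * R) s => kern h (s - p.2) * `|mollif e v p.1 p.2 - mollif e v p.1 s|)).
have m11 := @measurable_fst_fst _ _ _ R R R.
have m12 := @measurable_fst_snd _ _ _ R R R.
have l1 : bm (fun p : R * R * R => kern h (p.2 - p.1.2)).
  by apply: (bm_comp _ _ (bm_kern h h0)); exact: measurable_funB.
have l2 : bm (fun p : R * R * R => mollif e v p.1.1 p.1.2) by exact: (bm_comp _ _ bG).
have l3 : bm (fun p : R * R * R => mollif e v p.1.1 p.2).
  by apply: (bm_comp _ (fun p : R * R * R => (p.1.1, p.2)) bG); exact: measurable_fun_pair.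
by bm_tac.
Qed.

Lemma bm_time_osc {R : realType} (T h : R) (f : R * R -> R) : 0 < h -> bm f ->
  bm (fun p : R * R => \int[@lebesgue_measure R]_(s in `[0, T]) (kern h (s - p.2) * `|f p - f (p.1, s)|)).
Proof.
move=> h0 bf.
apply: (bm_int1 0 T (fun (p : R * R) s => kern h (s - p.2) * `|f p - f (p.1, s)|)).
have m11 := @measurable_fst_fst _ _ _ R R R.
have m12 := @measurable_fst_snd _ _ _ R R R.
have l1 : bm (fun p : R * R * R => kern h (p.2 - p.1.2)).
  by apply: (bm_comp _ _ (bm_kern h h0)); exact: measurable_funB.
have l2 : bm (fun p : R * R * R => f p.1) by exact: (bm_comp _ _ bf).
have l3 : bm (fun p : R * R * R => f (p.1.1, p.2)).
  by apply: (bm_comp _ (fun p : R * R * R => (p.1.1, p.2)) bf); exact: measurable_fun_pair.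
by bm_tac.
Qed.

Lemma bm_defect_xt {R : realType} (T h e : R) (f : R * R -> R) :
  0 < h -> 0 < e -> e < 1 -> bm f -> bm (defect_xt T h e f).
Proof.
move=> h0 e0 e1 bf; have bo := bm_time_osc T h f h0 bf.
apply: (bm_int1 0 1 (fun (p : R * R) y => pkern e (p.1 - y) *
    \int[@lebesgue_measure R]_(s in `[0, T]) (kern h (s - p.2) * `|f (y, p.2) - f (y, s)|))).
have m11 := @measurable_fst_fst _ _ _ R R R.
have m12 := @measurable_fst_snd _ _ _ R R R.
apply: bmM.
  by apply: (bm_comp _ _ (bm_pkern e e0 e1)); exact: measurable_funB.
by apply: (bm_comp _ (fun p : R * R * R => (p.2, p.1.2)) bo); exact: measurable_fun_pair.
Qed.

Lemma Kconv_diff {R : realType} (u v : R -> R -> R) (x t : R) :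
  bm (fun p : R * R => u p.1 p.2) -> bm (fun p : R * R => v p.1 p.2) ->
  `|Kconv u (x, t) - Kconv v (x, t)| <=
  Kp_Linf_norm * \int[@lebesgue_measure R]_(z in `[0, 1]) `|u z t - v z t|.
Proof.
move=> bu bv; rewrite /Kconv /convT /=.
have but : bm (fun z : R => u z t) by exact: (bm_t (fun p => u p.1 p.2)).
have bvt : bm (fun z : R => v z t) by exact: (bm_t (fun p => v p.1 p.2)).
have bKx : bm (fun z : R => Kp (x - z)) by apply: bm_shift; exact: bm_Kp.
rewrite -int1B; [|exact: bmM|exact: bmM].
apply: le_trans (norm_int1 _ _ _ _) _; first by bm_tac.
rewrite -int1Zl; last by bm_tac.
apply: le_int1; [by bm_tac|by bm_tac|].
by move=> z _; rewrite -mulrBr normrM; apply: ler_wpM2r => //; exact: Kp_le.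
Qed.

(** Here p = (x, t), q = (y, s), and [vy], [Kvy] are taken at the intermediate point (y, t). As eta'
    <= 0, a lower bound for |up - vq| is wanted; splitting up - vq through vp and vy and multiplying
    by the fixed sign sgn(up - vp) gives one in which vy - vq carries no absolute value. For the
    nonlocal term the triangle inequality suffices, since [Kconv v] is continuous in time at each
    point. *)
Lemma doubling_pointwise {R : realType} (up vp vy vq Ku Kvp Kvy Kvq eta eta' D : R) :
  0 <= eta -> eta' <= 0 -> `|Ku - Kvp| <= D ->
  `|up - vq| * eta' - Num.sg (up - vq) * (Ku - Kvq) * eta <=
  (eta' * `|up - vp| + eta * D) - eta' * `|vp - vy| + eta * `|Kvp - Kvy|
  + eta' * Num.sg (up - vp) * (vy - vq) + eta * `|Kvy - Kvq|.
Proof.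
move=> eta0 eta'0 KD.
have sg1 (x y : R) : - `|y| <= Num.sg x * y.
  rewrite -[leRHS]opprK lerN2; apply: le_trans (ler_norm _) _.
  by rewrite normrN normrM normr_sg; case: (x == 0); rewrite /= ?mul0r ?mul1r.
have a1 : `|up - vp| - `|vp - vy| + Num.sg (up - vp) * (vy - vq) <= `|up - vq|.
  have h1 : Num.sg (up - vp) * (up - vq) <= `|up - vq|.
    apply: le_trans (ler_norm _) _.
    by rewrite normrM normr_sg; case: (up - vp == 0); rewrite /= ?mul0r ?mul1r.
  have := sg1 (up - vp) (vp - vy); have := normrEsg (up - vp).
  by move=> h2 h3; nra.
have a2 : - (Num.sg (up - vq) * (Ku - Kvq)) <= D + `|Kvp - Kvy| + `|Kvy - Kvq|.
  have h1 := sg1 (up - vq) (Ku - Kvq).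
  have h2 := ler_normD (Ku - Kvp) (Kvp - Kvy + (Kvy - Kvq)).
  have h3 := ler_normD (Kvp - Kvy) (Kvy - Kvq).
  have -> : Ku - Kvq = Ku - Kvp + (Kvp - Kvy + (Kvy - Kvq)) by ring.
  have := sg1 (up - vq) (Ku - Kvp + (Kvp - Kvy + (Kvy - Kvq))).
  by lra.
have b1 := ler_wnM2r eta'0 a1.
have b2 := ler_wpM2r eta0 a2.
by nra.
Qed.

(** The mass m <= 1 is bounded by 1 in the nonnegative error terms but has to stay on the main term
    [M0], whose sign is unknown. *)
Lemma doubling_arith {R : realType} (et et' A2 A3 I4 D4 D5 m g M0 : R) :
  0 <= et -> et' <= 0 -> 0 <= m -> m <= 1 -> 0 <= A2 -> 0 <= A3 ->
  `|I4| <= D4 -> `|g| <= 1 ->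
  M0 * m + (- et') * (A2 * m) + et * (A3 * m) + (et' * g) * I4 + et * D5 <=
  m * M0 + (- et' * A2 + et * A3) + (- et' * D4 + et * D5).
Proof.
move=> et0 et'0 m0 m1 a2 a3 d4 g1.
have h2 : (- et') * (A2 * m) <= (- et') * A2.
  by apply: ler_wpM2l; [lra|rewrite ler_piMr].
have h3 : et * (A3 * m) <= et * A3.
  by apply: ler_wpM2l; [lra|rewrite ler_piMr].
have h4 : (et' * g) * I4 <= - et' * D4.
  apply: le_trans (ler_norm _) _; rewrite -mulrA normrM ler0_norm//.
  apply: ler_wpM2l; first by lra.
  apply: le_trans d4; rewrite normrM -[leRHS]mul1r; exact: ler_wpM2r.
rewrite (mulrC m M0); lra.
Qed.

(** After [doubling_pointwise] the kernel splits into a factor in y of mass 1 and a factor in s of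
    mass [step ((T - t) / h)]. The term linear in v(y, s) is integrated in y before absolute values
    are taken, whence [mollif]. *)
Lemma doubling_inner {R : realType} (T h e : R) (u v : R -> R -> R)
  (et et' x t : R) :
  0 < h -> 0 < e -> e < 1 ->
  bm (fun p : R * R => u p.1 p.2) -> bm (fun p : R * R => v p.1 p.2) ->
  0 <= et -> et' <= 0 -> 0 <= x <= 1 -> 0 <= t <= T ->
  strip_int T (fun q =>
         `|u x t - v q.1 q.2| * et' * (kern h (q.2 - t) * pkern e (x - q.1))
         - Num.sg (u x t - v q.1 q.2) * (Kconv u (x, t) - Kconv v q) * et
           * (kern h (q.2 - t) * pkern e (x - q.1))) <=
  step ((T - t) / h) * (et' * `|u x t - v x t| + et * (Kp_Linf_norm *
     \int[@lebesgue_measure R]_(z in `[0, 1]) `|u z t - v z t|))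
  + (- et' * defect_x e (fun p => v p.1 p.2) (x, t) + et * defect_x e (Kconv v) (x, t))
  + (- et' * defect_t T h e v (x, t) + et * defect_xt T h e (Kconv v) (x, t)).
Proof.
move=> h0 e0 e1 bu bv et0 et'0 x01 /andP[t0 tT].
have T0 : 0 <= T by exact: le_trans tT.
have bKu := bm_Kconv u bu; have bKv := bm_Kconv v bv.
have ker0 r : 0 <= kern h r by case/andP: (kern_itv h r h0).
have per0 r : 0 <= pkern e r by case/andP: (pkern_itv e r e0).
set D := Kp_Linf_norm * _; have KD : `|Kconv u (x, t) - Kconv v (x, t)| <= D by exact: Kconv_diff.
set m := step _; have /andP[m0 m1] : 0 <= m <= 1 by exact: step_itv.
pose k s := kern h (s - t); pose r y := pkern e (x - y).
have bk : bm (fun s : R => k s) by apply: bm_shift'; exact: bm_kern.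
have br : bm (fun y : R => r y) by apply: bm_shift; exact: bm_pkern.
have k0 s : 0 <= k s by exact: ker0.
have r0 y : 0 <= r y by exact: per0.
have mk : \int[@lebesgue_measure R]_(s in `[0, T]) k s = m by exact: kern_mass.
have mr : \int[@lebesgue_measure R]_(y in `[0, 1]) r y = 1 by exact: pkern_mass_r.
have bvt : bm (fun y : R => v y t) by exact: (bm_t (fun p => v p.1 p.2)).
have bKt : bm (fun y : R => Kconv v (y, t)) by exact: bm_t.
have bk2 : bm (fun q : R * R => k q.2) by exact: (bm_comp _ _ bk).
have br1 : bm (fun q : R * R => r q.1) by exact: (bm_comp _ _ br).
have bvt1 : bm (fun q : R * R => v q.1 t) by exact: (bm_comp _ _ bvt).
have bKt1 : bm (fun q : R * R => Kconv v (q.1, t)) by exact: (bm_comp _ _ bKt).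
pose f2 y := r y * `|v x t - v y t|.
pose f3 y := r y * `|Kconv v (x, t) - Kconv v (y, t)|.
have bf2 : bm (fun y : R => f2 y).
  exact: bmM br (bm_norm _ (bmB _ _ (bm_cst _) bvt)).
have bf3 : bm (fun y : R => f3 y).
  exact: bmM br (bm_norm _ (bmB _ _ (bm_cst _) bKt)).
pose M0 := et' * `|u x t - v x t| + et * D.
pose g := Num.sg (u x t - v x t).
pose F4 (q : R * R) := k q.2 * (v q.1 t * r q.1 - v q.1 q.2 * r q.1).
pose F5 (q : R * R) := r q.1 * (k q.2 * `|Kconv v (q.1, t) - Kconv v (q.1, q.2)|).
have bKp : bm (fun q : R * R => Kconv v (q.1, q.2)) by exact: bm_pair.
have bF4 : bm F4 by rewrite /F4; bm_tac.
have bF5 : bm F5 by rewrite /F5; bm_tac.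
have bF1 : bm (fun q : R * R => r q.1 * k q.2) by bm_tac.
have bf21 : bm (fun q : R * R => f2 q.1) by exact: (bm_comp _ _ bf2).
have bf31 : bm (fun q : R * R => f3 q.1) by exact: (bm_comp _ _ bf3).
have bF2 : bm (fun q : R * R => f2 q.1 * k q.2) by bm_tac.
have bF3 : bm (fun q : R * R => f3 q.1 * k q.2) by bm_tac.
pose G (q : R * R) := M0 * (r q.1 * k q.2) + (- et') * (f2 q.1 * k q.2) + et * (f3 q.1 * k q.2)
  + (et' * g) * F4 q + et * F5 q.
have bG : bm G by rewrite /G; bm_tac.
apply: (@le_trans _ _ (strip_int T G)).
  apply: strip_int_le => //.
    have l1 : bm (fun q : R * R => kern h (q.2 - t)) by [].
    have l2 : bm (fun q : R * R => pkern e (x - q.1)) by [].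
    by bm_tac.
  move=> y s _ _ /=.
  have := doubling_pointwise (u x t) (v x t) (v y t) (v y s) _ _ (Kconv v (y, t)) (Kconv v (y, s))
    et et' D et0 et'0 KD.
  have kr : 0 <= k s * r y by rewrite mulr_ge0.
  move/(ler_wpM2r kr) => H; apply: le_trans (le_trans H _).
    by rewrite mulrBl !mulrA lexx.
  rewrite /G /F4 /F5 /f2 /f3 /M0 /g /= le_eqVlt; apply/orP; left; apply/eqP; ring.
have b1 : bm (fun q => M0 * (r q.1 * k q.2)) by exact: bmM (bm_cst _) bF1.
have b2 : bm (fun q => - et' * (f2 q.1 * k q.2)) by exact: bmM (bm_cst _) bF2.
have b3 : bm (fun q => et * (f3 q.1 * k q.2)) by exact: bmM (bm_cst _) bF3.
have b4 : bm (fun q => et' * g * F4 q) by exact: bmM (bm_cst _) bF4.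
have b5 : bm (fun q => et * F5 q) by exact: bmM (bm_cst _) bF5.
have -> : strip_int T G = M0 * strip_int T (fun q => r q.1 * k q.2) + (- et') * strip_int T (fun q => f2 q.1 * k q.2)
    + et * strip_int T (fun q => f3 q.1 * k q.2) + (et' * g) * strip_int T F4 + et * strip_int T F5.
  rewrite (strip_intD T _ _ (bmD _ _ (bmD _ _ (bmD _ _ b1 b2) b3) b4) b5).
  rewrite (strip_intD T _ _ (bmD _ _ (bmD _ _ b1 b2) b3) b4) (strip_intD T _ _ (bmD _ _ b1 b2) b3).
  rewrite (strip_intD T _ _ b1 b2) (strip_intZl T M0 _ bF1) (strip_intZl T (- et') _ bF2) (strip_intZl T et _ bF3).
  by rewrite (strip_intZl T (et' * g) _ bF4) (strip_intZl T et _ bF5).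
rewrite (strip_int_tensor T _ _ br bk) (strip_int_tensor T _ _ bf2 bk) (strip_int_tensor T _ _ bf3 bk) mk mr mul1r.
have d5 : strip_int T F5 = defect_xt T h e (Kconv v) (x, t).
  rewrite /strip_int /defect_xt /=; apply: eq_int1 => y _; rewrite /F5 /= int1Zl//.
  have l : bm (fun s : R => Kconv v (y, s)) by exact: bm_x.
  exact: bmM bk (bm_norm _ (bmB _ _ (bm_cst _) l)).
have d4 : `|strip_int T F4| <= defect_t T h e v (x, t).
  have bm_s s : bm (fun y : R => v y s * r y).
    by apply: bmM => //; exact: (bm_t (fun p => v p.1 p.2)).
  have E4 : strip_int T F4 = \int[@lebesgue_measure R]_(s in `[0, T]) (k s * (mollif e v x t - mollif e v x s)).
    rewrite strip_int_swapxt//; apply: eq_int1 => s _; rewrite /F4 /= int1Zl; last first.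
      by apply: bmB; exact: bm_s.
    by rewrite int1B.
  have bmG : bm (fun s : R => mollif e v x s).
    by apply: (bm_x (fun p => mollif e v p.1 p.2)); exact: bm_mollif.
  rewrite E4; apply: le_trans (norm_int1 _ _ _ _) _.
    by bm_tac.
  rewrite le_eqVlt; apply/orP; left; apply/eqP; apply: eq_int1 => s _ /=.
  by rewrite normrM ger0_norm.
have a2 : 0 <= defect_x e (fun p => v p.1 p.2) (x, t).
  by apply: Rintegral_ge0 => y _; rewrite mulr_ge0.
have a3 : 0 <= defect_x e (Kconv v) (x, t).
  by apply: Rintegral_ge0 => y _; rewrite mulr_ge0.
rewrite d5.
have -> : \int[@lebesgue_measure R]_(y in `[0, 1]) f2 y = defect_x e (fun p => v p.1 p.2) (x, t) by [].
have -> : \int[@lebesgue_measure R]_(y in `[0, 1]) f3 y = defect_x e (Kconv v) (x, t) by [].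
have g1 : `|g| <= 1 by rewrite /g normr_sg; case: (_ == 0); rewrite /= ?ler01 ?lexx.
exact: doubling_arith.
Qed.

Lemma continuous_mollif {R : realType} (T e : R) (v0 : R -> R) (v : R -> R -> R) (x : R) :
  0 < e -> e < 1 -> bounded_solution T v0 v -> {within `[0, T], continuous (mollif e v x)}.
Proof.
move=> e0 e1 [_ _ cv _]; apply: cv.
by apply: bm_shift; exact: bm_pkern.
Qed.

(** A translate of [Kp] is bounded, hence admissible in the weak-* continuity: the convolution turns
    weak continuity of v into continuity at each point y. *)
Lemma continuous_Kconv {R : realType} (T : R) (v0 : R -> R) (v : R -> R -> R) (y : R) :
  bounded_solution T v0 v -> {within `[0, T], continuous (fun t => Kconv v (y, t))}.
Proof.
move=> [_ _ cv _].
have -> : (fun t => Kconv v (y, t)) =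
    (fun t => \int[@lebesgue_measure R]_(x in `[0, 1]) (v x t * Kp (y - x))).
  by apply/funext => t; apply: eq_int1 => x _; rewrite mulrC.
by apply: cv; apply: bm_shift; exact: bm_Kp.
Qed.

Lemma time_osc_bound {R : realType} (T h t c M : R) (G : R -> R) :
  0 < h -> 0 <= t -> 0 <= T -> bm G -> (forall s, `|G s| <= M) -> `|c| <= M ->
  0 <= \int[@lebesgue_measure R]_(s in `[0, T]) (kern h (s - t) * `|c - G s|) <= M + M.
Proof.
move=> h0 t0 T0 bG GM cM.
have ker0 r : 0 <= kern h r by case/andP: (kern_itv h r h0).
have bk : bm (fun s : R => kern h (s - t)) by apply: bm_shift'; exact: bm_kern.
apply/andP; split; first by apply: Rintegral_ge0 => s _; rewrite mulr_ge0.
apply: (@le_trans _ _ (\int[@lebesgue_measure R]_(s in `[0, T]) ((M + M) * kern h (s - t)))).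
  apply: le_int1.
  - by apply: bmM => //; apply: bm_norm; apply: bmB => //; exact: bm_cst.
  - by apply: bmM => //; exact: bm_cst.
  move=> s _; rewrite mulrC; apply: ler_wpM2r => //.
  by apply: le_trans (ler_normB _ _) _; exact: lerD.
rewrite int1Zl// kern_mass//; have /andP[_ m1] := step_itv ((T - t) / h).
have M0 : 0 <= M by apply: le_trans cM.
by rewrite ler_piMr// addr_ge0.
Qed.

Lemma defect_t_cvg0 {R : realType} (T e : R) (v0 : R -> R) (v : R -> R -> R) (th : R -> R) :
  0 <= T -> 0 < e -> e < 1 -> bounded_solution T v0 v -> bm th ->
  strip_int T (fun p => th p.2 * defect_t T (mesh n) e v p) @[n --> \oo] --> 0.
Proof.
move=> T0 e0 e1 Sv bth; have [bv _ _ _] := Sv.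
have bG := bm_mollif e v e0 e1 bv.
have [_ [M GM]] := bG; have [_ [N thN]] := bth.
have N0 : 0 <= N by apply: le_trans (thN 0).
have bGx x : bm (mollif e v x) by exact: (bm_x (fun p => mollif e v p.1 p.2)).
apply: (strip_int_cvg0 T (N * (M + M))) => //.
- move=> n; apply: bmM; first exact: (bm_comp _ _ bth).
  by apply: bm_defect_t => //; exact: mesh_gt0.
- move=> n x t _ /andP[t0 _] /=.
  have := time_osc_bound T (mesh n) t (mollif e v x t) M (mollif e v x) (mesh_gt0 n) t0 T0
    (bGx x) (fun s => GM (x, s)) (GM (x, t)).
  move=> /andP[d0 d1]; rewrite normrM; apply: ler_pM => //.
  by rewrite ger0_norm.
- move=> x t _ tT /=; rewrite -[X in _ --> X](mulr0 (th t)); apply: cvgMr.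
  exact: mollify_time tT (bGx x) (continuous_mollif T e v0 v x e0 e1 Sv).
Qed.

Lemma defect_xt_cvg0 {R : realType} (T e : R) (v0 : R -> R) (v : R -> R -> R) (th : R -> R) :
  0 <= T -> 0 < e -> e < 1 -> bounded_solution T v0 v -> bm th ->
  strip_int T (fun p => th p.2 * defect_xt T (mesh n) e (Kconv v) p) @[n --> \oo] --> 0.
Proof.
move=> T0 e0 e1 Sv bth; have [bv _ _ _] := Sv.
have bK := bm_Kconv v bv.
have [_ [M KM]] := bK; have [_ [N thN]] := bth.
have M0 : 0 <= M by apply: le_trans (KM (0, 0)).
have N0 : 0 <= N by apply: le_trans (thN 0).
have bper := bm_pkern e e0 e1.
have [_ [P perP]] := bper.
have P0 : 0 <= P by apply: le_trans (perP 0).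
have per0 r : 0 <= pkern e r by case/andP: (pkern_itv e r e0).
have bKy y : bm (fun s : R => Kconv v (y, s)) by exact: bm_x.
pose osc n y t := \int[@lebesgue_measure R]_(s in `[0, T])
   (kern (mesh n) (s - t) * `|Kconv v (y, t) - Kconv v (y, s)|).
have oscM n y t : 0 <= t -> 0 <= osc n y t <= M + M.
  move=> t0; exact: time_osc_bound (mesh_gt0 n) t0 T0 (bKy y) (fun s => KM (y, s)) (KM (y, t)).
have bosc n t : bm (fun y : R => osc n y t).
  have := bm_t _ t (bm_time_osc T (mesh n) (Kconv v) (mesh_gt0 n) bK); exact.
have bin n x t : bm (fun y : R => pkern e (x - y) * osc n y t).
  by apply: bmM => //; exact: bm_shift.
have inM n x t y : 0 <= t -> `|pkern e (x - y) * osc n y t| <= P * (M + M).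
  move=> t0; have /andP[q0 q1] := oscM n y t t0.
  by rewrite normrM; apply: ler_pM => //; rewrite ger0_norm.
apply: (strip_int_cvg0 T (N * (P * (M + M)))) => //.
- move=> n; apply: bmM; first exact: (bm_comp _ _ bth).
  by apply: bm_defect_xt => //; exact: mesh_gt0.
- move=> n x t _ /andP[t0 _] /=; rewrite normrM; apply: ler_pM => //.
  apply: le_trans (norm_int1 _ _ _ (bin n x t)) _.
  have -> : P * (M + M) = \int[@lebesgue_measure R]_(y in `[0, 1]) (P * (M + M)).
    by rewrite Rintegral_itv_cst// subr0 mulr1.
  apply: le_int1; [exact: bm_norm|exact: bm_cst|].
  by move=> y _; exact: inM.
- move=> x t _ tT /=; rewrite -[X in _ --> X](mulr0 (th t)); apply: cvgMr.
  have /andP[t0 _] := tT.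
  apply: (int1_cvg0_neq 0 1 0 (fun n y => pkern e (x - y) * osc n y t) (P * (M + M))).
  + by move=> n; exact: bin.
  + by move=> n y _; exact: inM.
  + move=> y _ _; rewrite -[X in _ --> X](mulr0 (pkern e (x - y))); apply: cvgMr.
    exact: mollify_time tT (bKy y) (continuous_Kconv T v0 v y Sv).
Qed.

(** The limit h -> 0 at fixed e. The condition on [t2, T] deals with the missing mass: there the
    coefficient of |u - v| vanishes, and before t2 the mass is full as soon as h <= T - t2. *)
Lemma kato_eps {R : realType} (T e t2 : R) (u0 v0 : R -> R) (u v : R -> R -> R)
  (eta eta' : R -> R) :
  0 < T -> 0 < e -> e < 1 -> bounded_solution T u0 u -> bounded_solution T v0 v ->
  C1 eta eta' -> bm eta -> bm eta' -> (forall t, 0 <= eta t) ->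
  (forall t, 0 <= t <= T -> eta' t <= 0) ->
  t2 < T -> (forall t, t2 <= t <= T -> eta' t + Kp_Linf_norm * eta t = 0) ->
  strip_int T (fun p => - (eta' p.2 + Kp_Linf_norm * eta p.2) * `|u p.1 p.2 - v p.1 p.2|) <=
  strip_int T (fun p => - eta' p.2 * defect_x e (fun p => v p.1 p.2) p
                 + eta p.2 * defect_x e (Kconv v) p)
  + eta 0 * \int[@lebesgue_measure R]_(x in `[0, 1]) \int[@lebesgue_measure R]_(y in `[0, 1])
         (pkern e (x - y) * `|u0 x - v0 y|).
Proof.
move=> T0 e0 e1 Su Sv Ceta beta beta' eta0 eta'0 t2T tail.
have T0' := ltW T0.
have [bu bu0 _ _] := Su; have [bv bv0 _ _] := Sv.
have bKv := bm_Kconv v bv.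
have [C HC] := initial_layer T e u0 v0 v T0' e0 e1 bu0 Sv.
set k := Kp_Linf_norm in tail *.
pose A (t : R) := \int[@lebesgue_measure R]_(z in `[0, 1]) `|u z t - v z t|.
pose Z n := strip_int T (fun p => - eta' p.2 * defect_t T (mesh n) e v p)
  + strip_int T (fun p => eta p.2 * defect_xt T (mesh n) e (Kconv v) p)
  + eta 0 * (C * \int[@lebesgue_measure R]_(s in `[0, T]) (1 - step (s / mesh n))).
have bneta' : bm (fun t : R => - eta' t) by exact: bmN.
have Z0 : Z n @[n --> \oo] --> 0.
  rewrite -[X in _ --> X]addr0; apply: cvgD.
    rewrite -[X in _ --> X]addr0; apply: cvgD.
      exact: (defect_t_cvg0 T e v0 v (fun t => - eta' t)).
    exact: (defect_xt_cvg0 T e v0 v eta).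
  rewrite -[X in _ --> X](mulr0 (eta 0)); apply: cvgMr.
  rewrite -[X in _ --> X](mulr0 C); apply: cvgMr; exact: layer_cvg0.
apply: le_cvg0 Z0; near=> n.
have hT : mesh n <= T - t2 by apply: ltW; near: n; apply: near_mesh; rewrite subr_gt0.
have h0 := @mesh_gt0 R n; set h := mesh n in h0 hT *.
have ker0 r : 0 <= kern h r by case/andP: (kern_itv h r h0).
have per0 r : 0 <= pkern e r by case/andP: (pkern_itv e r e0).
pose m (t : R) := step ((T - t) / h).
have mE t : t <= t2 -> m t = 1.
  move=> tt; apply: step_ge1; rewrite (ler_pdivlMr _ _ h0) mul1r.
  by apply: le_trans hT _; rewrite lerD2l lerN2.
have bmm : bm (fun t : R => m t).
  apply: (bm_comp _ _ bm_step); apply: measurable_funM => //.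
  exact: measurable_funB.
have bW : bm (fun p : R * R => `|u p.1 p.2 - v p.1 p.2|) by bm_tac.
have bA : bm (fun t : R => A t).
  apply: (bm_int1 0 1 (fun t z => `|u z t - v z t|)).
  by apply: (bm_comp _ (fun p : R * R => (p.2, p.1)) bW); exact: measurable_fun_pair.
have bm2 : bm (fun p : R * R => m p.2) by exact: (bm_comp _ _ bmm).
have bA2 : bm (fun p : R * R => A p.2) by exact: (bm_comp _ _ bA).
have be2 : bm (fun p : R * R => eta p.2) by exact: (bm_comp _ _ beta).
have be'2 : bm (fun p : R * R => eta' p.2) by exact: (bm_comp _ _ beta').
have bne'2 : bm (fun p : R * R => - eta' p.2) by exact: bmN.
have bd1 := bm_defect_x e (fun p => v p.1 p.2) e0 e1 bv.
have bd2 := bm_defect_x e (Kconv v) e0 e1 bKv.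
have bd3 := bm_defect_t T h e v h0 e0 e1 bv.
have bd4 := bm_defect_xt T h e (Kconv v) h0 e0 e1 bKv.
pose X1 (p : R * R) := m p.2 * (eta' p.2 * `|u p.1 p.2 - v p.1 p.2|).
pose X1' (p : R * R) := m p.2 * (eta p.2 * (k * A p.2)).
pose X2 (p : R * R) := - eta' p.2 * defect_x e (fun p => v p.1 p.2) p
                 + eta p.2 * defect_x e (Kconv v) p.
pose X3 (p : R * R) := - eta' p.2 * defect_t T h e v p.
pose X4 (p : R * R) := eta p.2 * defect_xt T h e (Kconv v) p.
have bX1 : bm X1 by exact: bmM bm2 (bmM _ _ be'2 bW).
have bX1' : bm X1' by exact: bmM bm2 (bmM _ _ be2 (bmM _ _ (bm_cst k) bA2)).
have bX2 : bm X2 by exact: bmD (bmM _ _ bne'2 bd1) (bmM _ _ be2 bd2).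
have bX3 : bm X3 by exact: bmM bne'2 bd3.
have bX4 : bm X4 by exact: bmM be2 bd4.
have bX11 := bmD _ _ bX1 bX1'.
have bX34 := bmD _ _ bX3 bX4.
have bX := bmD _ _ (bmD _ _ bX11 bX2) bX34.
have main := kruzhkov_doubling T h e u0 v0 u v eta eta' T0' h0 e0 e1 Su Sv Ceta beta beta' eta0.
pose Inn (p q : R * R) : R :=
         `|u p.1 p.2 - v q.1 q.2| * eta' p.2 * (kern h (q.2 - p.2) * pkern e (p.1 - q.1))
         - Num.sg (u p.1 p.2 - v q.1 q.2) * (Kconv u p - Kconv v q) * eta p.2
           * (kern h (q.2 - p.2) * pkern e (p.1 - q.1)).
have bInn : bm (fun p => strip_int T (Inn p)).
  apply: bm_strip_int; rewrite /Inn.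
  have m11 := @measurable_fst_fst _ _ _ R R (R * R)%type.
  have m12 := @measurable_fst_snd _ _ _ R R (R * R)%type.
  have m21 := @measurable_snd_fst _ _ _ (R * R)%type R R.
  have m22 := @measurable_snd_snd _ _ _ (R * R)%type R R.
  have bKu := bm_Kconv u bu.
  have l1 : bm (fun pq : (R * R) * (R * R) => v pq.2.1 pq.2.2) by exact: (bm_comp _ _ bv).
  have l2 : bm (fun pq : (R * R) * (R * R) => u pq.1.1 pq.1.2) by exact: (bm_comp _ _ bu).
  have l3 : bm (fun pq : (R * R) * (R * R) => Kconv v pq.2) by exact: (bm_comp _ _ bKv).
  have l3' : bm (fun pq : (R * R) * (R * R) => Kconv u pq.1) by exact: (bm_comp _ _ bKu).
  have l4 : bm (fun pq : (R * R) * (R * R) => pkern e (pq.1.1 - pq.2.1)).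
    by apply: (bm_comp _ _ (bm_pkern e e0 e1)); exact: measurable_funB.
  have l6 : bm (fun pq : (R * R) * (R * R) => kern h (pq.2.2 - pq.1.2)).
    by apply: (bm_comp _ _ (bm_kern h h0)); exact: measurable_funB.
  have l8 : bm (fun pq : (R * R) * (R * R) => eta pq.1.2) by exact: (bm_comp _ _ beta).
  have l9 : bm (fun pq : (R * R) * (R * R) => eta' pq.1.2) by exact: (bm_comp _ _ beta').
  by bm_tac.
have step1 : strip_int T (fun p => strip_int T (Inn p)) <= strip_int T (fun p => X1 p + X1' p + X2 p + (X3 p + X4 p)).
  apply: strip_int_le => // x t x01 tT.
  apply: le_trans (doubling_inner T h e u v (eta t) (eta' t) x t h0 e0 e1 bu bv (eta0 t)
    (eta'0 t tT) x01 tT) _.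
  by rewrite mulrDr.
have E1 : strip_int T (fun p => X1 p + X1' p + X2 p + (X3 p + X4 p)) =
    strip_int T X1 + strip_int T X1' + strip_int T X2 + (strip_int T X3 + strip_int T X4).
  by rewrite (strip_intD T _ _ (bmD _ _ bX11 bX2) bX34) (strip_intD T _ _ bX11 bX2) (strip_intD T _ _ bX1 bX1')
    (strip_intD T _ _ bX3 bX4).
pose X5 (p : R * R) := m p.2 * (eta p.2 * (k * `|u p.1 p.2 - v p.1 p.2|)).
have bX5 : bm X5 by exact: bmM bm2 (bmM _ _ be2 (bmM _ _ (bm_cst k) bW)).
(* [A] does not depend on x, and x runs over an interval of length 1, so A(t) may be replaced by |u
   - v| under the integral. Only then do the main terms combine into (eta' + k eta) |u - v|. *)
have E2 : strip_int T X1' = strip_int T X5.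
  rewrite (strip_int_swapxt T _ bX1') (strip_int_swapxt T _ bX5); apply: eq_int1 => t _.
  rewrite /X1' /X5 /= Rintegral_itv_cst// subr0 mulr1.
  have bWt : bm (fun x : R => `|u x t - v x t|) by exact: (bm_t _ t bW).
  under [RHS]eq_Rintegral do rewrite !mulrA.
  by rewrite int1Zl// !mulrA.
have E3 : strip_int T X1 + strip_int T X5 =
   - strip_int T (fun p => - (eta' p.2 + k * eta p.2) * `|u p.1 p.2 - v p.1 p.2|).
  rewrite -(strip_intD T _ _ bX1 bX5) -strip_intN; last first.
    exact: bmM (bmN _ (bmD _ _ be'2 (bmM _ _ (bm_cst k) be2))) bW.
  apply: eq_strip_int => x t _ /andP[t0 tT]; rewrite /X1 /X5 /=.
  (* On the tail both sides are 0 whatever [m] is; before it, [m] is 1. *)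
  have [tt|tt] := leP t2 t.
    have t2tT : t2 <= t <= T by rewrite tt tT.
    have E : eta' t = - (k * eta t) by apply/eqP; rewrite -addr_eq0 (tail t t2tT).
    by rewrite E; ring.
  by rewrite (mE t (ltW tt)); ring.
have init : \int[@lebesgue_measure R]_(x in `[0, 1]) strip_int T (fun q =>
         `|u0 x - v q.1 q.2| * (pkern e (x - q.1) * (eta 0 * kern h q.2))) <=
   eta 0 * \int[@lebesgue_measure R]_(x in `[0, 1]) \int[@lebesgue_measure R]_(y in `[0, 1])
         (pkern e (x - y) * `|u0 x - v0 y|)
  + eta 0 * (C * \int[@lebesgue_measure R]_(s in `[0, T]) (1 - step (s / h))).
  have bL : bm (fun xq : R * (R * R) => `|u0 xq.1 - v xq.2.1 xq.2.2| * (pkern e (xq.1 - xq.2.1) * kern h xq.2.2)).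
    have n21 := @measurable_snd_fst _ _ _ R R R.
    have n22 := @measurable_snd_snd _ _ _ R R R.
    have l1 : bm (fun xq : R * (R * R) => u0 xq.1) by exact: (bm_comp _ _ bu0).
    have l2 : bm (fun xq : R * (R * R) => v xq.2.1 xq.2.2) by exact: (bm_comp _ _ bv).
    have l3 : bm (fun xq : R * (R * R) => pkern e (xq.1 - xq.2.1)).
      by apply: (bm_comp _ _ (bm_pkern e e0 e1)); exact: measurable_funB.
    have l6 : bm (fun xq : R * (R * R) => kern h xq.2.2) by exact: (bm_comp _ _ (bm_kern h h0)).
    by bm_tac.
  have bLx x : bm (fun q : R * R => `|u0 x - v q.1 q.2| * (pkern e (x - q.1) * kern h q.2)).
    by apply: (bm_comp _ (fun q => (x, q)) bL); exact: measurable_pair1.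
  have bLi : bm (fun x : R => strip_int T (fun q => `|u0 x - v q.1 q.2| * (pkern e (x - q.1) * kern h q.2))).
    exact: (bm_strip_int T (fun (x : R) q => `|u0 x - v q.1 q.2| * (pkern e (x - q.1) * kern h q.2))).
  have -> : \int[@lebesgue_measure R]_(x in `[0, 1]) strip_int T (fun q =>
         `|u0 x - v q.1 q.2| * (pkern e (x - q.1) * (eta 0 * kern h q.2))) =
     eta 0 * \int[@lebesgue_measure R]_(x in `[0, 1]) strip_int T (fun q =>
         `|u0 x - v q.1 q.2| * (pkern e (x - q.1) * kern h q.2)).
    rewrite -(int1Zl _ _ _ _ bLi); apply: eq_int1 => x _; rewrite -(strip_intZl T (eta 0) _ (bLx x)).
    by apply: eq_strip_int => y s _ _ /=; ring.
  rewrite -mulrDr; apply: ler_wpM2l => //; exact: HC.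
have main' : 0 <= strip_int T (fun p => strip_int T (Inn p)) + \int[@lebesgue_measure R]_(x in `[0, 1]) strip_int T (fun q =>
         `|u0 x - v q.1 q.2| * (pkern e (x - q.1) * (eta 0 * kern h q.2))) by exact: main.
have {}step1 : strip_int T (fun p => strip_int T (Inn p)) <=
    (strip_int T X1 + strip_int T X5) + strip_int T X2 + (strip_int T X3 + strip_int T X4).
  by rewrite -E2 -E1.
rewrite E3 in step1.
rewrite /Z -/h; move: step1 main' init.
rewrite -/X2 -/X3 -/X4.
move: (strip_int T (fun p => strip_int T (Inn p))) (strip_int T (fun p => - _ * _)) (strip_int T X2) (strip_int T X3) (strip_int T X4)
  (\int[_]_(x in _) strip_int T _) (eta 0 * \int[_]_(x in _) _) (eta 0 * (C * _)).
clear => i1 i2 i3 i4 i5 i6 i7 i8.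
lra.
Unshelve. all: by end_near. Qed.

(** * Removing the space mollifier *)

(** [mollify_space] applies to the section f(., t) at each fixed t, and the bound M + M permits
    dominated convergence in t. *)
Lemma defect_x_cvg0 {R : realType} (T : R) (f : R * R -> R) (th : R -> R) :
  0 <= T -> bm f -> bm th ->
  strip_int T (fun p => th p.2 * defect_x (mesh n) f p) @[n --> \oo] --> 0.
Proof.
move=> T0 bf bth; have [_ [M fM]] := bf; have [_ [N thN]] := bth.
have N0 : 0 <= N by apply: le_trans (thN 0).
have M0 : 0 <= M by apply: le_trans (fM (0, 0)).
have bd n : bm (defect_x (mesh n) f) by apply: bm_defect_x => //; [exact: mesh_gt0|exact: mesh_lt1].
have dM n x t : 0 <= x <= 1 -> 0 <= defect_x (mesh n) f (x, t) <= M + M.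
  move=> x01.
  have per0 (r : R) : 0 <= pkern (mesh n) r by case/andP: (pkern_itv (mesh n) r (mesh_gt0 n)).
  have bp : bm (fun y : R => pkern (mesh n) (x - y)).
    by apply: bm_shift; apply: bm_pkern; [exact: mesh_gt0|exact: mesh_lt1].
  have bft : bm (fun y : R => f (y, t)) by exact: bm_t.
  apply/andP; split.
    by apply: Rintegral_ge0 => y _; apply: mulr_ge0; [exact: per0|exact: normr_ge0].
  have -> : M + M = \int[@lebesgue_measure R]_(y in `[0, 1]) ((M + M) * pkern (mesh n) (x - y)).
    by rewrite (int1Zl _ _ _ _ bp) (pkern_mass_r (mesh n) x (mesh_gt0 n) (mesh_lt1 n) x01) mulr1.
  apply: le_int1.
  - exact: bmM bp (bm_norm _ (bmB _ _ (bm_cst _) bft)).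
  - exact: bmM (bm_cst _) bp.
  - move=> y _; rewrite /= [leLHS]mulrC; apply: ler_wpM2r; first exact: per0.
    by apply: le_trans (ler_normB _ _) _; apply: lerD; exact: fM.
have bthd n : bm (fun p : R * R => th p.2 * defect_x (mesh n) f p).
  by apply: bmM => //; exact: (bm_comp _ _ bth).
have -> : (fun n => strip_int T (fun p => th p.2 * defect_x (mesh n) f p)) =
    (fun n => \int[@lebesgue_measure R]_(t in `[0, T]) (th t *
      \int[@lebesgue_measure R]_(x in `[0, 1]) defect_x (mesh n) f (x, t))).
  apply/funext => n; rewrite (strip_int_swapxt T _ (bthd n)); apply: eq_int1 => t _ /=.
  by rewrite int1Zl//; exact: bm_t.
have bIn n : bm (fun t : R => \int[@lebesgue_measure R]_(x in `[0, 1]) defect_x (mesh n) f (x, t)).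
  apply: (bm_int1 0 1 (fun t x => defect_x (mesh n) f (x, t))).
  by apply: (bm_comp _ (fun p : R * R => (p.2, p.1)) (bd n)); exact: measurable_fun_pair.
apply: (int1_cvg0_neq 0 T 0 (fun n t => th t *
   \int[@lebesgue_measure R]_(x in `[0, 1]) defect_x (mesh n) f (x, t)) (N * (M + M))).
- by move=> n; exact: bmM.
- move=> n t _; rewrite normrM; apply: ler_pM => //.
  apply: le_trans (norm_int1 _ _ _ (bm_t _ t (bd n))) _.
  have -> : M + M = \int[@lebesgue_measure R]_(x in `[0, 1]) (M + M).
    by rewrite Rintegral_itv_cst// subr0 mulr1.
  apply: le_int1; [exact: bm_norm _ (bm_t _ t (bd n))|exact: bm_cst|].
  by move=> x x01; have /andP[d0 d1] := dM n x t x01; rewrite ger0_norm.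
- move=> t _ _; rewrite -[X in _ --> X](mulr0 (th t)); apply: cvgMr.
  exact: (mollify_space (fun x => f (x, t)) (bm_t _ t bf)).
Qed.

(** The weak form of A' <= k A, tested with eta, where A(t) is the L1 distance at time t. The
    initial term is treated by comparing u0(x) - v0(y) with u0(x) - v0(x); the difference is the
    oscillation of v0 and vanishes by [mollify_space]. *)
Lemma kato {R : realType} (T t2 : R) (u0 v0 : R -> R) (u v : R -> R -> R)
  (eta eta' : R -> R) :
  0 < T -> bounded_solution T u0 u -> bounded_solution T v0 v ->
  C1 eta eta' -> bm eta -> bm eta' -> (forall t, 0 <= eta t) ->
  (forall t, 0 <= t <= T -> eta' t <= 0) ->
  t2 < T -> (forall t, t2 <= t <= T -> eta' t + Kp_Linf_norm * eta t = 0) ->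
  strip_int T (fun p => - (eta' p.2 + Kp_Linf_norm * eta p.2) * `|u p.1 p.2 - v p.1 p.2|) <=
  eta 0 * \int[@lebesgue_measure R]_(x in `[0, 1]) `|u0 x - v0 x|.
Proof.
move=> T0 Su Sv Ceta beta beta' eta0 eta'0 t2T tail.
have [bu bu0 _ _] := Su; have [bv bv0 _ _] := Sv.
have bKv := bm_Kconv v bv.
pose S n := \int[@lebesgue_measure R]_(x in `[0, 1]) \int[@lebesgue_measure R]_(y in `[0, 1])
         (pkern (mesh n) (x - y) * `|v0 x - v0 y|).
pose Z n := strip_int T (fun p => - eta' p.2 * defect_x (mesh n) (fun p => v p.1 p.2) p)
  + strip_int T (fun p => eta p.2 * defect_x (mesh n) (Kconv v) p) + eta 0 * S n.
have Z0 : Z n @[n --> \oo] --> 0.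
  rewrite -[X in _ --> X]addr0; apply: cvgD.
    rewrite -[X in _ --> X]addr0; apply: cvgD.
      by apply: (defect_x_cvg0 T _ (fun t => - eta' t)) => //; [exact: ltW|exact: bmN].
    by apply: (defect_x_cvg0 T _ eta) => //; exact: ltW.
  rewrite -[X in _ --> X](mulr0 (eta 0)); apply: cvgMr; exact: mollify_space.
apply: le_cvg0 Z0; near=> n.
have h0 := @mesh_gt0 R n; have h1 := @mesh_lt1 R n.
have per0 (r : R) : 0 <= pkern (mesh n) r by case/andP: (pkern_itv (mesh n) r h0).
have be2 : bm (fun p : R * R => eta p.2) by exact: (bm_comp _ _ beta).
have be'2 : bm (fun p : R * R => eta' p.2) by exact: (bm_comp _ _ beta').
have bne'2 : bm (fun p : R * R => - eta' p.2) by exact: bmN.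
have bd1 := bm_defect_x (mesh n) (fun p => v p.1 p.2) h0 h1 bv.
have bd2 := bm_defect_x (mesh n) (Kconv v) h0 h1 bKv.
apply: le_trans (kato_eps T (mesh n) t2 u0 v0 u v eta eta' T0 h0 h1 Su Sv Ceta beta beta' eta0
  eta'0 t2T tail) _.
rewrite (strip_intD T _ _ (bmM _ _ bne'2 bd1) (bmM _ _ be2 bd2)).
rewrite /Z addrCA lerD2l -mulrDr; apply: ler_wpM2l => //.
have bp : bm (fun p : R * R => pkern (mesh n) (p.1 - p.2)) by exact: bm_pkern2.
have b1 : bm (fun p : R * R => u0 p.1) by exact: (bm_comp _ _ bu0).
have b2 : bm (fun p : R * R => v0 p.1) by exact: (bm_comp _ _ bv0).
have b3 : bm (fun p : R * R => v0 p.2) by exact: (bm_comp _ _ bv0).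
have bo : bm (fun x : R => \int[@lebesgue_measure R]_(y in `[0, 1]) (pkern (mesh n) (x - y) * `|v0 x - v0 y|)).
  by apply: (bm_int1 0 1 (fun x y : R => pkern (mesh n) (x - y) * `|v0 x - v0 y|)); bm_tac.
have bi : bm (fun x : R => \int[@lebesgue_measure R]_(y in `[0, 1]) (pkern (mesh n) (x - y) * `|u0 x - v0 y|)).
  by apply: (bm_int1 0 1 (fun x y : R => pkern (mesh n) (x - y) * `|u0 x - v0 y|)); bm_tac.
have bw : bm (fun x : R => `|u0 x - v0 x|) by bm_tac.
rewrite -(int1D _ _ _ _ bw bo); apply: le_int1 => //; first exact: bmD.
move=> x x01.
have bpx : bm (fun y : R => pkern (mesh n) (x - y)) by apply: bm_shift; exact: bm_pkern.
have -> : `|u0 x - v0 x| = \int[@lebesgue_measure R]_(y in `[0, 1]) (`|u0 x - v0 x| * pkern (mesh n) (x - y)).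
  by rewrite int1Zl// pkern_mass_r// mulr1.
rewrite -int1D; [|by bm_tac|by bm_tac].
apply: le_int1; [by bm_tac|by bm_tac|].
move=> y _; rewrite (mulrC (`|_|)) -mulrDr; apply: ler_wpM2l => //.
have -> : u0 x - v0 y = (u0 x - v0 x) + (v0 x - v0 y) by ring.
exact: ler_normD.
Unshelve. all: by end_near. Qed.

(** * The exponential weight and the bound at a fixed time *)

Lemma bm_step_exp {R : realType} (k : R) (f : R -> R) : 0 <= k -> bm f ->
  (forall r, r <= 0 -> f r = 0) -> bm (fun t : R => f (t + 2) * expR (- k * t)).
Proof.
move=> k0 [mf [M fM]] f0; split.
  apply: measurable_funM.
    by apply: measurableT_comp => //; exact: measurable_funD.
  by apply: measurableT_comp => //; exact: measurable_funM.
(* Where the first factor can be nonzero, t > -2 and so exp(- k t) <= exp(2 k). *)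
exists (M * expR (2 * k)) => t; rewrite normrM.
have [t2|t2] := leP (t + 2) 0.
  rewrite f0// normr0 mul0r mulr_ge0 ?expR_ge0//.
  exact: le_trans (fM 0).
apply: ler_pM => //; rewrite ger0_norm ?expR_ge0// ler_expR; nra.
Qed.

(** For eta = exp(- k t) (1 - step((t - a) / d)) the combination - (eta' + k eta) is exp(- k t)
    [kern d (t - a)]: a nonnegative weight confined to (a, a + d), so the tail condition of [kato]
    holds from a + d on. As a >= 0, eta starts from 1. *)
Lemma kato_bump {R : realType} (T a d : R) (u0 v0 : R -> R) (u v : R -> R -> R) :
  0 <= a -> 0 < d -> a + d < T -> bounded_solution T u0 u -> bounded_solution T v0 v ->
  \int[@lebesgue_measure R]_(t in `[0, T]) (expR (- Kp_Linf_norm * t) * kern d (t - a) *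
     \int[@lebesgue_measure R]_(x in `[0, 1]) `|u x t - v x t|) <=
  \int[@lebesgue_measure R]_(x in `[0, 1]) `|u0 x - v0 x|.
Proof.
move=> a0 d0 adT Su Sv; have [bu _ _ _] := Su; have [bv _ _ _] := Sv.
have T0 : 0 < T by lra.
set k := Kp_Linf_norm; have k0 : 0 <= k by exact: Kp_Linf_norm_ge0.
pose E t := expR (- k * t).
have CE : C1 E (fun t => E t * (- k)).
  apply: C1_ext (C1_comp _ _ _ _ (@C1_expR R) (C1_affine (- k) 0)) => t; by rewrite addr0.
have Cs2 : C1 (fun t : R => step (t + 2)) (fun t => bump (t + 2)).
  by apply: C1_ext (C1_comp _ _ _ _ C1_step (C1_affine 1 2)) => s; rewrite mul1r ?mulr1.
have Cc : C1 (fun t : R => 1 - step ((t - a) / d)) (fun t => - kern d (t - a)).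
  have C1' := C1_comp _ _ _ _ (C1_step_scale d) (C1_affine 1 (- a)).
  apply: C1_ext (C1D _ _ _ _ (C1_cst 1) (C1Zl (-1) _ _ C1')) => s.
    by rewrite mulN1r mul1r.
  by rewrite mulN1r mul1r mulr1 add0r.
have Ceta := C1M _ _ _ _ (C1M _ _ _ _ Cs2 CE) Cc.
(* the factor step (t + 2) is 1 for t >= 0 and keeps eta bounded as t -> -oo *)
set eta := (fun t => step (t + 2) * E t * (1 - step ((t - a) / d))) in Ceta.
set eta' := (X in C1 eta X) in Ceta.
have bsE : bm (fun t : R => step (t + 2) * E t).
  by apply: bm_step_exp => //; [exact: bm_step|exact: step_le0].
have bbE : bm (fun t : R => bump (t + 2) * E t).
  by apply: bm_step_exp => //; [exact: bm_bump|exact: bump_le0].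
have bsd : bm (fun t : R => step ((t - a) / d)).
  apply: (bm_comp _ _ bm_step); apply: measurable_funM => //; exact: measurable_funB.
have bkd : bm (fun t : R => kern d (t - a)) by apply: bm_shift'; exact: bm_kern.
have beta : bm eta by exact: bmM bsE (bmB _ _ (bm_cst 1) bsd).
have beta' : bm eta'.
  rewrite /eta'; apply: bmD; last exact: bmM bsE (bmN _ bkd).
  apply: bmM; last exact: bmB _ _ (bm_cst 1) bsd.
  apply: bmD => //.
  by under eq_fun do rewrite mulrA; exact: bmM bsE (bm_cst (- k)).
have eta0 t : 0 <= eta t.
  have /andP[s0 _] := step_itv (t + 2); have /andP[_ s1] := step_itv ((t - a) / d).
  by rewrite /eta mulr_ge0 ?subr_ge0// mulr_ge0// expR_ge0.
have etaE t : 0 <= t -> eta' t = - k * eta t - E t * kern d (t - a).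
  by move=> t0; rewrite /eta' /eta bump_ge1 ?(step_ge1 (t + 2))//; [ring|lra|lra].
have ker0 r : 0 <= kern d r by case/andP: (kern_itv d r d0).
have eta'0 t : 0 <= t <= T -> eta' t <= 0.
  move=> /andP[t0 _]; rewrite etaE//.
  have h1 : 0 <= k * eta t by rewrite mulr_ge0.
  have h2 : 0 <= E t * kern d (t - a) by rewrite mulr_ge0// expR_ge0.
  lra.
have tail t : a + d <= t <= T -> eta' t + k * eta t = 0.
  move=> /andP[t1 _]; rewrite etaE; last by lra.
  rewrite (kern_geh d)//; first by ring.
  by lra.
have := kato T (a + d) u0 v0 u v eta eta' T0 Su Sv Ceta beta beta' eta0 eta'0 adT tail.
have -> : eta 0 = 1.
  rewrite /eta /E mulr0 expR0 step_ge1; last by lra.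
  rewrite sub0r step_le0 ?subr0 ?mulr1//.
  by rewrite pmulr_lle0 ?invr_gt0//; lra.
rewrite mul1r -/k; apply: le_trans.
have bW : bm (fun p : R * R => `|u p.1 p.2 - v p.1 p.2|) by bm_tac.
rewrite strip_int_swapxt; last first.
  apply: bmM bW; apply: bmN; apply: bmD; first exact: (bm_comp _ _ beta').
  by apply: bmM; [exact: bm_cst|exact: (bm_comp _ _ beta)].
rewrite le_eqVlt; apply/orP; left; apply/eqP; apply: eq_int1 => t /andP[t0 _] /=.
rewrite int1Zl; last exact: (bm_t _ t bW).
by congr (_ * _); rewrite etaE// /E; ring.
Qed.

(** Weak-* continuity makes A only lower semicontinuous, and this is enough: [B] is continuous, lies
    below [A] and touches it at t0. If exp(- k t0) A(t0) exceeded the initial distance, exp(- k t)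
    A(t) would stay above a larger constant on a short interval, contradicting [kato_bump] for a
    bump of unit mass there. *)
Lemma l1_contraction_bounded {R : realType} (T t0 : R) (u0 v0 : R -> R) (u v : R -> R -> R) :
  0 < T -> 0 <= t0 <= T -> bounded_solution T u0 u -> bounded_solution T v0 v ->
  \int[@lebesgue_measure R]_(x in `[0, 1]) `|u x t0 - v x t0| <=
  expR (t0 * Kp_Linf_norm) * \int[@lebesgue_measure R]_(x in `[0, 1]) `|u0 x - v0 x|.
Proof.
move=> T0 /andP[t00 t0T] Su Sv; have [bu _ cu _] := Su; have [bv _ cv _] := Sv.
set k := Kp_Linf_norm; set A0 := (X in _ <= _ * X).
pose A t := \int[@lebesgue_measure R]_(x in `[0, 1]) `|u x t - v x t|.
rewrite -/(A t0).
suff key : expR (- k * t0) * A t0 <= A0.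
  have := ler_wpM2l (expR_ge0 (t0 * k)) key.
  by rewrite mulrA -expRD mulNr (mulrC k) subrr expR0 mul1r.
rewrite leNgt; apply/negP => ltA.
have but t : bm (fun x : R => u x t) by exact: (bm_t (fun p => u p.1 p.2)).
have bvt t : bm (fun x : R => v x t) by exact: (bm_t (fun p => v p.1 p.2)).
pose g (x : R) := Num.sg (u x t0 - v x t0).
have bg : bm (fun x : R => g x) by apply: bm_sgn; exact: bmB.
pose B t := \int[@lebesgue_measure R]_(x in `[0, 1]) (u x t * g x)
          - \int[@lebesgue_measure R]_(x in `[0, 1]) (v x t * g x).
have BE t : B t = \int[@lebesgue_measure R]_(x in `[0, 1]) (u x t * g x - v x t * g x).
  by rewrite int1B//; exact: bmM.
have BA t : B t <= A t.
  rewrite BE; apply: le_int1.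
  - by apply: bmB; exact: bmM.
  - by apply: bm_norm; exact: bmB.
  - move=> x _; rewrite -mulrBl; apply: le_trans (ler_norm _) _.
    rewrite normrM /g normr_sg; case: (_ == 0); rewrite /= ?mulr0 ?mulr1//.
have BA0 : B t0 = A t0.
  by rewrite BE; apply: eq_int1 => x _; rewrite -mulrBl mulrC -normrEsg.
pose H t := expR (- k * t) * B t.
have cH : {within `[0, T], continuous H}.
  move=> t; apply: cvgM.
    apply: (@continuous_subspaceT _ _ _ (fun t => expR (- k * t))) => s.
    apply: (@continuous_comp _ _ _ (fun t => - k * t) expR); last exact: continuous_expR.
    by apply: cvgMr; exact: cvg_id.
  by apply: cvgB; [exact: cu|exact: cv].
have t0I : t0 \in `[0, T] by rewrite in_itv/= t00.
have c0 : 0 < H t0 - A0 by rewrite subr_gt0 /H BA0.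
have c2 : 0 < (H t0 - A0) / 2 by lra.
have [d d0 Hd] := within_continuousP _ _ _ _ cH t0I _ c2.
pose m := Num.min d T.
have md : m <= d by rewrite ge_min lexx.
have mT : m <= T by rewrite ge_min lexx orbT.
have m0 : 0 < m by rewrite lt_min d0 T0.
(* The interval starts at t0 in the first half of [0, T] and otherwise ends at t0 - m / 4, so that
   it stays in [0, T) even for t0 = 0 or t0 = T. *)
have [a [a0 adT near_a]] : exists a, [/\ 0 <= a, a + m / 4 < T &
    forall s, a <= s <= a + m / 4 -> `|s - t0| < d].
  have [tT|tT] := leP t0 (T / 2).
    exists t0; split; [by []|lra|move=> s /andP[s1 s2]].
    by rewrite ltr_norml; apply/andP; split; lra.
  exists (t0 - m / 2); split; [lra|lra|move=> s /andP[s1 s2]].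
  by rewrite ltr_norml; apply/andP; split; lra.
have dd0 : 0 < m / 4 by lra.
have := kato_bump T a (m / 4) u0 v0 u v a0 dd0 adT Su Sv; rewrite -/A0 -/k.
apply/negP; rewrite -ltNge.
have ker0 r : 0 <= kern (m / 4) r by case/andP: (kern_itv (m / 4) r dd0).
have bk : bm (fun s : R => kern (m / 4) (s - a)) by apply: bm_shift'; exact: bm_kern.
apply: (@lt_le_trans _ _ ((A0 + (H t0 - A0) / 2) * \int[@lebesgue_measure R]_(s in `[0, T]) kern (m / 4) (s - a))).
  rewrite kern_mass ?(ltW T0)// step_ge1 ?mulr1; first by lra.
  by rewrite ler_pdivlMr// mul1r; lra.
have bA : bm (fun t : R => A t).
  have bW : bm (fun p : R * R => `|u p.1 p.2 - v p.1 p.2|) by bm_tac.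
  apply: (bm_int1 0 1 (fun t z => `|u z t - v z t|)).
  by apply: (bm_comp _ (fun p : R * R => (p.2, p.1)) bW); exact: measurable_fun_pair.
(* The exponential is unbounded on the negative axis; [Num.max 0 t] changes nothing on [0, T] and
   gives a member of [bm]. *)
have bE : bm (fun t : R => expR (- k * Num.max 0 t)).
  split.
    apply: measurableT_comp => //; apply: measurable_funM => //.
    exact: measurable_maxr.
  exists 1 => t; rewrite ger0_norm ?expR_ge0// -expR0 ler_expR.
  have : 0 <= k by exact: Kp_Linf_norm_ge0.
  have : 0 <= Num.max 0 t by rewrite le_max lexx.
  nra.
rewrite -int1Zl//.
rewrite [leRHS](@eq_int1 _ _ _ _ (fun t => expR (- k * Num.max 0 t) * kern (m / 4) (t - a) * A t)); last first.
  by move=> t /andP[t1 _]; rewrite max_r.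
apply: le_int1.
- by apply: bmM => //; exact: bm_cst.
- by apply: bmM => //; exact: bmM.
- move=> s /andP[s0 sT]; rewrite max_r//.
  have [sa|sa] := leP (s - a) 0; first by rewrite kern_le0// !mulr0 mul0r.
  have [sb|sb] := leP (m / 4) (s - a); first by rewrite kern_geh// !mulr0 mul0r.
  rewrite mulrAC; apply: ler_wpM2r => //.
  have sI : s \in `[0, T] by rewrite in_itv/= s0.
  have := Hd s sI (near_a s _); rewrite ltr_norml.
  have sab : a <= s <= a + m / 4 by apply/andP; split; lra.
  move=> /(_ sab) /andP[H1 _].
  have H2 : H s <= expR (- k * s) * A s by apply: ler_wpM2l => //; exact: expR_ge0.
  by lra.
Qed.

(** * Reduction to bounded solutions *)

(** Tonelli for the indicator of a null set: the measures of its sections integrate to 0, so almost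
    all of them are 0. *)
Lemma ae_ysection {d1 d2} {T1 : measurableType d1} {T2 : measurableType d2} {R : realType}
  (m1 : {sigma_finite_measure set T1 -> \bar R}) (m2 : {sigma_finite_measure set T2 -> \bar R})
  (P : T1 * T2 -> Prop) :
  {ae (m1 \x m2)%E, forall p, P p} -> {ae m2, forall t, {ae m1, forall x, P (x, t)}}.
Proof.
move=> [N [mN N0 sN]].
have mf : measurable_fun setT (EFin \o (\1_N : T1 * T2 -> R)).
  by apply/measurable_EFinP; exact: measurable_indic.
have f0 p : (0 <= (EFin \o (\1_N : T1 * T2 -> R)) p)%E by rewrite lee_fin.
have e0 := fubini_tonelli2 (m1 := m1) (m2 := m2) _ mf f0.
have i0 : (\int[m1 \x m2]_z (EFin \o (\1_N : T1 * T2 -> R)) z = 0)%E.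
  by rewrite -[RHS]N0 -[in RHS](setIT N); exact: integral_indic.
rewrite i0 in e0.
have mG := measurable_fun_fubini_tonelli_G (m1 := m1) _ mf f0.
rewrite indic_fubini_tonelli_GE// in e0 mG.
have : (\int[m2]_(y in setT) `|(m1 \o ysection N) y| = 0)%E.
  by rewrite [RHS]e0; apply: eq_integral => y _; rewrite gee0_abs.
move/(ae_eq_integral_abs m2 measurableT mG).
apply: filterS => t /= /(_ I) Nt.
exists (ysection N t); split => //; first exact: measurable_ysection.
by move=> x /= nP; rewrite /ysection /= inE; exact: sN.
Qed.

Lemma Rintegral_le0_ae {d} {T : measurableType d} {R : realType}
  (mu : {measure set T -> \bar R}) (D : set T) (f : T -> R) :
  findom mu D -> bm f -> (forall x, 0 <= f x) -> \int[mu]_(x in D) f x <= 0 ->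
  {ae mu, forall x, D x -> f x = 0}.
Proof.
move=> FD bf f0 If; have [mD _] := FD.
have mf : measurable_fun D (EFin \o f).
  by apply/measurable_EFinP; apply: measurable_funTS; case: bf.
have E : (\int[mu]_(x in D) `|(EFin \o f) x| = 0)%E.
  have -> : (\int[mu]_(x in D) `|(EFin \o f) x| = (\int[mu]_(x in D) f x)%R%:E)%E.
    rewrite fineK; last by apply: integrable_fin_num => //; exact: bm_integrable.
    by apply: eq_integral => x _; rewrite gee0_abs// lee_fin.
  congr EFin; apply/eqP; rewrite eq_le If/=; exact: Rintegral_ge0.
move/(ae_eq_integral_abs mu mD mf): E.
by apply: filterS => x /= /[apply] -[].
Qed.

(** Alters a function only where an almost everywhere bound fails, hence on a null set, and makes
    the bound hold everywhere. *)
Definition trunc {R : realType} (M r : R) : R := if `|r| <= M then r else 0.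

Lemma trunc_id {R : realType} (M r : R) : `|r| <= M -> trunc M r = r.
Proof. by rewrite /trunc => ->. Qed.

Lemma trunc_le {R : realType} (M r : R) : 0 <= M -> `|trunc M r| <= M.
Proof. by rewrite /trunc; case: ifP => // _; rewrite normr0. Qed.

Lemma measurable_trunc {R : realType} (M : R) : measurable_fun setT (trunc M).
Proof.
apply: measurable_fun_ifT => //; apply: measurable_fun_ler => //.
Qed.

Lemma bm_trunc {d} {T : measurableType d} {R : realType} (M : R) (f : T -> R) :
  0 <= M -> measurable_fun setT f -> bm (fun x => trunc M (f x)).
Proof.
move=> M0 mf; split; first by apply: measurableT_comp => //; exact: measurable_trunc.
by exists M => x; exact: trunc_le.
Qed.

Lemma int1_ae_eq {R : realType} (a b : R) (f g : R -> R) :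
  measurable_fun setT f -> measurable_fun setT g ->
  {ae @lebesgue_measure R, forall x, a <= x <= b -> f x = g x} ->
  \int[@lebesgue_measure R]_(x in `[a, b]) f x = \int[@lebesgue_measure R]_(x in `[a, b]) g x.
Proof.
move=> mf mg fg; apply: Rintegral_ae_eq => //; exact: measurable_funTS.
Qed.

Lemma Linf_T_bound {R : realType} (f : R -> R) : Linf_T f ->
  measurable_fun setT f /\ exists2 M : R, 0 <= M & {ae @lebesgue_measure R, forall x, `|f x| <= M}.
Proof.
move=> [_ [mf [M fM]]]; split => //; exists `|M| => //.
apply: (ae_mono (@lebesgue_measure R) _ _ _ fM) => x fx.
exact: le_trans fx (ler_norm _).
Qed.

Lemma exists_subitv {R : realType} (T t0 d : R) : 0 < T -> 0 <= t0 <= T -> 0 < d ->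
  exists a b, [/\ a < b, 0 <= a, b <= T & forall s, a < s < b -> `|s - t0| < d].
Proof.
move=> T0 /andP[t00 t0T] d0.
pose m := Num.min d T.
have md : m <= d by rewrite ge_min lexx.
have mT : m <= T by rewrite ge_min lexx orbT.
have m0 : 0 < m by rewrite lt_min d0 T0.
have [tT|tT] := leP t0 (T / 2).
  exists t0, (t0 + m / 2); split; [lra|by []|lra|move=> s /andP[s1 s2]].
  by rewrite ltr_norml; apply/andP; split; lra.
exists (t0 - m / 2), t0; split; [lra|lra|by []|move=> s /andP[s1 s2]].
by rewrite ltr_norml; apply/andP; split; lra.
Qed.

(* Weak-* continuity in time upgrades the essential bound on the strip to every
   single time: test u(., t0) against its sign on the set where the bound fails *)
Lemma weak_star_bound {R : realType} (T M : R) (u : R -> R -> R) (t0 : R) :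
  0 < T -> 0 <= M ->
  {ae (@lebesgue_measure R \x @lebesgue_measure R)%E, forall p : R * R,
      p \in [set: R] `*` `[0, T] -> `|u p.1 p.2| <= M} ->
  (forall t, t \in `[0, T] -> Linf_T (fun x => u x t)) ->
  (forall g : R -> R, (@lebesgue_measure R).-integrable `[0, 1] (fun x => (g x)%:E) ->
     {within `[0, T], continuous (fun t => \int[@lebesgue_measure R]_(x in `[0, 1]) (u x t * g x))}) ->
  0 <= t0 <= T ->
  {ae @lebesgue_measure R, forall x, 0 <= x <= 1 -> `|u x t0| <= M}.
Proof.
move=> T0 M0 uM uL uc t0T.
have inT t : 0 <= t <= T -> t \in `[0, T] by move=> tT; rewrite in_itv.
have good : {ae @lebesgue_measure R, forall t, {ae @lebesgue_measure R, forall x,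
    0 <= t <= T -> `|u x t| <= M}}.
  have := ae_ysection (@lebesgue_measure R) (@lebesgue_measure R)
    (fun p => p \in [set: R] `*` `[0, T] -> `|u p.1 p.2| <= M) uM.
  apply: ae_mono => t; apply: ae_mono => x h tT; apply: h.
  by apply/mem_set; split => //=; exact: inT.
have [mu0 [M1 M10 u0M1]] := Linf_T_bound _ (uL t0 (inT _ t0T)).
(* The sign of u(., t0) on the set where the bound fails and 0 elsewhere, so that a positive excess
   of |u(., t0)| over M would show as B t0 > Q. *)
pose g (x : R) : R := Num.sg (u x t0) * (if `|u x t0| <= M then 0 else 1).
have bg : bm g.
  apply: bmM; first exact: bm_sg.
  split; last by exists 1 => x; case: ifP => _; rewrite ?normr0 ?normr1.
  apply: measurable_fun_ifT => //; apply: measurable_fun_ler => //.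
  exact: measurableT_comp.
have bng : bm (fun x : R => `|g x|) by exact: bm_norm.
pose B t := \int[@lebesgue_measure R]_(x in `[0, 1]) (u x t * g x).
pose Q := \int[@lebesgue_measure R]_(x in `[0, 1]) (M * `|g x|).
have cB : {within `[0, T], continuous B} by apply: uc; exact: integrable1.
have BE t K : 0 <= t <= T -> {ae @lebesgue_measure R, forall x, `|u x t| <= K} ->
    B t = \int[@lebesgue_measure R]_(x in `[0, 1]) (trunc K (u x t) * g x).
  move=> tT uK; have [mut _] := Linf_T_bound _ (uL t (inT _ tT)).
  apply: int1_ae_eq.
  - by apply: measurable_funM => //; case: bg.
  - apply: measurable_funM => //; last by case: bg.
    by apply: measurableT_comp => //; exact: measurable_trunc.
  - apply: (ae_mono (@lebesgue_measure R) _ _ _ uK) => x ux _; by rewrite trunc_id.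
have BQ t : 0 <= t <= T -> {ae @lebesgue_measure R, forall x, `|u x t| <= M} -> B t <= Q.
  move=> tT uMt; rewrite (BE t M)//; have [mut _] := Linf_T_bound _ (uL t (inT _ tT)).
  have bt : bm (fun x : R => trunc M (u x t)) by exact: bm_trunc.
  apply: le_int1; [exact: bmM|by apply: bmM => //; exact: bm_cst|].
  move=> x _; apply: le_trans (ler_norm _) _; rewrite normrM; apply: ler_wpM2r => //.
  exact: trunc_le.
have B0Q : B t0 <= Q.
  rewrite leNgt; apply/negP => ltQ.
  have c0 : 0 < B t0 - Q by rewrite subr_gt0.
  have [d d0 Hd] := within_continuousP _ _ _ _ cB (inT _ t0T) _ c0.
  have [a [b [ab a0 bT near_t0]]] := exists_subitv T t0 d T0 t0T d0.
  have [s [sab us]] := ae_exists_itv a b _ ab good.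
  have sT : 0 <= s <= T by move: sab => /andP[s1 s2]; apply/andP; split; lra.
  have := BQ s sT; have := Hd s (inT _ sT) (near_t0 s sab).
  rewrite ltr_norml => /andP[h1 _] h2.
  have : B s <= Q by apply: h2; apply: (ae_mono (@lebesgue_measure R) _ _ _ us) => x; exact.
  by lra.
have bt1 : bm (fun x : R => trunc M1 (u x t0)) by exact: bm_trunc.
(* Almost everywhere this is the positive part of |u(., t0)| - M, and its integral is B t0 - Q. The
   bound [M1], special to time t0, only serves to make the integrands bounded. *)
pose f (x : R) := Num.max 0 (trunc M1 (u x t0) * g x - M * `|g x|).
have bf' : bm (fun x : R => trunc M1 (u x t0) * g x - M * `|g x|).
  by apply: bmB; apply: bmM => //; exact: bm_cst.
have bf : bm f.
  have [mf' [K fK]] := bf'; split; first exact: measurable_maxr.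
  exists K => x; rewrite ger0_norm; last by rewrite le_max lexx.
  by rewrite ge_max (le_trans _ (fK x))//= (le_trans (ler_norm _) (fK x)).
have gE x : u x t0 * g x - M * `|g x| = if `|u x t0| <= M then 0 else `|u x t0| - M.
  rewrite /g; case: (leP `|u x t0| M) => h; first by rewrite !mulr0 normr0 mulr0 subrr.
  have un0 : u x t0 != 0 by rewrite -normr_gt0; exact: le_lt_trans h.
  by rewrite !mulr1 mulrC -normrEsg normr_sg un0 mulr1.
have f_le0 : \int[@lebesgue_measure R]_(x in `[0, 1]) f x <= 0.
  have -> : \int[@lebesgue_measure R]_(x in `[0, 1]) f x =
     \int[@lebesgue_measure R]_(x in `[0, 1]) (trunc M1 (u x t0) * g x - M * `|g x|).
    apply: int1_ae_eq; [by case: bf|by case: bf'|].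
    apply: (ae_mono (@lebesgue_measure R) _ _ _ u0M1) => x ux _.
    rewrite /f trunc_id// gE max_r//; case: (leP `|u x t0| M) => // h.
    by rewrite subr_ge0 ltW.
  rewrite int1B; [|exact: bmM|by apply: bmM => //; exact: bm_cst].
  by rewrite -(BE t0 M1)// subr_le0.
have f_ge0 x : 0 <= f x by rewrite le_max lexx.
have fae := Rintegral_le0_ae (@lebesgue_measure R) `[0, 1] f (findom_itv 0 1) bf f_ge0 f_le0.
apply: (ae_mono2 (@lebesgue_measure R) _ _ _ _ fae u0M1) => x fx ux x01.
have : f x = 0 by apply: fx; rewrite /= in_itv.
rewrite /f trunc_id// gE; case: (leP `|u x t0| M) => // h.
by rewrite max_r ?subr_ge0 ?(ltW h)// => e; lra.
Qed.

(** Set to 0 for times outside [0, T] before truncation, because u is known to be measurable on the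
    strip only. *)
Definition truncate_solution {R : realType} (T M : R) (u : R -> R -> R) (x t : R) : R :=
  trunc M (((fun p : R * R => u p.1 p.2) \_ ([set: R] `*` `[0, T])) (x, t)).

Lemma truncate_solutionE {R : realType} (T M : R) (u : R -> R -> R) (x t : R) :
  0 <= t <= T -> truncate_solution T M u x t = trunc M (u x t).
Proof.
move=> tT; have xtD : ([set: R] `*` `[0, T]) (x, t) by split; rewrite //= in_itv.
by rewrite /truncate_solution patchE (mem_set xtD).
Qed.

Lemma bm_truncate_solution {R : realType} (T M : R) (u : R -> R -> R) : 0 <= M ->
  measurable_fun ([set: R] `*` `[0, T]) (fun p : R * R => u p.1 p.2) ->
  bm (fun p : R * R => truncate_solution T M u p.1 p.2).
Proof.
move=> M0 mu; apply: (bm_trunc M (fun p : R * R =>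
  ((fun p : R * R => u p.1 p.2) \_ ([set: R] `*` `[0, T])) (p.1, p.2)) M0).
have mD : measurable ([set: R] `*` `[0, T]) by exact: measurableX.
suff -> : (fun p : R * R => ((fun p : R * R => u p.1 p.2) \_ ([set: R] `*` `[0, T])) (p.1, p.2)) =
    (fun p : R * R => u p.1 p.2) \_ ([set: R] `*` `[0, T]).
  by apply/(measurable_restrictT _ _).1.
by apply/funext => -[].
Qed.

Lemma truncate_initial {R : realType} (u0 : R -> R) (M : R) (w : R -> R) (lam : R) :
  measurable_fun setT u0 -> 0 <= M ->
  {ae @lebesgue_measure R, forall x, `|u0 x| <= M} -> bm w ->
  (\int[@lebesgue_measure R]_(x in `[0%R, 1%R]) (`|u0 x - lam| * w x)%:E =
   (\int[@lebesgue_measure R]_(x in `[0%R, 1%R]) (`|trunc M (u0 x) - lam| * w x)%R)%:E)%E.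
Proof.
move=> mu0 M0 u0M bw.
have bt : bm (fun x : R => `|trunc M (u0 x) - lam| * w x).
  by apply: bmM => //; apply: bm_norm; apply: bmB; [exact: bm_trunc|exact: bm_cst].
have fI := findom_itv (0 : R) 1; have [mI _] := fI.
rewrite fineK; last by apply: integrable_fin_num => //; exact: integrable1.
apply: ae_eq_integral => //.
- apply/measurable_EFinP; apply: measurable_funTS; apply: measurable_funM; last by case: bw.
  by apply: measurableT_comp => //; exact: measurable_funB.
- by apply/measurable_EFinP; apply: measurable_funTS; case: bt.
- by apply: (ae_mono (@lebesgue_measure R) _ _ _ u0M) => x ux _; rewrite trunc_id.
Qed.

(** Equality almost everywhere in the plane handles the local terms of the entropy inequality, but
    the continuity in time and the convolution see individual times. For these [weak_star_bound]
    shows that truncation alters every section u(., t) only on a null subset of [0, 1]. *)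
Lemma truncate_bounded_solution {R : realType} (T : R) (u0 : R -> R) (u : R -> R -> R) :
  0 < T -> Linf_T u0 -> weak_entropy_solution T u0 u ->
  exists M M0 : R,
    [/\ {ae @lebesgue_measure R, forall x, `|u0 x| <= M0}, 0 <= M0,
      forall t, 0 <= t <= T -> {ae @lebesgue_measure R, forall x, 0 <= x <= 1 -> `|u x t| <= M}
    & bounded_solution T (fun x => trunc M0 (u0 x)) (truncate_solution T M u)].
Proof.
move=> T0 Lu0 [_ [mu [[M' uM'] [uL [uc Eu]]]]].
have [mu0 [M0 M00 u0M0]] := Linf_T_bound _ Lu0.
pose M := `|M'|; have Mge0 : 0 <= M by exact: normr_ge0.
have uM : {ae (@lebesgue_measure R \x @lebesgue_measure R)%E, forall p : R * R,
      p \in [set: R] `*` `[0, T] -> `|u p.1 p.2| <= M}.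
  apply: (ae_mono (@lebesgue_measure R \x @lebesgue_measure R)%E _ _ _ uM') => p h pD.
  exact: le_trans (h pD) (ler_norm _).
have ut t : 0 <= t <= T -> {ae @lebesgue_measure R, forall x, 0 <= x <= 1 -> `|u x t| <= M}.
  by move=> tT; exact: (weak_star_bound T M u t T0 Mge0 uM uL uc tT).
have inT t : 0 <= t <= T -> t \in `[0, T] by move=> tT; rewrite in_itv.
exists M, M0; split => //.
set v := truncate_solution T M u.
have bv : bm (fun p : R * R => v p.1 p.2) by exact: bm_truncate_solution.
have bvt t : bm (fun x : R => v x t) by exact: (bm_t (fun p => v p.1 p.2)).
have uvt (g : R -> R) t : 0 <= t <= T -> bm g ->
    \int[@lebesgue_measure R]_(x in `[0, 1]) (u x t * g x) =
    \int[@lebesgue_measure R]_(x in `[0, 1]) (v x t * g x).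
  move=> tT bg; have [mut _] := Linf_T_bound _ (uL t (inT _ tT)).
  have [mg _] := bg; have [mvt _] := bvt t.
  apply: int1_ae_eq; [exact: measurable_funM|exact: measurable_funM|].
  apply: (ae_mono (@lebesgue_measure R) _ _ _ (ut t tT)) => x ux x01.
  by rewrite /v truncate_solutionE// trunc_id// ux.
split => //.
- exact: bm_trunc.
- move=> g bg; apply: (subspace_eq_continuous _ (uc g (integrable1 0 1 g bg))).
  by move=> t /set_mem tT; apply: uvt => //; move: tT; rewrite /= in_itv.
move=> lam a a' b b' Ca Cb ba ba' bb bb' pa a0 b0 bsupp.
have tf := test_fun_prod a a' b b' Ca Cb pa a0 b0 bsupp.
have := Eu lam _ _ _ tf.
have baw : bm (fun x : R => a x * b 0) by apply: bmM => //; exact: bm_cst.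
rewrite (truncate_initial u0 M0 _ lam mu0 M00 u0M0 baw).
have bKv := bm_Kconv v bv.
have ba1 : bm (fun p : R * R => a p.1) by exact: (bm_comp _ _ ba).
have ba1' : bm (fun p : R * R => a' p.1) by exact: (bm_comp _ _ ba').
have bb2 : bm (fun p : R * R => b p.2) by exact: (bm_comp _ _ bb).
have bb2' : bm (fun p : R * R => b' p.2) by exact: (bm_comp _ _ bb').
have bF : bm (flux_integrand v lam a a' b b') by rewrite /flux_integrand; bm_tac.
have fP := findom_prod (@lebesgue_measure R) (@lebesgue_measure R) _ _ (findom_itv 0 1) (findom_itv 0 T).
have [mP _] := fP.
(* [F] is an intermediate integrand: u extended by 0 in the local terms, the truncated function in
   the convolution. It equals the entropy integrand at every point of the domain, is measurable on
   the plane, and agrees with the truncated integrand almost everywhere. *)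
pose U (p : R * R) : R := ((fun p : R * R => u p.1 p.2) \_ ([set: R] `*` `[0, T])) p.
have mU : measurable_fun setT U.
  by apply/(measurable_restrictT _ _).1 => //; exact: measurableX.
have UE x t : 0 <= t <= T -> U (x, t) = u x t.
  move=> tT; have xtD : ([set: R] `*` `[0, T]) (x, t) by split; rewrite //= in_itv.
  by rewrite /U patchE (mem_set xtD).
pose F (p : R * R) : R := `|U p - lam| * (a p.1 * b' p.2)
  + Num.sg (U p - lam) * ((U p ^+ 2 - lam ^+ 2) / 2) * (a' p.1 * b p.2)
  - Num.sg (U p - lam) * Kconv v p * (a p.1 * b p.2).
have mF : measurable_fun setT F.
  have mUl : measurable_fun setT (fun p => U p - lam) by exact: measurable_funB.
  have msg : measurable_fun setT (fun p => Num.sg (U p - lam)) by case: (bm_sg _ mUl).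
  have m1 : measurable_fun setT (fun p : R * R => a p.1 * b' p.2) by case: (bmM _ _ ba1 bb2').
  have m2 : measurable_fun setT (fun p : R * R => a' p.1 * b p.2) by case: (bmM _ _ ba1' bb2).
  have m3 : measurable_fun setT (fun p : R * R => a p.1 * b p.2) by case: (bmM _ _ ba1 bb2).
  have m4 : measurable_fun setT (Kconv v) by case: bKv.
  have m5 : measurable_fun setT (fun p => (U p ^+ 2 - lam ^+ 2) / 2).
    apply: measurable_funM => //; apply: measurable_funB => //; exact: measurable_funX.
  apply: measurable_funB; last by apply: measurable_funM => //; exact: measurable_funM.
  apply: measurable_funD; last by apply: measurable_funM => //; exact: measurable_funM.
  by apply: measurable_funM => //; exact: measurableT_comp.
have Keq x t : 0 <= x <= 1 -> 0 <= t <= T ->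
    convT Kp (fun y => u y t - lam) x = Kconv v (x, t).
  move=> x01 tT; rewrite /Kconv /convT /=.
  have [mut _] := Linf_T_bound _ (uL t (inT _ tT)).
  have bKx : bm (fun z : R => Kp (x - z)) by apply: bm_shift; exact: bm_Kp.
  have [mKx _] := bKx; have [mvt _] := bvt t.
  have -> : \int[@lebesgue_measure R]_(y in `[0, 1]) (Kp (x - y) * (u y t - lam)) =
     \int[@lebesgue_measure R]_(y in `[0, 1]) (Kp (x - y) * v y t - lam * Kp (x - y)).
    apply: int1_ae_eq.
    - by apply: measurable_funM => //; exact: measurable_funB.
    - by apply: measurable_funB; exact: measurable_funM.
    - apply: (ae_mono (@lebesgue_measure R) _ _ _ (ut t tT)) => y uy y01.
      by rewrite /v truncate_solutionE// trunc_id ?uy//; ring.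
  rewrite int1B; [|exact: bmM|by apply: bmM => //; exact: bm_cst].
  by rewrite int1Zl// Kp_mean0// mulr0 subr0.
have -> : (\int[(@lebesgue_measure R \x @lebesgue_measure R)%E]_(p in `[0%R, 1%R] `*` `[0%R, T])
    (entropy_integrand u lam (fun x t => a x * b t) (fun x t => a' x * b t)
       (fun x t => a x * b' t) p)%:E = (strip_int T (flux_integrand v lam a a' b b'))%:E)%E.
  rewrite -strip_int_prodE// fineK; last first.
    by apply: integrable_fin_num => //; exact: bm_integrable fP bF.
  transitivity (\int[(@lebesgue_measure R \x @lebesgue_measure R)%E]_(p in `[0%R, 1%R] `*` `[0%R, T]) (F p)%:E)%E.
    apply: eq_integral => -[x t] /set_mem[]; rewrite /= !in_itv/= => x01 tT.
    by rewrite /entropy_integrand /F /= UE// Keq.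
  apply: ae_eq_integral => //.
  - by apply/measurable_EFinP; exact: measurable_funTS.
  - by apply/measurable_EFinP; apply: measurable_funTS; case: bF.
  - apply: (ae_mono (@lebesgue_measure R \x @lebesgue_measure R)%E _ _ _ uM) => -[x t] ux [].
    rewrite /= !in_itv/= => x01 tT; congr EFin.
    have ux' : `|u x t| <= M by apply: ux; apply/mem_set; split => //=; rewrite in_itv.
    by rewrite /F /flux_integrand /= UE// /v truncate_solutionE// trunc_id.
by rewrite -EFinD lee_fin.
Qed.

Theorem theorem1 (R : realType) (T : R) (u0 v0 : R -> R) (u v : R -> R -> R) :
  0 < T ->
  Linf_T u0 -> Linf_T v0 ->
  weak_entropy_solution T u0 u ->
  weak_entropy_solution T v0 v ->
  forall t : R, t \in `[0, T] ->
  (\int[@lebesgue_measure R]_(x in `[0%R, 1%R]) (`|u x t - v x t|)%:E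
     <= (expR (t * Kp_Linf_norm))%:E
        * \int[@lebesgue_measure R]_(x in `[0%R, 1%R]) (`|u0 x - v0 x|)%:E)%E.
Proof.
move=> T0 Lu0 Lv0 Su Sv t tT.
have tT' : 0 <= t <= T by move: tT; rewrite in_itv.
have [M [M0 [u0M M00 uM bu]]] := truncate_bounded_solution T u0 u T0 Lu0 Su.
have [N [N0 [v0N N00 vN bv]]] := truncate_bounded_solution T v0 v T0 Lv0 Sv.
have [_ [_ [_ [uL _]]]] := Su; have [_ [_ [_ [vL _]]]] := Sv.
have [mut _] := Linf_T_bound _ (uL t tT); have [mvt _] := Linf_T_bound _ (vL t tT).
have [mu0 _] := Linf_T_bound _ Lu0; have [mv0 _] := Linf_T_bound _ Lv0.
have fI := findom_itv (0 : R) 1; have [mI _] := fI.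
(* The claim is stated in the extended reals; replacing both pairs of functions by bounded ones
   makes the integrals finite and reduces it to an inequality between real numbers. *)
have eqi (f g f' g' : R -> R) : measurable_fun setT f -> measurable_fun setT g ->
    bm f' -> bm g' ->
    {ae @lebesgue_measure R, forall x, 0 <= x <= 1 -> f x = f' x} ->
    {ae @lebesgue_measure R, forall x, 0 <= x <= 1 -> g x = g' x} ->
    (\int[@lebesgue_measure R]_(x in `[0%R, 1%R]) (`|f x - g x|)%:E =
     (\int[@lebesgue_measure R]_(x in `[0%R, 1%R]) (`|f' x - g' x|)%R)%:E)%E.
  move=> mf mg bf' bg' ff' gg'.
  have bd : bm (fun x : R => `|f' x - g' x|) by apply: bm_norm; exact: bmB.
  rewrite fineK; last by apply: integrable_fin_num => //; exact: integrable1.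
  apply: ae_eq_integral => //.
  - apply/measurable_EFinP; apply: measurable_funTS; apply: measurableT_comp => //.
    exact: measurable_funB.
  - by apply/measurable_EFinP; apply: measurable_funTS; case: bd.
  - apply: (ae_mono2 (@lebesgue_measure R) _ _ _ _ ff' gg') => x h1 h2.
    by rewrite /= in_itv/= => x01; rewrite h1// h2.
have [bu1 bu2 _ _] := bu; have [bv1 bv2 _ _] := bv.
rewrite (eqi _ _ (fun x => truncate_solution T M u x t) (fun x => truncate_solution T N v x t))//.
- rewrite (eqi u0 v0 (fun x => trunc M0 (u0 x)) (fun x => trunc N0 (v0 x)))//.
  + by rewrite -EFinM lee_fin; exact: (l1_contraction_bounded T t _ _ _ _ T0 tT' bu bv).
  + by apply: (ae_mono (@lebesgue_measure R) _ _ _ u0M) => x ux _; rewrite trunc_id.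
  + by apply: (ae_mono (@lebesgue_measure R) _ _ _ v0N) => x ux _; rewrite trunc_id.
- exact: (bm_t (fun p => truncate_solution T M u p.1 p.2)).
- exact: (bm_t (fun p => truncate_solution T N v p.1 p.2)).
- apply: (ae_mono (@lebesgue_measure R) _ _ _ (uM t tT')) => x ux x01.
  by rewrite truncate_solutionE// trunc_id// ux.
- apply: (ae_mono (@lebesgue_measure R) _ _ _ (vN t tT')) => x ux x01.
  by rewrite truncate_solutionE// trunc_id// ux.
Qed.
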